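(* Let $n\geqslant 2$ be an integer, $s\in(0,1)$, $\alpha\in(0,n)$, and $p_*=\frac{n+\alpha}{n-2s}$. Suppose $u\in \mathcal{C}^{1,1}_{\mathrm{loc}}(\mathbb{R}^{n}\setminus\{0\})\cap L_{s}(\mathbb{R}^{n})\cap L^{1}_{\mathrm{loc}}(\mathbb{R}^{n})$ is a positive solution to $$(-\Delta)^s u=\big(\mathcal{R}_\alpha*u^{p_*}\big)u^{p_*-1}\quad\text{in }\mathbb{R}^n\setminus\{0\}$$ with a non-removable singularity at the origin. Then $u$ is radially symmetric with respect to the origin.
   Context: Here $\mathcal{R}_\alpha(x)=|x|^{\alpha-n}$, so $(\mathcal{R}_\alpha*u^{p_*})(x)=\int_{\mathbb{R}^n}|x-y|^{\alpha-n}u(y)^{p_*}\,dy$. The fractional Laplacian is $$(-\Delta)^{s}u(x)=\kappa_{n,s}\,\mathrm{P.V.}\int_{\mathbb{R}^{n}}\frac{u(x)-u(x+y)}{|y|^{n+2s}}\,dy,\qquad \kappa_{n,s}=\pi^{-n/2}2^{2s}\frac{\Gamma(\frac{n+2s}{2})}{\Gamma(1-s)}s,$$ and $L_s(\mathbb{R}^n)=\{u:\int_{\mathbb{R}^n}\frac{|u(y)|}{1+|y|^{n+2s}}\,dy<+\infty\}$. The equation is understood pointwise in $\mathbb{R}^n\setminus\{0\}$. The singularity at the origin is non-removable if $u$ cannot be extended to a continuous function on $\mathbb{R}^n$. *)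

(* Defs.v *)
From HB Require Import structures.
From mathcomp Require Import all_boot all_order all_algebra.
From mathcomp Require Import all_classical all_reals all_analysis.

Set Implicit Arguments.
Unset Strict Implicit.
Unset Printing Implicit Defensive.

Import Order.TTheory GRing.Theory Num.Theory.
Import numFieldNormedType.Exports.

Local Open Scope classical_set_scope.
Local Open Scope ring_scope.

(** R^n is ['rV[R]_n]; the library gives it the product topology (through the
    sup norm), and we equip it with the product sigma-algebra, generated by the
    coordinate maps, i.e. the Borel sigma-algebra. *)

Section measurable_rV.
Context (R : realType) (n : nat).

Let coord (i : 'I_n) (x : 'rV[R]_n) : R := x ord0 i.

Let rV_set0 : g_sigma_preimage coord set0.
Proof. exact: sigma_algebra0. Qed.

Let rV_setC A : g_sigma_preimage coord A -> g_sigma_preimage coord (~` A).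
Proof. exact: sigma_algebraC. Qed.

Let rV_bigcup (F : (set 'rV[R]_n)^nat) :
  (forall i, g_sigma_preimage coord (F i)) ->
  g_sigma_preimage coord (\bigcup_i (F i)).
Proof. exact: sigma_algebra_bigcup. Qed.

HB.instance Definition _ := @isMeasurable.Build default_measure_display
  'rV[R]_n (g_sigma_preimage coord) rV_set0 rV_setC rV_bigcup.

Lemma measurable_coord_rV (i : 'I_n) :
  measurable_fun [set: 'rV[R]_n] (fun x => x ord0 i : R).
Proof.
move=> _ Y mY; rewrite setTI; apply: sub_sigma_algebra => /=.
rewrite -bigcup_seq/=; exists i => /=; first by rewrite mem_index_enum.
by exists Y => //; rewrite setTI.
Qed.

Lemma measurable_fun_rV d (T : measurableType d) (f : T -> 'rV[R]_n) :
  (forall i, measurable_fun [set: T] (fun t => f t ord0 i : R)) ->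
  measurable_fun [set: T] f.
Proof.
move=> mf _ Y mY; rewrite setTI.
have : g_sigma_preimage coord `<=` [set A | measurable (f @^-1` A)].
  apply: smallest_sub.
    split => /=.
    - by rewrite preimage_set0.
    - by move=> A mA; rewrite setTD preimage_setC; apply: measurableC.
    - by move=> F mF; rewrite preimage_bigcup; apply: bigcup_measurable => k _; exact: mF.
  rewrite -bigcup_seq/= => A [i _ [B mB <-]].
  by rewrite /= setTI -comp_preimage -[X in measurable X]setTI; exact: mf.
by move=> /(_ _ mY).
Qed.

End measurable_rV.

(* The library's instance for [m1 \x m2] is shadowed by the one for
   subprobabilities, so that [sigma_finiteT] does not apply. *)
Lemma product_measure1_sigma_finite d1 d2 (T1 : measurableType d1)
    (T2 : measurableType d2) (R : realType)
    (m1 : {sigma_finite_measure set T1 -> \bar R})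
    (m2 : {sigma_finite_measure set T2 -> \bar R}) :
  sigma_finite setT (m1 \x m2)%E.
Proof.
have /sigma_finiteP[F [TF ndF Foo]] := sigma_finiteT m1.
have /sigma_finiteP[G [TG ndG Goo]] := sigma_finiteT m2.
exists (fun n => F n `*` G n).
  rewrite -setXTT TF TG predeqE => -[x y]; split.
    move=> [/= [n _ Fnx] [k _ Gky]]; exists (maxn n k) => //; split.
    - by move: x Fnx; exact/subsetPset/ndF/leq_maxl.
    - by move: y Gky; exact/subsetPset/ndG/leq_maxr.
  by move=> [n _ []/= ? ?]; split; exists n.
move=> k; have [? ?] := Foo k; have [? ?] := Goo k.
split; first exact: measurableX.
by rewrite product_measure1E// lte_mul_pinfty// ge0_fin_numE.
Qed.

(** Lebesgue measure on R^n, as the iterated product of [lebesgue_measure]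
    along (x_0, (x_1, ..., x_(n-1))) |-> (x_0, x_1, ..., x_(n-1)). *)

Section lebesgue_rV.
Context (R : realType).

Definition cons_rV n (p : measurableTypeR R * 'rV[R]_n) : 'rV[R]_n.+1 :=
  \row_i if unlift ord0 i is Some j then p.2 ord0 j else p.1.

Definition uncons_rV n (x : 'rV[R]_n.+1) : measurableTypeR R * 'rV[R]_n :=
  (x ord0 ord0, \row_j x ord0 (lift ord0 j)).

Lemma cons_rV0 n (p : measurableTypeR R * 'rV[R]_n) : cons_rV p ord0 ord0 = p.1.
Proof. by rewrite mxE unlift_none. Qed.

Lemma cons_rVS n (p : measurableTypeR R * 'rV[R]_n) (i : 'I_n) :
  cons_rV p ord0 (lift ord0 i) = p.2 ord0 i.
Proof. by rewrite mxE liftK. Qed.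

Lemma cons_rVK n : cancel (@cons_rV n) (@uncons_rV n).
Proof.
move=> [a x]; rewrite /uncons_rV cons_rV0; congr pair.
by apply/rowP => j; rewrite mxE cons_rVS.
Qed.

Lemma measurable_cons_rV n : measurable_fun setT (@cons_rV n).
Proof.
apply: measurable_fun_rV => i; case: (unliftP ord0 i) => [j ->|->].
  apply: (eq_measurable_fun (fun p : measurableTypeR R * 'rV[R]_n => p.2 ord0 j)).
    by move=> p _; rewrite cons_rVS.
  exact: (measurableT_comp (measurable_coord_rV j) measurable_snd).
apply: (eq_measurable_fun (fun p : measurableTypeR R * 'rV[R]_n => p.1)).
  by move=> p _; rewrite cons_rV0.
exact: measurable_fst.
Qed.

Lemma measurable_uncons_rV n : measurable_fun setT (@uncons_rV n).
Proof.
apply/measurable_fun_pairP; split; first exact: measurable_coord_rV.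
apply: measurable_fun_rV => i.
apply: (eq_measurable_fun (fun x : 'rV[R]_n.+1 => x ord0 (lift ord0 i))).
  by move=> x _; rewrite /= mxE.
exact: measurable_coord_rV.
Qed.

Section step.
Context (n : nat) (m : {sigma_finite_measure set 'rV[R]_n -> \bar R}).

Definition lebesgue_rVS : set 'rV[R]_n.+1 -> \bar R :=
  pushforward (lebesgue_measure \x m)%E (@cons_rV n).

HB.instance Definition _ := Measure.copy lebesgue_rVS
  (measure_function_pushforward__canonical__measure_function_Measure
    (lebesgue_measure \x m)%E (@measurable_cons_rV n)).

Let lebesgue_rVS_sigma_finite : sigma_finite setT lebesgue_rVS.
Proof.
have [F FT mF] := product_measure1_sigma_finite (@lebesgue_measure R) m.
exists (fun k => @uncons_rV n @^-1` F k).
  by rewrite -preimage_bigcup -FT preimage_setT.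
move=> k; split.
  rewrite -[X in measurable X]setTI; apply: measurable_uncons_rV => //.
  exact: (mF k).1.
rewrite /lebesgue_rVS /pushforward -comp_preimage.
rewrite (_ : _ \o _ = id); first exact: (mF k).2.
by apply/funext => p; exact: cons_rVK.
Qed.

HB.instance Definition _ :=
  Measure_isSigmaFinite.Build _ _ _ lebesgue_rVS lebesgue_rVS_sigma_finite.

End step.

Fixpoint lebesgue_rV (n : nat) :
    {sigma_finite_measure set 'rV[R]_n -> \bar R} :=
  if n isn't n'.+1 then \d_(0 : 'rV[R]_0) else lebesgue_rVS (lebesgue_rV n').

End lebesgue_rV.

Lemma lebesgue_rV_box (R : realType) n (A : 'I_n -> set R) :
  (forall i, measurable (A i)) ->
  lebesgue_rV R n [set x : 'rV[R]_n | forall i, A i (x ord0 i)] =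
  (\prod_(i < n) @lebesgue_measure R (A i))%E.
Proof.
elim: n A => [|n IH] A mA.
  by rewrite big_ord0 /= diracE mem_set// => -[].
rewrite big_ord_recl /= /lebesgue_rVS /pushforward -IH; last by move=> i; exact: mA.
rewrite -product_measure1E; last 2 first.
- exact: mA.
- rewrite (_ : [set _ | _] =
    \bigcap_(i : 'I_n) (fun x : 'rV[R]_n => x ord0 i) @^-1` A (lift ord0 i)).
    apply: fin_bigcap_measurable => // i _; rewrite -[X in measurable X]setTI.
    exact: measurable_coord_rV.
  by apply/seteqP; split => [x Ax i _|x Ax i]; [exact: Ax|exact: (Ax i Logic.I)].
congr product_measure1; apply/seteqP; split => [p /= Ap|p /= [A0 AS] i].
  split=> [|i]; first by rewrite -cons_rV0; exact: Ap.
  by rewrite -cons_rVS; exact: Ap.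
by case: (unliftP ord0 i) => [j ->|->]; rewrite ?cons_rV0 ?cons_rVS.
Qed.

Section fractional.
Context (R : realType).

Definition Gamma (a : R) : R :=
  \int[@lebesgue_measure R]_(t in `]0, +oo[) (t `^ (a - 1) * expR (- t)).

Context (n : nat).
Implicit Types (u : 'rV[R]_n -> R) (x : 'rV[R]_n).

(** The Euclidean norm; the library's [`|x|] on ['rV[R]_n] is the sup norm. *)
Definition enorm x : R := Num.sqrt (\sum_i x ord0 i ^+ 2).

Definition frac_laplacian_const (s : R) : R :=
  pi `^ (- (n%:R / 2)) * 2 `^ (2 * s) *
  (Gamma ((n%:R + 2 * s) / 2) / Gamma (1 - s)) * s.

(** [(-Delta)^s u x] exists (the principal value converges) and equals [l].
    A truncated integral that does not converge absolutely is infinite in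
    [\bar R], hence excluded by the convergence to a real number. *)
Definition is_frac_laplacian (s : R) u x (l : R) : Prop :=
  exists2 I : R,
    (\int[lebesgue_rV R n]_(y in [set y | (e < enorm y)%R])
       ((u x - u (x + y)) / enorm y `^ (n%:R + 2 * s))%R%:E)%E
      @[e --> (0 : R)^'+] --> I%:E
  & l = frac_laplacian_const s * I.

Definition riesz_kernel (alpha : R) x : R := enorm x `^ (alpha - n%:R).

Definition convolution (f g : 'rV[R]_n -> R) x : \bar R :=
  (\int[lebesgue_rV R n]_y (f (x - y) * g y)%R%:E)%E.

Definition in_Ls (s : R) u : Prop :=
  measurable_fun [set: 'rV[R]_n] u /\
  (\int[lebesgue_rV R n]_y (`|u y| / (1 + enorm y `^ (n%:R + 2 * s)))%R%:E
     < +oo)%E.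

Definition in_L1loc u : Prop :=
  measurable_fun [set: 'rV[R]_n] u /\
  forall K : set 'rV[R]_n, compact K ->
    (\int[lebesgue_rV R n]_(y in K) `|u y|%R%:E < +oo)%E.

Definition gradient u x : 'rV[R]_n := \row_i 'D_(delta_mx ord0 i) u x.

Definition in_C11loc (D : set 'rV[R]_n) u : Prop :=
  (forall x, D x -> differentiable u x) /\
  forall K : set 'rV[R]_n, compact K -> K `<=` D ->
    [lipschitz gradient u x | x in K].

Definition p_star (s alpha : R) : R := (n%:R + alpha) / (n%:R - 2 * s).

(** The equality in [\bar R] includes the finiteness of the convolution. *)
Definition solves_hartree (s alpha : R) u x : Prop :=
  exists2 l : R, is_frac_laplacian s u x l &
  (l%:E = convolution (riesz_kernel alpha) (fun y => u y `^ p_star s alpha)%R x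
          * (u x `^ (p_star s alpha - 1))%R%:E)%E.

Definition removable_at0 u : Prop :=
  exists2 v : 'rV[R]_n -> R, continuous v & forall x, x != 0 -> v x = u x.

Definition radially_symmetric u : Prop :=
  forall x y, enorm x = enorm y -> u x = u y.

End fractional.

(* Main.v *)
(** Moving spheres, applied directly to the equation. Translate a centre [c <> 0] to
    the origin: [u] becomes [U], singular only at [z = - c]. For [0 < l < |c|] compare
    [U] in the ball [|v| < l] with its Kelvin transform
    [U_l v = (l / |v|)^(n-2s) U (l^2 v / |v|^2)]. As [p_star] is the conformally
    invariant exponent, [U_l] solves the same equation, and inversion folds both the
    fractional Laplacian and the Riesz potential of the antisymmetric difference
    [U_l - U] onto the ball, with positive kernels. This gives a maximum principle in
    thin shells near the sphere, which starts the process at small [l], and a strict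
    lower bound for [U_l - U] in the interior unless [U_l = U], which allows [l] to
    increase; [U_l = U] would extend [U] continuously to [z]. The uncontrolled points
    [0] and [l^2 z / |z|^2] are dealt with by adding a small antisymmetric multiple of
    fundamental solutions. Hence [U <= U_l] for all [l < |c|]. If [|a| = |b|], let [c]
    go to infinity in the direction of [a - b] with [l] close to [|c|]: the spheres
    tend to the hyperplane exchanging [a] and [b], so that [u a <= u b]. *)

Require Import Defs.
From mathcomp Require Import all_boot all_order all_algebra.
From mathcomp Require Import all_classical all_reals all_analysis.
From mathcomp Require Import measurable_realfun ring lra.

Set Implicit Arguments.
Unset Strict Implicit.
Unset Printing Implicit Defensive.

Import Order.TTheory GRing.Theory Num.Theory.
Import numFieldNormedType.Exports.

Local Open Scope classical_set_scope.
Local Open Scope ring_scope.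

(** * Euclidean geometry and inversion *)

(** For [l < |z|], [U] is continuous and bounded between positive constants on the closed ball, but
    [U_l] at [0] and at the image of [z] reflects [U] at infinity and at [z], where no pointwise
    information is available. So the estimates are one-sided: [U_l > 0] bounds the gap [U_l - U]
    below, and the operator is bounded above at a minimum. Because the potential is nonlocal, the
    right-hand side there is controlled by a lower bound [- M] of the whole gap, not by its value at
    that point; as the infimum need not be attained, [- M] is improved to [- M / 2] and the step is
    iterated.

    Regularity is used at single points only. Inversion turns a round truncation of the principal
    value into a skew one; the two differ by a shell whose contribution is of order [c^(2 - 2s)], so
    Lipschitz continuity at the point suffices. The same remark yields the harmonicity of
    [|x|^(2s - n)] without computing an integral.

    To enlarge [l], Kelvin transforms of two radii are compared at two points with the same inverse
    image, so that no uniform continuity of [U] near infinity or near [z] is needed. *)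

Section pointwise_continuity.
Context (R : realType) (T : topologicalType) (t : T).

Lemma contD (V : normedModType R) (f g : T -> V) :
  {for t, continuous f} -> {for t, continuous g} ->
  {for t, continuous (fun x => f x + g x)}.
Proof. by move=> cf cg; apply: cvgD. Qed.

Lemma contB (V : normedModType R) (f g : T -> V) :
  {for t, continuous f} -> {for t, continuous g} ->
  {for t, continuous (fun x => f x - g x)}.
Proof. by move=> cf cg; apply: cvgB. Qed.

Lemma contZ (V : normedModType R) (f : T -> R) (g : T -> V) :
  {for t, continuous f} -> {for t, continuous g} ->
  {for t, continuous (fun x => f x *: g x)}.
Proof. by move=> cf cg; apply: cvgZ. Qed.

Lemma contM (f g : T -> R) :
  {for t, continuous f} -> {for t, continuous g} ->
  {for t, continuous (fun x => f x * g x)}.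
Proof. by move=> cf cg; apply: cvgM. Qed.

Lemma contX (f : T -> R) k :
  {for t, continuous f} -> {for t, continuous (fun x => f x ^+ k)}.
Proof.
move=> cf; elim: k => [|k IH]; first exact: cvg_cst.
rewrite /prop_for /continuous_at; under eq_fun do rewrite exprS.
by rewrite exprS; exact: contM.
Qed.

Lemma contV (f : T -> R) : f t != 0 ->
  {for t, continuous f} -> {for t, continuous (fun x => (f x)^-1)}.
Proof. by move=> f0 cf; apply: cvgV. Qed.

Lemma contc (V : topologicalType) (a : V) : {for t, continuous (fun _ : T => a)}.
Proof. exact: cvg_cst. Qed.

Lemma cont_id : {for t, continuous (fun x : T => x)}.
Proof. exact: cvg_id. Qed.

Lemma cont_comp (U V : topologicalType) (f : T -> U) (g : U -> V) :
  {for t, continuous f} -> {for f t, continuous g} ->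
  {for t, continuous (fun x => g (f x))}.
Proof. by move=> cf cg; apply: (@continuous_comp _ _ _ f g). Qed.

Lemma cont_powR (f : T -> R) (p : R) : 0 < f t ->
  {for t, continuous f} -> {for t, continuous (fun x => f x `^ p)}.
Proof.
move=> f0 cf; apply: (@cont_comp _ _ f (fun a => a `^ p)) => //.
apply: differentiable_continuous; apply/derivable1_diffP.
by apply: derivable_powR; rewrite in_itv/= f0.
Qed.

End pointwise_continuity.

Section euclidean.
Context (R : realType) (n : nat).
Implicit Types (x y v w : 'rV[R]_n) (l : R).

Definition dot x y : R := \sum_i x ord0 i * y ord0 i.

Lemma dotC x y : dot x y = dot y x.
Proof. by apply: eq_bigr => i _; rewrite mulrC. Qed.

Lemma dotDl x y v : dot (x + y) v = dot x v + dot y v.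
Proof. by rewrite -big_split; apply: eq_bigr => i _; rewrite mxE mulrDl. Qed.

Lemma dotZl a x y : dot (a *: x) y = a * dot x y.
Proof. by rewrite mulr_sumr; apply: eq_bigr => i _; rewrite mxE mulrA. Qed.

Lemma dotNl x y : dot (- x) y = - dot x y.
Proof. by rewrite -scaleN1r dotZl mulN1r. Qed.

Lemma dotDr x y v : dot v (x + y) = dot v x + dot v y.
Proof. by rewrite dotC dotDl !(dotC v). Qed.

Lemma dotZr a x y : dot x (a *: y) = a * dot x y.
Proof. by rewrite dotC dotZl dotC. Qed.

Lemma dotNr x y : dot x (- y) = - dot x y.
Proof. by rewrite dotC dotNl dotC. Qed.

Definition dotE := (dotDl, dotDr, dotNl, dotNr, dotZl, dotZr).

Lemma dot_ge0 x : 0 <= dot x x.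
Proof. by apply: sumr_ge0 => i _; rewrite -expr2 sqr_ge0. Qed.

Lemma dot_eq0 x : (dot x x == 0) = (x == 0).
Proof.
apply/idP/eqP => [|->]; last first.
  by rewrite /dot big1// => i _; rewrite mxE mul0r.
rewrite psumr_eq0 => [/allP x0|i _]; last by rewrite -expr2 sqr_ge0.
apply/rowP => i; have := x0 i (mem_index_enum i).
by rewrite /= -expr2 sqrf_eq0 mxE => /eqP.
Qed.

Lemma enorm_sqr x : enorm x ^+ 2 = dot x x.
Proof.
rewrite /enorm (eq_bigr (fun i => x ord0 i * x ord0 i)) => [|i _]; last by rewrite expr2.
by rewrite sqr_sqrtr// dot_ge0.
Qed.

Lemma enormE x : enorm x = Num.sqrt (dot x x).
Proof. by congr Num.sqrt; apply: eq_bigr => i _; rewrite expr2. Qed.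

Lemma enorm_ge0 x : 0 <= enorm x.
Proof. exact: sqrtr_ge0. Qed.

Lemma enorm_eq0 x : (enorm x == 0) = (x == 0).
Proof. by rewrite -dot_eq0 -enorm_sqr sqrf_eq0. Qed.

Lemma enorm_gt0 x : (0 < enorm x) = (x != 0).
Proof. by rewrite lt_def enorm_eq0 enorm_ge0 andbT. Qed.

Lemma enorm0 : enorm (0 : 'rV[R]_n) = 0.
Proof. by apply/eqP; rewrite enorm_eq0. Qed.

Lemma enormZ a x : enorm (a *: x) = `|a| * enorm x.
Proof. by rewrite !enormE dotZl dotZr mulrA -expr2 sqrtrM ?sqr_ge0// sqrtr_sqr. Qed.

Lemma enormN x : enorm (- x) = enorm x.
Proof. by rewrite -scaleN1r enormZ normrN1 mul1r. Qed.

Lemma enormBC x y : enorm (x - y) = enorm (y - x).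
Proof. by rewrite -enormN opprB. Qed.

Lemma dot_le x y : dot x y <= enorm x * enorm y.
Proof.
have [->|x0] := eqVneq x 0.
  by rewrite enorm0 mul0r /dot big1// => i _; rewrite mxE mul0r.
have [->|y0] := eqVneq y 0.
  by rewrite enorm0 mulr0 /dot big1// => i _; rewrite mxE mulr0.
have X0 : 0 < enorm x by rewrite enorm_gt0.
have Y0 : 0 < enorm y by rewrite enorm_gt0.
have := dot_ge0 (enorm y *: x - enorm x *: y).
rewrite !dotE -!enorm_sqr (dotC y x) => H.
have : 0 <= 2 * (enorm x * enorm y) * (enorm x * enorm y - dot x y) by nra.
by rewrite pmulr_rge0 ?subr_ge0// !mulr_gt0.
Qed.

Lemma enormD x y : enorm (x + y) <= enorm x + enorm y.
Proof.
rewrite -(@ler_pXn2r _ 2)// ?nnegrE ?addr_ge0 ?enorm_ge0//.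
rewrite enorm_sqr !dotE -!enorm_sqr (dotC y x).
by have := dot_le x y; nra.
Qed.

Lemma enormB x y : enorm (x - y) <= enorm x + enorm y.
Proof. by rewrite -(enormN y) enormD. Qed.

Lemma enorm_tri v x y : enorm (x - y) <= enorm (x - v) + enorm (v - y).
Proof. by rewrite (le_trans _ (enormD _ _))// addrA subrK. Qed.

Lemma enormB_ge x y : enorm x - enorm y <= enorm (x - y).
Proof. by rewrite lerBlDr (le_trans _ (enormD _ _))// subrK. Qed.

Lemma continuous_dot (T : topologicalType) (f g : T -> 'rV[R]_n) t :
  {for t, continuous f} -> {for t, continuous g} ->
  {for t, continuous (fun t => dot (f t) (g t))}.
Proof.
move=> cf cg; rewrite /dot.
rewrite /prop_for /continuous_at.
apply: (@cvg_big R 'I_n +%R 0 xpredT _ T (nbhs t)); first exact: add_continuous.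
move=> i _; apply: cvgM.
  apply: (@cvg_comp _ _ _ f (fun v : 'rV[R]_n => v ord0 i) _ _ _ cf).
  exact: coord_continuous.
apply: (@cvg_comp _ _ _ g (fun v : 'rV[R]_n => v ord0 i) _ _ _ cg).
exact: coord_continuous.
Qed.

Lemma continuous_enorm (T : topologicalType) (f : T -> 'rV[R]_n) t :
  {for t, continuous f} -> {for t, continuous (fun t => enorm (f t))}.
Proof.
move=> cf; rewrite (_ : (fun t => _) = fun t => Num.sqrt (dot (f t) (f t))).
  by apply: continuous_comp; [exact: continuous_dot|exact: sqrt_continuous].
by apply/funext => ?; rewrite enormE.
Qed.

Lemma coord_le_enorm x i : `|x ord0 i| <= enorm x.
Proof.
rewrite -(@ler_pXn2r _ 2)// ?nnegrE ?enorm_ge0// enorm_sqr real_normK ?num_real//.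
rewrite /dot (bigD1 i)//= expr2 lerDl.
by apply: sumr_ge0 => j _; rewrite -expr2 sqr_ge0.
Qed.

Lemma norm_le_enorm x : `|x| <= enorm x.
Proof.
rewrite [leLHS]/Num.norm/= mx_normrE.
apply: bigmax_le; first exact: enorm_ge0.
by move=> [i j] _; rewrite ord1 coord_le_enorm.
Qed.

Lemma continuous_enormB y x : {for x, continuous (fun v => enorm (v - y))}.
Proof.
apply: continuous_enorm; apply: (@cvgB _ _ _ (nbhs x) _ id (cst y)).
  exact: cvg_id.
exact: cvg_cst.
Qed.

Lemma near_enorm x e : 0 < e -> \forall y \near x, enorm (y - x) < e.
Proof.
move=> e0; have : {for x, continuous (fun y => enorm (y - x))}.
  exact: continuous_enormB.
rewrite /prop_for/continuous_at /= subrr enorm0 => /cvgrPdist_lt/(_ _ e0).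
by apply: filterS => y; rewrite sub0r normrN ger0_norm// enorm_ge0.
Qed.

(** The sup norm is at most [enorm], and [enorm] is continuous: this suffices to trade the balls of
    the library for Euclidean ones. *)
Lemma nbhs_enormP x (P : set 'rV[R]_n) :
  (exists2 e, 0 < e & forall y, enorm (y - x) < e -> P y) <-> nbhs x P.
Proof.
split=> [[e e0 xP]|].
  by apply: filterS (near_enorm x e0).
move=> /nbhs_ballP[e /= e0 xP]; exists e => // y yx; apply: xP.
by rewrite -ball_normE /ball_/= distrC (le_lt_trans (norm_le_enorm _)).
Qed.

Lemma compact_enorm_le r (D : set 'rV[R]_n) :
  (forall x, D x -> enorm x <= r) -> closed D -> compact D.
Proof.
move=> Dr cD; apply: bounded_closed_compact => //.
exists r; split; first exact: num_real.
move=> M rM x /= Dx.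
by rewrite (le_trans (norm_le_enorm x))// (le_trans (Dr _ Dx))// ltW.
Qed.

Lemma closed_enorm_le y r : closed [set x | enorm (x - y) <= r].
Proof.
rewrite (_ : [set _ | _] = (fun x => enorm (x - y)) @^-1` [set t | t <= r])//.
apply: closed_comp; last exact: closed_le.
by move=> x _; exact: continuous_enormB.
Qed.

Lemma closed_enorm_ge y r : closed [set x | r <= enorm (x - y)].
Proof.
rewrite (_ : [set _ | _] = (fun x => enorm (x - y)) @^-1` [set t | r <= t])//.
apply: closed_comp; last exact: closed_ge.
by move=> x _; exact: continuous_enormB.
Qed.

End euclidean.

Section inversion.
Context (R : realType) (n : nat).
Implicit Types (x y v w : 'rV[R]_n) (l : R).

Definition kinv l v : 'rV[R]_n := (l ^+ 2 / enorm v ^+ 2) *: v.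

Lemma kinvE l v : kinv l v = (l ^+ 2 / enorm v ^+ 2) *: v.
Proof. by []. Qed.

Lemma kinv0 l : kinv l 0 = 0.
Proof. by rewrite /kinv scaler0. Qed.

Lemma enorm_kinv l v : enorm (kinv l v) = l ^+ 2 / enorm v.
Proof.
have [->|v0] := eqVneq v 0; first by rewrite kinv0 enorm0 invr0 mulr0.
rewrite /kinv enormZ ger0_norm ?divr_ge0 ?sqr_ge0//.
by field; rewrite enorm_eq0.
Qed.

Lemma kinv_eq0 l v : l != 0 -> (kinv l v == 0) = (v == 0).
Proof.
by move=> l0; rewrite -enorm_eq0 enorm_kinv mulf_eq0 invr_eq0 enorm_eq0 sqrf_eq0 (negbTE l0).
Qed.

Lemma kinvK l v : l != 0 -> kinv l (kinv l v) = v.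
Proof.
move=> l0; have [->|v0] := eqVneq v 0; first by rewrite !kinv0.
rewrite {1}/kinv enorm_kinv /kinv scalerA -[RHS]scale1r; congr (_ *: _).
by field; rewrite enorm_eq0 v0 l0.
Qed.

Lemma kinv_inj l : l != 0 -> injective (kinv l).
Proof. by move=> l0; apply: can_inj => v; exact: kinvK. Qed.

Lemma kinv_fix l v : 0 < l -> enorm v = l -> kinv l v = v.
Proof. by move=> l0 vl; rewrite /kinv vl divff ?scale1r// expf_neq0 ?gt_eqF. Qed.

(* The extension of [enorm v * enorm (y - kinv l v) / l] that is smooth at [v = 0]. *)
Definition mirror_dist l y v : R :=
  Num.sqrt (l ^+ 2 - 2 * dot y v + enorm y ^+ 2 * enorm v ^+ 2 / l ^+ 2).

(** Cauchy-Schwarz. It makes the radicand of [mirror_dist] nonnegative, so that [Num.sqrt] does not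
    fall back on its default value. *)
Lemma mirror_dist_sqr_ge l y v : 0 < l ->
  (l - enorm y * enorm v / l) ^+ 2 <=
  l ^+ 2 - 2 * dot y v + enorm y ^+ 2 * enorm v ^+ 2 / l ^+ 2.
Proof.
move=> l0; rewrite sqrrB -exprMn -expr_div_n lerD2r lerD2l lerN2.
rewrite (_ : l * (enorm y * enorm v / l) = enorm y * enorm v); last first.
  by field; rewrite gt_eqF.
by rewrite -[leRHS]mulr_natl ler_pM2l// dot_le.
Qed.

Lemma mirror_dist_sqr l y v : 0 < l ->
  mirror_dist l y v ^+ 2 =
  l ^+ 2 - 2 * dot y v + enorm y ^+ 2 * enorm v ^+ 2 / l ^+ 2.
Proof.
by move=> l0; rewrite sqr_sqrtr// (le_trans _ (mirror_dist_sqr_ge y v l0))// sqr_ge0.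
Qed.

Lemma mirror_dist_ge0 l y v : 0 <= mirror_dist l y v.
Proof. exact: sqrtr_ge0. Qed.

Lemma mirror_distC l y v : mirror_dist l y v = mirror_dist l v y.
Proof. by rewrite /mirror_dist dotC (mulrC (enorm y ^+ 2)). Qed.

Lemma mirror_dist_ge l y v : 0 < l -> l - enorm y * enorm v / l <= mirror_dist l y v.
Proof.
move=> l0; rewrite (le_trans (ler_norm _))// -sqrtr_sqr ler_wsqrtr//.
exact: mirror_dist_sqr_ge.
Qed.

(** Both factors on the right are positive when [y] and [v] lie in the open ball: the positivity of
    all the folded kernels comes from this identity. *)
Lemma mirror_distB l y v : 0 < l ->
  mirror_dist l y v ^+ 2 - enorm (y - v) ^+ 2 =
  (l ^+ 2 - enorm y ^+ 2) * (l ^+ 2 - enorm v ^+ 2) / l ^+ 2.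
Proof.
move=> l0; rewrite mirror_dist_sqr// [enorm (y - v) ^+ 2]enorm_sqr !dotE -!enorm_sqr.
rewrite (dotC v y).
by field; rewrite gt_eqF.
Qed.

Lemma mirror_distE l y v : 0 < l -> v != 0 ->
  enorm (y - kinv l v) = l * mirror_dist l y v / enorm v.
Proof.
move=> l0 v0; have v1 : 0 < enorm v by rewrite enorm_gt0.
apply/eqP; rewrite -(@eqrXn2 _ 2)// ?enorm_ge0//; last first.
  by rewrite divr_ge0 ?mulr_ge0 ?mirror_dist_ge0// ltW.
rewrite expr_div_n exprMn mirror_dist_sqr// [enorm (_ - _) ^+ 2]enorm_sqr /kinv !dotE.
rewrite -!enorm_sqr (dotC v y); apply/eqP; field.
by rewrite !gt_eqF.
Qed.

Lemma enorm_kinvB l y v : 0 < l -> y != 0 -> v != 0 ->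
  enorm (kinv l y - kinv l v) = l ^+ 2 * enorm (y - v) / (enorm y * enorm v).
Proof.
move=> l0 y0 v0.
have v1 : 0 < enorm v by rewrite enorm_gt0.
have y1 : 0 < enorm y by rewrite enorm_gt0.
apply/eqP; rewrite -(@eqrXn2 _ 2)// ?enorm_ge0//; last first.
  by rewrite divr_ge0 ?mulr_ge0 ?enorm_ge0 ?sqr_ge0// ltW.
rewrite expr_div_n !exprMn 2![enorm (_ - _) ^+ 2]enorm_sqr /kinv !dotE -!enorm_sqr.
rewrite (dotC v y); apply/eqP; field.
by rewrite !gt_eqF.
Qed.

Lemma continuous_kinv l v : v != 0 -> {for v, continuous (kinv l)}.
Proof.
move=> v0; apply: contZ; last exact: cont_id.
apply: contM; first exact: contc.
apply: contV; first by rewrite sqrf_eq0 enorm_eq0.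
by apply: contX; apply: continuous_enorm; exact: cont_id.
Qed.

End inversion.

(** * Change of variables in Lebesgue integrals *)

Section affine_change_of_variables.
Context (R : realType).

Lemma measurable_affine (a b : R) :
  measurable_fun setT (fun x : measurableTypeR R => a * x + b : measurableTypeR R).
Proof.
apply: measurable_funD; last exact: measurable_cst.
exact: mulrl_measurable.
Qed.

Lemma lebesgue_measure_affine (a b : R) (A : set (measurableTypeR R)) : a != 0 ->
  measurable A ->
  lebesgue_measure A =
  (`|a|%:E * pushforward lebesgue_measure (fun x : measurableTypeR R => (a * x + b)%R : measurableTypeR R) A)%E.
Proof.
move=> a0 mA; have na0 : 0 <= `|a| by [].
pose m := pushforward lebesgue_measure (fun x : measurableTypeR R => (a * x + b)%R : measurableTypeR R).
pose m' : {measure set (measurableTypeR R) -> \bar R} :=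
  measure_function_pushforward__canonical__measure_function_Measure
    lebesgue_measure (measurable_affine a b).
pose M : {measure set (measurableTypeR R) -> \bar R} := mscale (NngNum na0) m'.
(* By uniqueness of Lebesgue measure, half-open intervals suffice. For [a < 0] the preimage is
   closed at the other end, which does not change its length. *)
suff -> : (`|a|%:E * m A = M A)%E.
  apply: (@lebesgue_measure_unique R M) => // _ [[p q] /= pq <-].
  rewrite /M /mscale/= /m' /pushforward/=.
  case: (ltgtP a 0) a0 => // a0 _.
    rewrite (_ : _ @^-1` _ = `[(q - b) / a, (p - b) / a[%classic).
      rewrite !lebesgue_measure_itv/= !lte_fin ler0_norm ?ltW//.
      rewrite ltr_nM2r ?invr_lt0// ltrBlDr subrK; case: ifPn => // _.
      by rewrite -EFinD -EFinM; congr EFin; field; rewrite lt_eqF.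
      by rewrite mule0.
    apply/seteqP; split=> x /=; rewrite !in_itv/= => /andP[h1 h2]; apply/andP.
      by rewrite ltr_ndivlMr// ler_ndivrMr// mulrC; split; lra.
    by move: h1 h2; rewrite ltr_ndivlMr// ler_ndivrMr// mulrC; split; lra.
  rewrite (_ : _ @^-1` _ = `](p - b) / a, (q - b) / a]%classic).
    rewrite !lebesgue_measure_itv/= !lte_fin gtr0_norm//.
    rewrite ltr_pM2r ?invr_gt0// ltrBlDr subrK; case: ifPn => // _.
    by rewrite -EFinD -EFinM; congr EFin; field; rewrite gt_eqF.
    by rewrite mule0.
  apply/seteqP; split=> x /=; rewrite !in_itv/= => /andP[h1 h2]; apply/andP.
    by rewrite ler_pdivlMr// ltr_pdivrMr// mulrC; split; lra.
  by move: h1 h2; rewrite ler_pdivlMr// ltr_pdivrMr// mulrC; split; lra.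
by [].
Qed.

Lemma ge0_integral_affine1 (a b : R) (f : R -> \bar R) : a != 0 ->
  measurable_fun [set: measurableTypeR R] f -> (forall x, 0 <= f x)%E ->
  (\int[lebesgue_measure]_x f x = `|a|%:E * \int[lebesgue_measure]_x f (a * x + b)%R)%E.
Proof.
move=> a0 mf f0; have na0 : 0 <= `|a| by [].
pose m' : {measure set (measurableTypeR R) -> \bar R} :=
  measure_function_pushforward__canonical__measure_function_Measure
    lebesgue_measure (measurable_affine a b).
rewrite (eq_measure_integral (mscale (NngNum na0) m')); last first.
  by move=> A mA _; exact: (lebesgue_measure_affine b a0 mA).
rewrite ge0_integral_mscale//=; congr (_ * _)%E.
exact: (@ge0_integral_pushforward _ _ _ _ _ _ (measurable_affine a b)).
Qed.

End affine_change_of_variables.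

Section lebesgue_rV_integral.
Context (R : realType).

Lemma integral_lebesgue_rVS n (f : 'rV[R]_n.+1 -> \bar R) :
  measurable_fun setT f -> (forall x, 0 <= f x)%E ->
  (\int[lebesgue_rV R n.+1]_x f x =
   \int[lebesgue_measure]_t \int[lebesgue_rV R n]_x f (cons_rV (t, x)))%E.
Proof.
move=> mf f0; rewrite [LHS](@ge0_integral_pushforward _ _ _ _ _ _ (@measurable_cons_rV R n))//.
rewrite preimage_setT fubini_tonelli1//=.
by apply: measurableT_comp => //; exact: measurable_cons_rV.
Qed.

Lemma measurable_integral_cons n (f : 'rV[R]_n.+1 -> \bar R) :
  measurable_fun setT f -> (forall x, 0 <= f x)%E ->
  measurable_fun [set: measurableTypeR R]
    (fun t => \int[lebesgue_rV R n]_x f (cons_rV (t, x)))%E.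
Proof.
move=> mf f0.
apply: (@measurable_fun_fubini_tonelli_F _ _ _ _ _ _ (f \o @cons_rV R n)) => //=.
by apply: measurableT_comp => //; exact: measurable_cons_rV.
Qed.

Lemma measurable_affine_rV n (a : R) (b : 'rV[R]_n) :
  measurable_fun setT (fun x : 'rV[R]_n => a *: x + b).
Proof.
apply: measurable_fun_rV => i.
apply: (eq_measurable_fun (fun x : 'rV[R]_n => a * x ord0 i + b ord0 i)).
  by move=> x _; rewrite !mxE.
apply: measurable_funD; last exact: measurable_cst.
by apply: measurable_funM; [exact: measurable_cst|exact: measurable_coord_rV].
Qed.

(** The map acts on each coordinate separately, so Tonelli peels off one one-dimensional
    substitution, with one factor [|a|], per induction step. *)
Lemma ge0_integral_affine n (a : R) (b : 'rV[R]_n) (f : 'rV[R]_n -> \bar R) : a != 0 ->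
  measurable_fun setT f -> (forall x, 0 <= f x)%E ->
  (\int[lebesgue_rV R n]_x f x =
   (`|a| ^+ n)%:E * \int[lebesgue_rV R n]_x f (a *: x + b)%R)%E.
Proof.
move=> a0; elim: n b f => [|n IH] b f mf f0.
  rewrite !integral_dirac//=; last first.
    by apply: measurableT_comp => //; exact: measurable_affine_rV.
  rewrite !diracT !mul1e; congr (f _).
  by apply/rowP => -[].
pose b' : 'rV[R]_n := \row_j b ord0 (lift ord0 j).
have E t x : (a *: cons_rV (t, x) + b = cons_rV (a * t + b ord0 ord0, a *: x + b'))%R.
  apply/rowP => i; case: (unliftP ord0 i) => [j ->|->].
    by rewrite [RHS]cons_rVS !mxE liftK.
  by rewrite [RHS]cons_rV0 !mxE unlift_none.
rewrite !integral_lebesgue_rVS//; last first.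
  by apply: measurableT_comp => //; exact: measurable_affine_rV.
rewrite (@ge0_integral_affine1 _ a (b ord0 ord0) _ a0); last 2 first.
- exact: measurable_integral_cons.
- by move=> t; exact: integral_ge0.
rewrite exprS EFinM -muleA; congr (_ * _)%E.
rewrite -ge0_integralZl//; last 2 first.
- apply: (@measurable_integral_cons _ (fun x => f (a *: x + b)%R)) => //.
  by apply: measurableT_comp => //; exact: measurable_affine_rV.
- by move=> t _; exact: integral_ge0.
apply: eq_integral => t _; rewrite (IH b')//; last first.
  apply: measurableT_comp => //; apply: (measurableT_comp (@measurable_cons_rV R n)).
  exact: measurable_pair1.
by under eq_integral do rewrite -E.
Qed.

End lebesgue_rV_integral.

Section measurable_euclidean.
Context (R : realType) (n : nat) d (T : measurableType d).
Implicit Types (f g : T -> 'rV[R]_n).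

Lemma measurable_coord f i : measurable_fun setT f ->
  measurable_fun setT (fun t => f t ord0 i : R).
Proof. by move=> mf; exact: (measurableT_comp (measurable_coord_rV i) mf). Qed.

Lemma measurable_rVD f g : measurable_fun setT f -> measurable_fun setT g ->
  measurable_fun setT (fun t => f t + g t).
Proof.
move=> mf mg; apply: measurable_fun_rV => i.
apply: (eq_measurable_fun (fun t => f t ord0 i + g t ord0 i)).
  by move=> x _; rewrite mxE.
by apply: measurable_funD; exact: measurable_coord.
Qed.

Lemma measurable_rVZ (a : T -> R) f : measurable_fun setT a -> measurable_fun setT f ->
  measurable_fun setT (fun t => a t *: f t).
Proof.
move=> ma mf; apply: measurable_fun_rV => i.
apply: (eq_measurable_fun (fun t => a t * f t ord0 i)).
  by move=> x _; rewrite mxE.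
by apply: measurable_funM => //; exact: measurable_coord.
Qed.

Lemma measurable_rVB f g : measurable_fun setT f -> measurable_fun setT g ->
  measurable_fun setT (fun t => f t - g t).
Proof.
move=> mf mg; apply: measurable_rVD => //.
apply: (eq_measurable_fun (fun t => -1 *: g t)).
  by move=> x _; rewrite scaleN1r.
by apply: measurable_rVZ => //; exact: measurable_cst.
Qed.

Lemma measurable_dot f g : measurable_fun setT f -> measurable_fun setT g ->
  measurable_fun setT (fun t => dot (f t) (g t)).
Proof.
move=> mf mg; apply: (@measurable_sum _ _ _ _ _ _ (fun i t => f t ord0 i * g t ord0 i)).
by move=> i; apply: measurable_funM; exact: measurable_coord.
Qed.

Lemma measurable_enorm f : measurable_fun setT f ->
  measurable_fun setT (fun t => enorm (f t)).
Proof.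
move=> mf; apply: (eq_measurable_fun (fun t => Num.sqrt (dot (f t) (f t)))).
  by move=> x _; rewrite enormE.
apply: measurableT_comp; last exact: measurable_dot.
by apply: continuous_measurable_fun => x; exact: sqrt_continuous.
Qed.

Lemma measurable_powRf (p : R) (f : T -> R) : measurable_fun setT f ->
  measurable_fun setT (fun t => f t `^ p).
Proof. by move=> mf; exact: (measurableT_comp (measurable_powR p) mf). Qed.

Lemma measurable_invr (f : T -> R) : (forall t, 0 <= f t) -> measurable_fun setT f ->
  measurable_fun setT (fun t => (f t)^-1).
Proof.
move=> f0 mf; apply: (eq_measurable_fun (fun t => f t `^ (-1))).
  by move=> x _; rewrite powR_inv1.
exact: measurable_powRf.
Qed.

Lemma measurable_kinv l f : measurable_fun setT f ->
  measurable_fun setT (fun t => kinv l (f t)).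
Proof.
move=> mf; apply: measurable_rVZ => //.
apply: measurable_funM; first exact: measurable_cst.
apply: measurable_invr => [t|]; first exact: sqr_ge0.
by apply: measurable_funX; exact: measurable_enorm.
Qed.

End measurable_euclidean.

Section lebesgue_rV_null.
Context (R : realType) (n : nat).

Lemma measurable_rV1 (a : 'rV[R]_n) : measurable [set a].
Proof.
rewrite (_ : [set a] = (fun x => enorm (x - a)) @^-1` [set 0]).
  rewrite -[X in measurable X]setTI; apply: measurable_enorm => //.
  by apply: measurable_rVB => //; exact: measurable_cst.
apply/seteqP; split => x /=; first by move=> ->; rewrite subrr enorm0.
by move/eqP; rewrite enorm_eq0 subr_eq0 => /eqP.
Qed.

Lemma lebesgue_rV1 (a : 'rV[R]_n) : (0 < n)%N -> lebesgue_rV R n [set a] = 0%E.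
Proof.
move=> n0; rewrite (_ : [set a] = [set x | forall i, [set a ord0 i] (x ord0 i)]).
  rewrite (@lebesgue_rV_box _ _ (fun i => [set a ord0 i]))//; case: n n0 a => // m _ a.
  by rewrite big_ord_recl lebesgue_measure_set1 mul0e.
apply/seteqP; split => x /=; first by move=> ->.
by move=> xa; apply/rowP => i; exact: xa.
Qed.

End lebesgue_rV_null.

(** * Inversion as a change of variables, without a Jacobian determinant *)

Section inversion_change_of_variables.
Local Open Scope ereal_scope.
Context (R : realType) (n : nat).
Hypothesis n0 : (0 < n)%N.
Local Notation mu := (lebesgue_rV R n).
Implicit Types (G : 'rV[R]_n -> \bar R) (x : 'rV[R]_n).

(* The scaling-invariant measure [|x|^-n dx]. *)
Let M G := \int[mu]_x ((enorm x ^- n)%:E * G x).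

Let measurable_id : measurable_fun setT (fun x : 'rV[R]_n => x).
Proof. exact: measurable_id. Qed.

Let mw d (T : measurableType d) (f : T -> 'rV[R]_n) : measurable_fun setT f ->
  measurable_fun setT (fun t => (enorm (f t) ^- n)%:E).
Proof.
move=> mf; apply/measurable_EFinP; apply: measurable_invr => [t|].
  by rewrite exprn_ge0 ?enorm_ge0.
by apply: measurable_funX; exact: measurable_enorm.
Qed.

Let w0 x : 0 <= (enorm x ^- n)%:E.
Proof. by rewrite lee_fin invr_ge0 exprn_ge0 ?enorm_ge0. Qed.

Let M_scale (t : R) G : (0 < t)%R -> measurable_fun setT G -> (forall x, 0 <= G x) ->
  M (fun x => G (t *: x)%R) = M G.
Proof.
move=> t0 mG G0; rewrite /M [RHS](@ge0_integral_affine _ _ t 0%R) ?gt_eqF//.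
- rewrite -ge0_integralZl//.
  + apply: eq_integral => x _; rewrite addr0 enormZ exprMn muleA -EFinM gtr0_norm//.
    rewrite invfM mulrA divff ?mul1r// expf_neq0// gt_eqF//.
  + apply: emeasurable_funM; first by apply: mw; exact: measurable_affine_rV.
    by apply: measurableT_comp => //; exact: measurable_affine_rV.
  + by move=> x _; exact: mule_ge0.
- by apply: emeasurable_funM => //; exact: mw.
- by move=> x; exact: mule_ge0.
Qed.

(** A fundamental domain for the dilations [x |-> expR t *: x]: every ray meets it in logarithmic
    length 1. Its value at the origin is irrelevant, the weight [enorm x ^- n] being 0 there. *)
Let window (r : R) : \bar R := if (0 <= ln r < 1)%R then 1 else 0.

Let window_ge0 r : 0 <= window r.
Proof. by rewrite /window; case: ifP. Qed.

Let measurable_window d (T : measurableType d) (f : T -> R) : measurable_fun setT f ->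
  measurable_fun setT (fun t => window (f t)).
Proof.
move=> mf; apply: measurable_fun_ifT => //.
apply: measurable_and.
  by apply: measurable_fun_ler => //; apply: measurableT_comp mf; exact: measurable_ln.
by apply: measurable_fun_ltr => //; apply: measurableT_comp mf; exact: measurable_ln.
Qed.

Let window_int x : x != 0%R -> \int[lebesgue_measure]_t window (enorm (expR t *: x)) = 1.
Proof.
move=> x0; transitivity (\int[lebesgue_measure]_t
    (\1_(`[- ln (enorm x), 1 - ln (enorm x)[%classic) t)%:E).
  apply: eq_integral => t _.
  rewrite /window indicE enormZ gtr0_norm ?expR_gt0// lnM ?posrE ?expR_gt0 ?enorm_gt0//.
  rewrite expRK mem_setE in_itv/= -lerBlDr sub0r -ltrBrDr.
  by case: ifP.
rewrite integral_indic// setIT.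
rewrite [LHS](lebesgue_measure_itv `[(- ln (enorm x))%R, (1 - ln (enorm x))%R[)/= lte_fin.
by rewrite ltrDr ltr01 -EFinD opprK -addrA addNr addr0.
Qed.

(** Insert the integral over [t] of [window (enorm (expR t *: x))], which is 1, exchange the
    integrals, and use the invariance of [M] under the dilation by [expR t] for each [t]. Hence
    [M G] depends only on the integrals of [G] along rays. *)
Let M_average G : measurable_fun setT G -> (forall x, 0 <= G x) ->
  M G = M (fun x => window (enorm x) * \int[lebesgue_measure]_t G (expR (- t) *: x)%R).
Proof.
move=> mG G0.
have mexp : measurable_fun [set: measurableTypeR R] (fun t => expR (- t) : R).
  by apply: (measurableT_comp (@measurable_expR R)); exact: oppr_measurable.
pose F (z : 'rV[R]_n * measurableTypeR R) : \bar R :=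
  (enorm z.1 ^- n)%:E * (window (enorm (expR z.2 *: z.1)) * G z.1).
have mF : measurable_fun setT F.
  apply: emeasurable_funM; first by apply: mw; exact: measurable_fst.
  apply: emeasurable_funM.
    apply: measurable_window; apply: measurable_enorm; apply: measurable_rVZ.
      exact: (measurableT_comp (@measurable_expR R) measurable_snd).
    exact: measurable_fst.
  exact: measurableT_comp mG measurable_fst.
have F0 z : 0 <= F z by rewrite /F !mule_ge0.
transitivity (\int[mu]_x \int[lebesgue_measure]_t F (x, t)).
  apply: eq_integral => x _; rewrite /F/=.
  have [->|x0] := eqVneq x 0%R.
    rewrite enorm0 expr0n eqn0Ngt n0 invr0.
    by under eq_integral do rewrite mul0e; rewrite integral0 mul0e.
  under eq_integral do rewrite muleCA.
  rewrite ge0_integralZr//; last 2 first.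
  - apply: measurable_window; apply: measurable_enorm; exact: measurable_rVZ.
  - exact: mule_ge0.
  by rewrite window_int// mul1e.
rewrite fubini_tonelli//.
transitivity (\int[lebesgue_measure]_t M (fun x => window (enorm x) * G (expR (- t) *: x)%R)).
  apply: eq_integral => t _; rewrite -(@M_scale (expR t)) ?expR_gt0//.
  - apply: eq_integral => x _; rewrite /F/= scalerA -expRD addNr expR0 scale1r//.
  - apply: emeasurable_funM; first by apply: measurable_window; exact: measurable_enorm.
    by apply: measurableT_comp => //; exact: measurable_rVZ.
  - by move=> x; exact: mule_ge0.
pose H (z : measurableTypeR R * 'rV[R]_n) : \bar R :=
  (enorm z.2 ^- n)%:E * (window (enorm z.2) * G (expR (- z.1) *: z.2)).
have mH : measurable_fun setT H.
  apply: emeasurable_funM; first by apply: mw; exact: measurable_snd.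
  apply: emeasurable_funM.
    by apply: measurable_window; apply: measurable_enorm; exact: measurable_snd.
  apply: (measurableT_comp mG); apply: measurable_rVZ; last exact: measurable_snd.
  exact: (measurableT_comp mexp measurable_fst).
have H0 z : 0 <= H z by rewrite /H !mule_ge0.
rewrite [LHS](@fubini_tonelli _ _ _ _ _ _ _ H)//.
apply: eq_integral => x _; rewrite /H/=.
have mGx : measurable_fun [set: measurableTypeR R] (fun t => G (expR (- t) *: x)%R).
  by apply: (measurableT_comp mG); apply: measurable_rVZ.
rewrite ge0_integralZl//; last 2 first.
- by apply: emeasurable_funM.
- by move=> t _; exact: mule_ge0.
congr (_ * _); rewrite ge0_integralZl//.
Qed.

(** Inversion maps every ray to itself and reverses its logarithmic coordinate, so integrals along
    rays are unchanged. *)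
Let M_inv l G : (0 < l)%R -> measurable_fun setT G -> (forall x, 0 <= G x) ->
  M (fun x => G (kinv l x)) = M G.
Proof.
move=> l0 mG G0; rewrite (@M_average (fun x => G (kinv l x))); last 2 first.
- by apply: (measurableT_comp mG); exact: measurable_kinv.
- by move=> x; exact: G0.
rewrite (M_average mG G0); apply: eq_integral => x _.
have [->|x0] := eqVneq x 0%R; first by rewrite enorm0 expr0n eqn0Ngt n0 invr0 !mul0e.
congr (_ * (_ * _)).
(* On the ray of [x], inversion reads [t |-> - t - c] in the logarithmic coordinate. *)
pose c := ln (l ^+ 2 / enorm x ^+ 2).
rewrite [RHS](@ge0_integral_affine1 _ (-1) (- c)); last 3 first.
- by rewrite oppr_eq0 oner_eq0.
- apply: (measurableT_comp mG); apply: measurable_rVZ => //.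
  by apply: (measurableT_comp (@measurable_expR R)); exact: oppr_measurable.
- by move=> t; exact: G0.
rewrite normrN1 mul1e; apply: eq_integral => t _; congr (G _).
rewrite /kinv enormZ gtr0_norm ?expR_gt0// scalerA mulN1r opprD !opprK expRD.
rewrite lnK; last by rewrite posrE divr_gt0 ?exprn_gt0 ?enorm_gt0.
congr (_ *: _)%R; rewrite expRN; field.
by rewrite enorm_eq0 x0 gt_eqF ?expR_gt0.
Qed.

(** Lebesgue measure is [enorm x ^+ n] times the invariant measure of [M], so the density is the
    quotient of [enorm (kinv l x) ^+ n] by [enorm x ^+ n]. *)
Theorem ge0_integral_kinv l (f : 'rV[R]_n -> \bar R) : (0 < l)%R ->
  measurable_fun setT f -> (forall x, 0 <= f x) ->
  \int[mu]_x f x = \int[mu]_x (((l / enorm x) ^+ (2 * n))%:E * f (kinv l x)).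
Proof.
move=> l0 mf f0.
pose G x := (enorm x ^+ n)%:E * f x.
have mG : measurable_fun setT G.
  apply: emeasurable_funM => //; apply/measurable_EFinP/measurable_funX.
  exact: measurable_enorm.
have G0 x : 0 <= G x by rewrite mule_ge0// lee_fin exprn_ge0// enorm_ge0.
transitivity (M G).
  apply: ge0_ae_eq_integral => //.
  - by apply: emeasurable_funM => //; exact: mw.
  - by move=> x _; exact: mule_ge0.
  exists [set 0%R]; split; [exact: measurable_rV1|exact: lebesgue_rV1|].
  move=> x /= H; apply/eqP; apply: contra_notT H => x0 _.
  by rewrite /G muleA -EFinM mulVf ?mul1e// expf_neq0// enorm_eq0.
rewrite -(M_inv l0)//; apply: eq_integral => x _.
rewrite /G muleA -EFinM enorm_kinv; congr (_%:E * _).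
have [->|x0] := eqVneq x 0%R.
  by rewrite enorm0 !invr0 !mulr0 !expr0n muln_eq0/= eqn0Ngt n0 mulr0.
by rewrite exprM -exprVn -exprMn; congr (_ ^+ _)%R; field; rewrite enorm_eq0.
Qed.

End inversion_change_of_variables.

(** * Real-valued integrals *)

Section real_integral.
Context (R : realType) (n : nat).
Local Notation mu := (lebesgue_rV R n).
Implicit Types (f g : 'rV[R]_n -> R) (a b v x y : 'rV[R]_n).

Definition itg f : Prop := mu.-integrable setT (EFin \o f).
Definition Int f : R := Rintegral mu setT f.

Lemma itg_measurable f : itg f -> measurable_fun setT f.
Proof. by move=> /(measurable_int mu)/measurable_EFinP. Qed.

Lemma Int_EFin f : itg f -> ((Int f)%:E = \int[mu]_x (f x)%:E)%E.
Proof. by move=> If; rewrite fineK//; exact: integrable_fin_num. Qed.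

Lemma eq_itg f g : f =1 g -> itg f -> itg g.
Proof. by move=> fg; rewrite /itg (_ : f = g)//; exact/funext. Qed.

Lemma eq_Int f g : f =1 g -> Int f = Int g.
Proof. by move=> fg; congr Int; exact/funext. Qed.

Lemma itg0 : itg (fun _ => 0).
Proof. exact: (integrable0 mu setT). Qed.

Lemma itgD f g : itg f -> itg g -> itg (fun v => f v + g v).
Proof. by move=> If Ig; apply: (integrableD measurableT If Ig). Qed.

Lemma itgB f g : itg f -> itg g -> itg (fun v => f v - g v).
Proof. by move=> If Ig; apply: (integrableB measurableT If Ig). Qed.

Lemma itgZ c f : itg f -> itg (fun v => c * f v).
Proof. by move=> If; apply: (integrableZl measurableT c If). Qed.

Lemma IntD f g : itg f -> itg g -> Int (fun v => f v + g v) = Int f + Int g.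
Proof. by move=> If Ig; exact: RintegralD. Qed.

Lemma IntB f g : itg f -> itg g -> Int (fun v => f v - g v) = Int f - Int g.
Proof. by move=> If Ig; exact: RintegralB. Qed.

Lemma IntZ c f : itg f -> Int (fun v => c * f v) = c * Int f.
Proof. by move=> If; exact: RintegralZl. Qed.

Lemma Int0 : Int (fun _ => 0) = 0.
Proof. by rewrite /Int /Rintegral integral0. Qed.

Lemma Int_ge0 f : (forall v, 0 <= f v) -> 0 <= Int f.
Proof. by move=> f0; apply: Rintegral_ge0. Qed.

Lemma itg_lty f : measurable_fun setT f -> (\int[mu]_x `|f x|%:E < +oo)%E -> itg f.
Proof. by move=> mf foo; apply/integrableP; split => //; exact/measurable_EFinP. Qed.

Lemma itg_abs f : itg f -> itg (fun v => `|f v|).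
Proof. by move=> /integrable_norm. Qed.

Lemma Int_abs f : itg f -> `|Int f| <= Int (fun v => `|f v|).
Proof. by move=> If; apply: le_normr_Rintegral. Qed.

Lemma itg_le f g : itg g -> measurable_fun setT f -> (forall v, `|f v| <= g v) -> itg f.
Proof.
move=> Ig mf fg; apply: (le_integrable measurableT _ _ Ig).
  exact/measurable_EFinP.
by move=> v _; rewrite lee_fin (le_trans (fg v))// ler_norm.
Qed.

Lemma Int_le f g : itg f -> itg g -> (forall v, f v <= g v) -> Int f <= Int g.
Proof. by move=> If Ig fg; apply: le_Rintegral. Qed.

End real_integral.

Section null_points.
Context (R : realType) (n : nat).
Hypothesis n0 : (0 < n)%N.
Local Notation mu := (lebesgue_rV R n).
Implicit Types (f g : 'rV[R]_n -> R) (a b v x y : 'rV[R]_n).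

(** Two exceptional points are enough throughout: the origin and the image pole in comparisons, and
    a single point, taken twice, in changes of variables and on the diagonal of a kernel. *)
Lemma ae_two_points a b (P : 'rV[R]_n -> Prop) :
  (forall v, v != a -> v != b -> P v) -> {ae mu, forall v, setT v -> P v}.
Proof.
move=> abP; apply: (@negligibleS _ _ _ _ ([set a] `|` [set b])).
  move=> v /= nP; apply: contrapT => /not_orP[va vb]; apply: nP => _.
  by apply: abP; exact/eqP.
by apply: negligibleU; apply/negligibleP; [exact: measurable_rV1|exact: lebesgue_rV1
  |exact: measurable_rV1|exact: lebesgue_rV1].
Qed.

Lemma itg_le_ae a b f g : itg g -> measurable_fun setT f ->
  (forall v, v != a -> v != b -> `|f v| <= g v) -> itg f.
Proof.
move=> Ig mf fg; apply: itg_lty => //.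
apply: (@le_lt_trans _ _ (\int[mu]_x `|(g x)%:E|)%E).
  apply: ae_ge0_le_integral => //.
  - by apply/measurable_EFinP; apply: measurableT_comp.
  - by apply: measurableT_comp => //; exact: measurable_int Ig.
  apply: (@ae_two_points a b) => v va vb; rewrite lee_fin.
  by rewrite (le_trans (fg _ va vb))// ler_norm.
by case/integrableP: Ig.
Qed.

Lemma Int_eq_ae a b f g : itg f -> itg g ->
  (forall v, v != a -> v != b -> f v = g v) -> Int f = Int g.
Proof.
move=> If Ig fg; congr fine; apply: ae_eq_integral => //.
- exact: measurable_int If.
- exact: measurable_int Ig.
by apply: (@ae_two_points a b) => v va vb; rewrite fg.
Qed.

Lemma Int_le_ae a b f g : itg f -> itg g ->
  (forall v, v != a -> v != b -> f v <= g v) -> Int f <= Int g.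
Proof.
(* [Int_le] wants the inequality everywhere, so [f] is overwritten by [g] at the two points. *)
move=> If Ig fg; pose h v := if (v == a) || (v == b) then g v else f v.
have fh v : v != a -> v != b -> f v = h v.
  by move=> va vb; rewrite /h (negbTE va) (negbTE vb).
have meq c : measurable_fun [set: 'rV[R]_n] (fun v => v == c).
  apply: (measurable_fun_bool true) => //; rewrite setTI.
  rewrite (_ : _ @^-1` _ = [set c]); first exact: measurable_rV1.
  by apply/seteqP; split => v /= /eqP.
have mh : measurable_fun setT h.
  apply: measurable_fun_ifT; last 2 first.
  - exact: itg_measurable.
  - exact: itg_measurable.
  by apply: measurable_or; exact: meq.
have Ih : itg h.
  apply: (@itg_le_ae a b h (fun v => `|f v|)) => //; first exact: itg_abs.
  by move=> v va vb; rewrite -fh.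
rewrite (Int_eq_ae If Ih fh); apply: Int_le => // v; rewrite /h.
by case: ifPn => //; rewrite negb_or => /andP[va vb]; exact: fg.
Qed.

End null_points.

Section change_of_variables.
Context (R : realType) (n : nat).
Hypothesis n0 : (0 < n)%N.
Local Notation mu := (lebesgue_rV R n).
Implicit Types (f g : 'rV[R]_n -> R) (a b v x y : 'rV[R]_n).

Section jacobian.
Variables (k : 'rV[R]_n -> 'rV[R]_n) (J : 'rV[R]_n -> R).
Hypotheses (mk : measurable_fun setT k) (mJ : measurable_fun setT J).
Hypothesis J0 : forall v, 0 <= J v.
Hypothesis kJ : forall f : 'rV[R]_n -> \bar R, measurable_fun setT f ->
  (forall v, 0 <= f v)%E -> (\int[mu]_v f v = \int[mu]_v ((J v)%:E * f (k v)))%E.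

Lemma measurable_jacobian f : measurable_fun setT f ->
  measurable_fun setT (fun v => J v * f (k v)).
Proof. by move=> mf; apply: measurable_funM => //; exact: measurableT_comp. Qed.

Lemma itg_jacobianP f : measurable_fun setT f ->
  itg (fun v => J v * f (k v)) <-> itg f.
Proof.
move=> mf; have E : (\int[mu]_v `|f v|%:E = \int[mu]_v `|J v * f (k v)|%:E)%E.
  rewrite (kJ (f := fun v => `|f v|%:E))//; last first.
    by apply/measurable_EFinP; exact: measurableT_comp.
  by apply: eq_integral => v _; rewrite -EFinM normrM (ger0_norm (J0 v)).
split=> /integrableP[_ If]; apply: itg_lty => //; first by rewrite E.
  exact: measurable_jacobian.
by rewrite -E.
Qed.

Lemma itg_jacobian f : itg f -> itg (fun v => J v * f (k v)).
Proof. by move=> If; apply/itg_jacobianP => //; exact: itg_measurable. Qed.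

Lemma Int_jacobian f : itg f -> Int f = Int (fun v => J v * f (k v)).
Proof.
move=> If; have mf := itg_measurable If.
congr fine; rewrite integralE [RHS]integralE.
have mfE : measurable_fun setT (EFin \o f) by exact/measurable_EFinP.
congr (_ - _)%E.
  rewrite kJ//; last exact: measurable_funepos.
  apply: eq_integral => v _; rewrite !funeposE -!EFin_max -EFinM.
  by rewrite maxr_pMr// mulr0.
rewrite kJ//; last exact: measurable_funeneg.
apply: eq_integral => v _; rewrite !funenegE -!EFinN -!EFin_max -EFinM.
by rewrite maxr_pMr// mulr0 mulrN.
Qed.

End jacobian.

Let affine_jacobian (c : R) b : c != 0 ->
  forall f : 'rV[R]_n -> \bar R, measurable_fun setT f -> (forall v, 0 <= f v)%E ->
  (\int[mu]_v f v = \int[mu]_v ((`|c| ^+ n)%:E * f (c *: v + b)%R))%E.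
Proof.
move=> c0 f mf f0; rewrite ge0_integralZl ?lee_fin ?exprn_ge0//.
  exact: ge0_integral_affine.
by apply: measurableT_comp => //; exact: measurable_affine_rV.
Qed.

Lemma itg_affine (c : R) b f : c != 0 -> itg f -> itg (fun v => f (c *: v + b)).
Proof.
move=> c0 If; have cn0 (_ : 'rV[R]_n) : 0 <= `|c| ^+ n by exact: exprn_ge0.
have := itg_jacobian (measurable_affine_rV c b) (measurable_cst _) cn0
  (affine_jacobian b c0) If.
move=> /(itgZ (`|c| ^- n)); apply: eq_itg => v.
by rewrite mulrA mulVf ?mul1r// expf_neq0// normr_eq0.
Qed.

Lemma Int_affine (c : R) b f : c != 0 -> itg f ->
  Int f = `|c| ^+ n * Int (fun v => f (c *: v + b)).
Proof.
move=> c0 If; have cn0 (_ : 'rV[R]_n) : 0 <= `|c| ^+ n by exact: exprn_ge0.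
rewrite -IntZ; last exact: itg_affine.
exact: (Int_jacobian cn0 (affine_jacobian b c0) If).
Qed.

Lemma itg_shift b f : itg f -> itg (fun v => f (v + b)).
Proof. by move=> /(itg_affine b (oner_neq0 _)); apply: eq_itg => v; rewrite scale1r. Qed.

Lemma Int_shift b f : itg f -> Int f = Int (fun v => f (v + b)).
Proof.
move=> /(Int_affine b (oner_neq0 _)) ->; rewrite normr1 expr1n mul1r.
by apply: eq_Int => v; rewrite scale1r.
Qed.

Lemma Int_opp f : itg f -> Int f = Int (fun v => f (- v)).
Proof.
move=> If; rewrite (@Int_affine (-1) 0)// ?oppr_eq0 ?oner_eq0//.
by rewrite normrN1 expr1n mul1r; apply: eq_Int => v; rewrite scaleN1r addr0.
Qed.

Section kelvin.
Variable l : R.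
Hypothesis l0 : 0 < l.

Let J v := (l / enorm v) ^+ (2 * n).

Let mJ : measurable_fun setT J.
Proof.
apply: measurable_funX; apply: measurable_funM => //.
by apply: measurable_invr => [v|]; [exact: enorm_ge0|exact: measurable_enorm].
Qed.

Let J0 v : 0 <= J v.
Proof. by rewrite exprn_ge0// divr_ge0 ?enorm_ge0// ltW. Qed.

Let kJ (f : 'rV[R]_n -> \bar R) : measurable_fun setT f ->
  (forall v, 0 <= f v)%E -> (\int[mu]_v f v = \int[mu]_v ((J v)%:E * f (kinv l v)))%E.
Proof. exact: ge0_integral_kinv. Qed.

Let mk : measurable_fun setT (kinv l : 'rV[R]_n -> 'rV[R]_n).
Proof. exact: measurable_kinv. Qed.

Lemma itg_kinvP f : measurable_fun setT f ->
  itg (fun v => (l / enorm v) ^+ (2 * n) * f (kinv l v)) <-> itg f.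
Proof. exact: itg_jacobianP. Qed.

Lemma itg_kinv f : itg f -> itg (fun v => (l / enorm v) ^+ (2 * n) * f (kinv l v)).
Proof. exact: itg_jacobian. Qed.

Lemma Int_kinv f : itg f -> Int f = Int (fun v => (l / enorm v) ^+ (2 * n) * f (kinv l v)).
Proof. exact: Int_jacobian. Qed.

End kelvin.

End change_of_variables.

(** * Balls and powers of the norm *)

(** Truncations are factors of the integrand, so that every [Int] is over the whole space and
    linearity applies without changing domains. *)
Notation chi b := ((nat_of_bool b%R)%:R).

Section measurable_chi.
Context (R : realType) d (T : measurableType d).

Lemma measurable_chi (b : T -> bool) : measurable_fun setT b ->
  measurable_fun setT (fun t => (b t)%:R : R).
Proof.
move=> mb; apply: (eq_measurable_fun (fun t => if b t then 1 else 0 : R)).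
  by move=> x _; case: (b x).
exact: measurable_fun_ifT.
Qed.

Lemma measurable_fun_inv_mirror n l (y : 'rV[R]_n) (f : T -> 'rV[R]_n) :
  measurable_fun setT f -> measurable_fun setT (fun t => mirror_dist l y (f t)).
Proof.
move=> mf; apply: (@measurableT_comp _ _ _ _ _ _ (@Num.sqrt R)).
  by apply: continuous_measurable_fun => x; exact: sqrt_continuous.
apply: measurable_funD.
  apply: measurable_funB => //; apply: measurable_funM => //.
  by apply: measurable_dot.
apply: measurable_funM => //; apply: measurable_funM => //.
by apply: measurable_funX; exact: measurable_enorm.
Qed.

End measurable_chi.

Ltac measr := repeat first
  [ exact: measurable_cst | exact: measurable_id
  | apply: measurable_chi
  | apply: measurable_fun_ltr | apply: measurable_fun_ler
  | apply: measurable_enorm | apply: measurable_rVB | apply: measurable_rVD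
  | apply: measurable_rVZ | apply: measurable_kinv | apply: measurable_dot
  | apply: measurable_fun_inv_mirror
  | apply: measurable_powRf
  | apply: measurable_funX | apply: measurable_funM
  | apply: measurable_funD | apply: measurable_funB | apply: measurable_funN
  | (apply: measurable_invr; [by move=> ?; rewrite ?exprn_ge0 ?enorm_ge0|]) ].

Section balls.
Context (R : realType) (n : nat).
Hypothesis n0 : (0 < n)%N.
Local Notation mu := (lebesgue_rV R n).
Implicit Types (f g : 'rV[R]_n -> R) (v x y : 'rV[R]_n) (r : R).

Lemma itg_chi (A : set 'rV[R]_n) : measurable A -> (mu A < +oo)%E -> itg (\1_A : _ -> R).
Proof.
move=> mA Aoo; apply: itg_lty; first exact: measurable_indic.
under eq_integral => v _ do rewrite ger0_norm//.
by rewrite integral_indic// setIT.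
Qed.

Let box (r : R) : set 'rV[R]_n := [set x | forall i, `[- r, r]%classic (x ord0 i)].

Let measurable_box r : measurable (box r).
Proof.
rewrite (_ : box r = \bigcap_(i : 'I_n) (fun x : 'rV[R]_n => x ord0 i) @^-1` `[- r, r]%classic).
  apply: fin_bigcap_measurable => // i _; rewrite -[X in measurable X]setTI.
  exact: measurable_coord_rV.
by apply/seteqP; split => [x Ax i _|x Ax i]; [exact: Ax|exact: (Ax i Logic.I)].
Qed.

Let mu_box r : 0 < r -> mu (box r) = ((2 * r) ^+ n)%:E.
Proof.
move=> r0; rewrite (@lebesgue_rV_box _ _ (fun=> `[- r, r]%classic))//.
under eq_bigr => i _.
  rewrite (lebesgue_measure_itv `[- r, r])/= lte_fin gtrN// -EFinD opprK.
  rewrite (_ : r + r = 2 * r); last by ring.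
  over.
by rewrite prodEFin prodr_const card_ord.
Qed.

Lemma itg_ball y r : itg (fun v => chi (enorm (v - y) < r) : R).
Proof.
have [r0|r0] := leP r 0.
  apply: eq_itg (itg0 _ _) => v.
  by rewrite ltNge (le_trans r0 (enorm_ge0 _)).
have /(itg_shift (- y)) Ib : itg (\1_(box r) : _ -> R).
  by apply: itg_chi => //; rewrite mu_box// ltry.
apply: (itg_le Ib); first by measr.
move=> v; rewrite ger0_norm// indicE.
case: ltP => vr /=; last exact: ler0n.
rewrite mem_set// => i; rewrite /= in_itv/= -ler_norml.
by rewrite (le_trans (coord_le_enorm _ _))// ltW.
Qed.

Definition unit_ball_volume : R := Int (fun v : 'rV[R]_n => chi (enorm v < 1)).

Lemma Int_ball y r : 0 < r ->
  Int (fun v => chi (enorm (v - y) < r)) = r ^+ n * unit_ball_volume.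
Proof.
move=> r0; rewrite (@Int_affine _ _ r y) ?gt_eqF//; last exact: itg_ball.
rewrite gtr0_norm//; congr (_ * _); apply: eq_Int => v.
by rewrite addrK enormZ gtr0_norm// -ltr_pdivlMl// mulVf// gt_eqF.
Qed.

(** No volume is computed: the ball of radius [n + 1] contains the cube [[-1, 1]^n], of volume at
    least 1, and scaling brings the positivity back to radius 1. *)
Lemma unit_ball_volume_gt0 : 0 < unit_ball_volume.
Proof.
have : 1 <= Int (fun v : 'rV[R]_n => chi (enorm (v - 0) < n.+1%:R) : R).
  have Ib : itg (\1_(box 1) : _ -> R) by apply: itg_chi => //; rewrite mu_box// ltry.
  apply: (@le_trans _ _ (Int (\1_(box 1) : _ -> R))).
    rewrite -lee_fin Int_EFin// integral_indic// setIT.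
    apply: (@le_trans _ _ ((2 * 1) ^+ n)%:E).
      by rewrite mulr1 lee_fin -natrX ler1n expn_gt0.
    by rewrite le_eqVlt; apply/orP; left; apply/eqP/esym; exact: mu_box.
  apply: Int_le => //; first exact: itg_ball.
  move=> v; rewrite indicE; case: (boolP (v \in box 1)) => //= /set_mem vb.
  rewrite subr0 (_ : enorm v < _)// -(@ltr_pXn2r _ 2)// ?nnegrE ?enorm_ge0//.
  rewrite enorm_sqr /dot (@le_lt_trans _ _ (\sum_(i < n) 1))//.
    apply: ler_sum => i _; have := vb i; rewrite /= in_itv/= => /andP[h1 h2].
    by rewrite -expr2 -real_normK ?num_real// expr_le1// ler_norml h1.
  rewrite sumr_const card_ord -natrX ltr_nat (@leq_trans (n.+1 ^ 1))//.
  by rewrite leq_exp2l.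
rewrite Int_ball// => h; rewrite ltNge; apply/negP => u0.
have : n.+1%:R ^+ n * unit_ball_volume <= 0 by rewrite pmulr_rle0// exprn_gt0.
by lra.
Qed.

End balls.

Section power_kernels.
Context (R : realType) (n : nat).
Hypothesis n0 : (0 < n)%N.
Local Notation mu := (lebesgue_rV R n).
Implicit Types (f g : 'rV[R]_n -> R) (v x y : 'rV[R]_n) (a b e r : R).

Lemma ler_powRN (p x y : R) : 0 < x -> x <= y -> p <= 0 -> y `^ p <= x `^ p.
Proof.
move=> x0 xy p0; rewrite -(opprK p) !(powRN _ (- p)) lef_pV2 ?posrE ?powR_gt0//; last first.
  exact: lt_le_trans xy.
by rewrite ge0_ler_powR ?nnegrE ?oppr_ge0// ltW// (lt_le_trans x0).
Qed.

Lemma powRVN (x p : R) : 0 <= x -> x^-1 `^ p = x `^ (- p).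
Proof. by move=> x0; rewrite -(powR_inv1 x0) -powRrM mulN1r. Qed.

Lemma itg_annulus e r a : 0 < e -> a <= 0 ->
  itg (fun v : 'rV[R]_n => chi (e <= enorm v < r) * enorm v `^ a).
Proof.
move=> e0 a0; have /(itgZ (e `^ a)) Ib := @itg_ball _ n 0 r.
apply: (itg_le Ib).
  apply: measurable_funM; last by measr.
  by apply: measurable_chi; apply: measurable_and; measr.
move=> v; rewrite subr0 ger0_norm; last by rewrite mulr_ge0// powR_ge0.
rewrite mulrC; case: (leP e (enorm v)) => ev /=; last first.
  by rewrite mulr0 mulr_ge0 ?powR_ge0.
by rewrite ler_wpM2r// ler_powRN.
Qed.

Let X a e := Int (fun v : 'rV[R]_n => chi (e <= enorm v < 1) * enorm v `^ (a - n%:R)).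

(** The part within radius [1/2], dilated by 2, is at most [2^-1 ^ a] times [X a e] itself and is
    absorbed on the left. This sums a geometric series over dyadic annuli in one line, with a bound
    that does not depend on [e]. *)
Let X_bound a e : 0 < a < n%:R -> 0 < e <= 2^-1 ->
  X a e <= X a (2^-1) / (1 - 2^-1 `^ a).
Proof.
move=> /andP[a0 an] /andP[e0 e2]; have an0 : a - n%:R <= 0 by lra.
have ha1 : 2^-1 `^ a < 1 :> R.
  have : 2^-1 `^ a < 1 `^ a :> R by apply: gt0_ltr_powR => //; rewrite ?nnegrE; lra.
  by rewrite powR1.
rewrite ler_pdivlMr; last by lra.
suff : X a e <= X a 2^-1 + 2^-1 `^ a * X a e by lra.
have h0 : 2^-1 != 0 :> R by rewrite invr_eq0 pnatr_eq0.
pose f v : R := chi (e <= enorm v < 2^-1) * enorm v `^ (a - n%:R).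
have If : itg f by exact: itg_annulus.
have E : X a e = X a 2^-1 + Int f.
  rewrite -IntD//; last exact: itg_annulus.
  apply: eq_Int => v; rewrite /f -mulrDl; congr (_ * _).
  case: (ltP (enorm v) 2^-1) => h1; rewrite ?andbT ?andbF ?addr0 ?add0r.
    by rewrite (_ : enorm v < 1) ?andbT//; lra.
  by rewrite (le_trans e2 h1).
rewrite {1}E lerD2l (Int_affine 0 h0 If) -IntZ; last exact: itg_affine.
rewrite -IntZ; last exact: itg_annulus.
apply: Int_le.
- by apply: itgZ; exact: itg_affine.
- by apply: itgZ; exact: itg_annulus.
move=> v; rewrite /f addr0 enormZ ger0_norm//.
have -> : 2^-1 ^+ n * (chi (e <= 2^-1 * enorm v < 2^-1) *
   (2^-1 * enorm v) `^ (a - n%:R)) =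
   2^-1 `^ a * (chi (e <= 2^-1 * enorm v < 2^-1) * enorm v `^ (a - n%:R)) :> R.
  rewrite powRM ?enorm_ge0// [2^-1 `^ (a - _)]powRB; last by rewrite h0 implybT.
  rewrite powR_mulrn//.
  by field; rewrite expf_neq0// pnatr_eq0.
rewrite ler_wpM2l ?powR_ge0// ler_wpM2r ?powR_ge0// ler_nat.
case: (boolP (e <= 2^-1 * enorm v < 2^-1)) => // /andP[h1 h2].
rewrite [X in (_ <= X)%N](_ : _ = 1%N)//; apply/eqP; rewrite eqb1.
by have ? := enorm_ge0 v; apply/andP; split; lra.
Qed.

Lemma itg_power_ball1 a : 0 < a < n%:R ->
  itg (fun v : 'rV[R]_n => chi (enorm v < 1) * enorm v `^ (a - n%:R)).
Proof.
move=> ha; have /andP[a0 an] := ha.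
pose C := X a (2^-1) / (1 - 2^-1 `^ a).
set f := (fun v => _).
have mf : measurable_fun setT f by rewrite /f; measr.
have f0 v : 0 <= f v by rewrite mulr_ge0 ?powR_ge0.
(* The shift by two keeps the inner radii at most [1/2], as [X_bound] requires. *)
pose g (k : nat) v : R := chi (k.+2%:R^-1 <= enorm v < 1) * enorm v `^ (a - n%:R).
have g0 k v : 0 <= g k v by rewrite mulr_ge0 ?powR_ge0.
have mg k : measurable_fun setT (g k).
  by apply: itg_measurable; apply: itg_annulus => //; lra.
apply: itg_lty => //; apply: (@le_lt_trans _ _ C%:E); last exact: ltry.
have gf v : (g k v)%:E @[k --> \oo] --> `|f v|%:E.
  rewrite ger0_norm//; apply: cvg_EFin; first by apply: nearW.
  apply: cvg_near_cst.
  have [->|v0] := eqVneq v 0.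
    by apply: nearW => k; rewrite /g /f /= enorm0 powR0 ?mulr0// lt_eqF//; lra.
  exists (Num.trunc (enorm v)^-1) => // k /= hk; rewrite /g /f.
  rewrite (_ : _ <= enorm v)//.
  rewrite -(invrK (enorm v)) lef_pV2 ?posrE ?invr_gt0 ?enorm_gt0//.
  have := truncnS_gt (enorm v)^-1; move=> /ltW/le_trans; apply.
  by rewrite ler_nat ltnS (leq_trans hk).
apply: (@le_trans _ _ (limn (fun k => \int[mu]_v (g k v)%:E)%E)).
  rewrite -monotone_convergence//.
  - rewrite le_eqVlt; apply/orP; left; apply/eqP/eq_integral => v _.
    by apply/esym/cvg_lim => //; exact: gf.
  - by move=> k; apply/measurable_EFinP.
  - by move=> k v _; rewrite lee_fin.
  - move=> v _ k1 k2 k12; rewrite lee_fin /g ler_wpM2r ?powR_ge0// ler_nat.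
    case: (leP k1.+2%:R^-1 (enorm v)) => //= h.
    rewrite (le_trans _ h)// lef_pV2 ?posrE// ler_nat.
    exact: k12.
apply: lime_le.
  apply: ereal_nondecreasing_is_cvgn => k1 k2 k12; apply: ge0_le_integral => //.
  - by move=> v _; rewrite lee_fin.
  - by apply/measurable_EFinP.
  - by apply/measurable_EFinP.
  move=> v _; rewrite lee_fin /g ler_wpM2r ?powR_ge0// ler_nat.
  case: (leP k1.+2%:R^-1 (enorm v)) => //= h.
  by rewrite (le_trans _ h)// lef_pV2 ?posrE// ler_nat.
apply: nearW => k; rewrite -Int_EFin; last by apply: itg_annulus => //; lra.
rewrite lee_fin; apply: X_bound => //.
by rewrite invr_gt0 ltr0n/= lef_pV2 ?posrE// ler_nat.
Qed.

Lemma itg_power_ball a r : 0 < a < n%:R -> 0 < r ->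
  itg (fun v : 'rV[R]_n => chi (enorm v < r) * enorm v `^ (a - n%:R)).
Proof.
move=> ha r0.
have /(itg_affine 0 (invr_neq0 (lt0r_neq0 r0)))/(itgZ (r `^ (a - n%:R))) :=
  itg_power_ball1 ha.
apply: eq_itg => v; rewrite addr0 enormZ ger0_norm ?invr_ge0 ?(ltW r0)//.
rewrite ltr_pdivrMl// mulr1 mulrCA; congr (_ * _).
by rewrite -powRM ?mulr_ge0 ?enorm_ge0 ?invr_ge0 ?(ltW r0)// mulrA mulfV ?mul1r// gt_eqF.
Qed.

(** Inversion in the unit sphere, with its density of exponent [- 2n], turns the exponent
    [- (n + b)] at infinity into [b - n] at the origin. *)
Lemma itg_power_tail b e : 0 < b < n%:R -> 0 < e ->
  itg (fun v : 'rV[R]_n => chi (e < enorm v) * enorm v `^ (- (n%:R + b))).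
Proof.
move=> hb e0; have /andP[b0 bn] := hb; apply/(@itg_kinvP _ _ n0 1) => //; first by measr.
have e1 : 0 < e^-1 by rewrite invr_gt0.
apply: eq_itg (itg_power_ball hb e1) => v.
rewrite enorm_kinv expr1n.
have [->|v0] := eqVneq v 0.
  by rewrite enorm0 invr0 mulr0 !powR0 ?mulr0// lt_eqF//; lra.
have v1 : 0 < enorm v by rewrite enorm_gt0.
rewrite mulrCA !div1r; congr (_ * _).
  by rewrite -[e in RHS]invrK ltf_pV2 ?posrE.
rewrite -(powR_inv1 (ltW v1)) -powRrM -powR_mulrn ?powR_ge0// -powRrM -powRD ?implybT//.
  by congr (_ `^ _); rewrite natrM; ring.
by rewrite (gt_eqF v1) implybT.
Qed.

End power_kernels.

(** * Truncated fractional Laplacian and Kelvin transform *)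

Lemma differentiable_near_lipschitz (R : realType) (V : normedModType R) (f : V -> R) x :
  differentiable f x -> exists2 C, 0 < C & \forall v \near x, `|f x - f v| <= C * `|v - x|.
Proof.
move=> df; have [k k0 hk] := linear_lipschitz (diff_continuous df).
exists (k + 1); first by rewrite addr_gt0.
have /eqaddoP/(_ 1 ltr01) h := diff_locally df.
rewrite (near_shift 0 x)/=; apply: filterS h => v /=; rewrite mul1r subr0 addrK => h.
rewrite distrC (_ : f (v + x) - f x = (f (v + x) - (f x + 'd f x v)) + 'd f x v); last first.
  by rewrite opprD addrA subrK.
by rewrite (le_trans (ler_normD _ _))// mulrDl addrC mul1r lerD.
Qed.

Lemma powR_near1_lipschitz (R : realType) (p : R) :
  exists C r : R, [/\ 0 <= C, 0 < r & forall t, `|t - 1| < r -> `|1 - t `^ p| <= C * `|t - 1|].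
Proof.
have df : differentiable (fun t : R => t `^ p) (1 : R).
  by apply/derivable1_diffP; apply: derivable_powR; rewrite in_itv/= andbT.
have [C C0 /nbhs_ballP[r /= r0 H]] := differentiable_near_lipschitz df.
exists C, r; split=> //; first exact: ltW.
move=> t tr; have := H t; rewrite powR1; apply.
by rewrite -ball_normE /ball_/= distrC.
Qed.

Section truncated_laplacian.
Context (R : realType) (n : nat) (s : R).
Hypotheses (n2 : 2 <= n%:R :> R) (s0 : 0 < s) (s1 : s < 1).
Local Notation q := (n%:R + 2 * s).
Local Notation g := (n%:R - 2 * s).
Implicit Types (f G : 'rV[R]_n -> R) (v x y : 'rV[R]_n) (c e r l : R).

Let n0 : (0 < n)%N. Proof. by rewrite -(ltr_nat R); apply: lt_le_trans n2. Qed.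

Definition Kq v : R := enorm v `^ (- q).

Lemma Kq_ge0 v : 0 <= Kq v. Proof. exact: powR_ge0. Qed.

Lemma KqN v : Kq (- v) = Kq v. Proof. by rewrite /Kq enormN. Qed.

Lemma measurable_Kq d (T : measurableType d) (f : T -> 'rV[R]_n) :
  measurable_fun setT f -> measurable_fun setT (fun t => Kq (f t)).
Proof. by move=> mf; apply: measurable_powRf; exact: measurable_enorm. Qed.

Definition tail_integrable f y : Prop := measurable_fun setT f /\
  forall e, 0 < e -> itg (fun v => chi (e < enorm (v - y)) * (f v * Kq (v - y))).

(* [frac_laplacian_const n s] times its limit as [e] tends to [0] is the fractional
   Laplacian of [f] at [y]. *)
Definition trunc_lap e f y : R :=
  Int (fun v => chi (e < enorm (v - y)) * ((f y - f v) * Kq (v - y))).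

Lemma itg_Kq_tail y e : 0 < e -> itg (fun v => chi (e < enorm (v - y)) * Kq (v - y)).
Proof.
move: (s0) (s1) (n2) => S0 S1 N2.
move=> e0; have h : 0 < 2 * s < n%:R by apply/andP; split; lra.
exact: itg_shift (itg_power_tail n0 h e0).
Qed.

Lemma tail_integrable_cst a y : tail_integrable (fun=> a) y.
Proof.
split=> [//|e e0]; apply: eq_itg (itgZ a (itg_Kq_tail y e0)) => v.
by rewrite mulrCA.
Qed.

Lemma tail_integrableD f G y : tail_integrable f y -> tail_integrable G y ->
  tail_integrable (fun v => f v + G v) y.
Proof.
move=> [mf tf] [mG tG]; split=> [|e e0]; first exact: measurable_funD.
by apply: eq_itg (itgD (tf e e0) (tG e e0)) => v; ring.
Qed.

Lemma tail_integrableZ a f y : tail_integrable f y -> tail_integrable (fun v => a * f v) y.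
Proof.
move=> [mf tf]; split=> [|e e0]; first exact: measurable_funM.
by apply: eq_itg (itgZ a (tf e e0)) => v; ring.
Qed.

Lemma tail_integrableB f G y : tail_integrable f y -> tail_integrable G y ->
  tail_integrable (fun v => f v - G v) y.
Proof.
move=> tf /(tail_integrableZ (-1)) tG.
have [m t] := tail_integrableD tf tG; split.
  by apply: eq_measurable_fun m => v _; rewrite mulN1r.
by move=> e /t; apply: eq_itg => v; rewrite mulN1r.
Qed.

Lemma itg_trunc_lap e f y : 0 < e -> tail_integrable f y ->
  itg (fun v => chi (e < enorm (v - y)) * ((f y - f v) * Kq (v - y))).
Proof.
move=> e0 tf.
by have [_] := tail_integrableB (tail_integrable_cst (f y) y) tf; exact.
Qed.

Lemma trunc_lapD e f G y : 0 < e -> tail_integrable f y -> tail_integrable G y ->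
  trunc_lap e (fun v => f v + G v) y = trunc_lap e f y + trunc_lap e G y.
Proof.
move=> e0 tf tG; rewrite -IntD; [|exact: itg_trunc_lap..].
by apply: eq_Int => v; ring.
Qed.

Lemma trunc_lapZ e a f y : 0 < e -> tail_integrable f y ->
  trunc_lap e (fun v => a * f v) y = a * trunc_lap e f y.
Proof.
move=> e0 tf; rewrite -IntZ; last exact: itg_trunc_lap.
by apply: eq_Int => v; ring.
Qed.

Lemma trunc_lapB e f G y : 0 < e -> tail_integrable f y -> tail_integrable G y ->
  trunc_lap e (fun v => f v - G v) y = trunc_lap e f y - trunc_lap e G y.
Proof.
move=> e0 tf tG; rewrite -IntB; [|exact: itg_trunc_lap..].
by apply: eq_Int => v; ring.
Qed.

Lemma sub_expr_le (a b : R) m : 0 <= b <= a -> a ^+ m - b ^+ m <= m%:R * (a - b) * a ^+ m.-1.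
Proof.
move=> /andP[b0 ab]; have a0 : 0 <= a by exact: le_trans ab.
case: m => [|m]; first by rewrite !expr0 subrr !mul0r.
rewrite subrXX mulrAC mulrC (mulrC m.+1%:R) ler_wpM2r ?subr_ge0//.
rewrite mulr_natr -[X in _ *+ X]card_ord -sumr_const; apply: ler_sum => i _ /=.
rewrite -[X in _ <= a ^+ X](subnK (leq_ord i)) exprD ler_wpM2l ?exprn_ge0//.
by rewrite lerXn2r// nnegrE.
Qed.

Section shell.
Variables (y : 'rV[R]_n) (f : 'rV[R]_n -> R) (C r : R).
Hypotheses (y0 : y != 0) (r0 : 0 < r) (mf : measurable_fun setT f).
Hypothesis tf : forall e, 0 < e -> itg (fun v => chi (e < enorm (v - y)) * f v).
Hypothesis bf : forall v, 0 < enorm (v - y) < r ->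
  `|f v| <= C * enorm (v - y) `^ (1 - q).

Let Y := enorm y.
Let Y0 : 0 < Y. Proof. by rewrite enorm_gt0. Qed.

(** The exterior of a ball about a point becomes, under inversion, the exterior of a ball that
    contains the image point but is not centred there: the condition [c * enorm v < enorm (v - y)].
    It still keeps a positive distance from [y], so tail integrability applies. *)
Lemma skew_ball_sub c v : 0 < c < 1 -> c * enorm v < enorm (v - y) ->
  c * Y / 2 < enorm (v - y).
Proof.
move=> /andP[c0 c1] h; have t : Y - enorm (v - y) <= enorm v.
  by have := enormD v (y - v); rewrite addrCA subrr addr0 (enormBC y v) /Y; lra.
have h2 := enorm_ge0 (v - y); move: Y0 h t h2.
move: (enorm (v - y)) (enorm v) (Y) => t a b; nra.
Qed.

Lemma itg_skew c : 0 < c < 1 -> itg (fun v => chi (c * enorm v < enorm (v - y)) * f v).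
Proof.
move=> hc; have /andP[c0 c1] := hc.
have d0 : 0 < c * Y / 2 by rewrite divr_gt0// mulr_gt0.
apply: (itg_le (itg_abs (tf d0))).
  by apply: measurable_funM => //; measr.
move=> v; rewrite !normrM ler_wpM2r// !ger0_norm// ler_nat.
by case: (ltP (c * enorm v)) => // /(skew_ball_sub hc) ->.
Qed.

(** The skew and the round truncation differ only where [|v - y|] lies between [c * Y * (1 - 2c)]
    and [c * Y * (1 + 2c)]. That shell has volume of order [c^(n+1)] and the integrand is there of
    order [c^(1-q)]; the product has order [c^(2-2s)]. *)
Lemma shell_estimate : exists2 K, 0 <= K & exists2 d, 0 < d & forall c, 0 < c < d ->
  `|Int (fun v => chi (c * enorm v < enorm (v - y)) * f v) -
    Int (fun v => chi (c * Y < enorm (v - y)) * f v)| <= K * c `^ (2 - 2 * s).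
Proof.
move: (s0) (s1) (n2) => S0 S1 N2.
pose M0 := `|C| * (Y / 2) `^ (1 - q).
pose K := M0 * (unit_ball_volume R n * Y ^+ n * (n%:R * 4 * 2 ^+ n.-1)).
have w0 := unit_ball_volume_gt0 R n0.
exists K.
  rewrite /K /M0; rewrite !mulr_ge0// ?powR_ge0// ?exprn_ge0// ltW//.
(* [c < 1/4] keeps the shell outside radius [c * Y / 2]; [2 * c * Y < r] keeps it where [bf]
   holds. *)
exists (Num.min 4^-1 (r / (2 * Y))); first by rewrite lt_min invr_gt0 ltr0n divr_gt0// mulr_gt0.
move=> c; rewrite lt_min => /and3P[c0 c4 cr].
have hc : 0 < c < 1 by apply/andP; split; lra.
have cY : 0 < c * Y by rewrite mulr_gt0.
have cYr : 2 * (c * Y) < r by move: cr; rewrite ltr_pdivlMr ?mulr_gt0//; lra.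
pose t1 := c * Y * (1 - 2 * c); pose t2 := c * Y * (1 + 2 * c).
have t10 : c * Y / 2 <= t1 by rewrite /t1 -subr_ge0; nra.
have t12 : t1 < t2 by rewrite /t1 /t2; nra.
have t2r : t2 < r by rewrite /t2; nra.
rewrite -IntB; [|exact: itg_skew|exact: tf].
pose M := `|C| * (c * Y / 2) `^ (1 - q).
have M00 : 0 <= M by rewrite mulr_ge0 ?powR_ge0.
pose S v : R := M * (chi (enorm (v - y) < t2) - chi (enorm (v - y) < t1)).
have IS : itg S by apply: itgZ; apply: itgB; exact: itg_ball.
have Ib : itg (fun v => chi (c * enorm v < enorm (v - y)) * f v -
     chi (c * Y < enorm (v - y)) * f v) by apply: itgB; [exact: itg_skew|exact: tf].
apply: (le_trans (Int_abs Ib)); apply: (@le_trans _ _ (Int S)).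
  apply: Int_le => //; first exact: itg_abs.
  move=> v; rewrite -mulrBl normrM /S.
  pose t := enorm (v - y).
  have tv : Y - t <= enorm v.
    by have := enormD v (y - v); rewrite addrCA subrr addr0 (enormBC y v) /Y /t; lra.
  have vt : enorm v <= Y + t by have := enormD y (v - y); rewrite addrCA subrr addr0.
  (* [enorm v] differs from [Y] by at most [enorm (v - y)]: below [t1] both indicators are 0, and
     from [t2] on both are 1. *)
  have [tt1|tt1] := ltP (enorm (v - y)) t1.
    rewrite (lt_trans tt1 t12) subrr mulr0 [X in `|X|](_ : _ = 0) ?normr0 ?mul0r//.
    have -> : (c * Y < enorm (v - y)) = false.
      by apply/negbTE; rewrite -leNgt ltW// (lt_le_trans tt1)// /t1; nra.
    have -> : (c * enorm v < enorm (v - y)) = false.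
      apply/negbTE; rewrite -leNgt -/t; move: tt1 tv; rewrite /t1 -/t => tt1 tv; nra.
    by rewrite subrr.
  have [tt2|tt2] := ltP (enorm (v - y)) t2; last first.
    rewrite subrr mulr0 [X in `|X|](_ : _ = 0) ?normr0 ?mul0r//.
    have -> : (c * Y < enorm (v - y)).
      by rewrite (lt_le_trans _ tt2)// /t2; nra.
    have -> : (c * enorm v < enorm (v - y)).
      rewrite -/t; move: tt2 vt; rewrite /t2 -/t => tt2 vt.
      have : c * enorm v <= c * (Y + t) by rewrite ler_pM2l.
      have : (1 - c) * t >= (1 - c) * (c * Y * (1 + 2 * c)) by rewrite ler_pM2l//; lra.
      have : 0 < c * Y * (c * (1 - 2 * c)) by rewrite !mulr_gt0//; lra.
      by lra.
    by rewrite subrr.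
  rewrite subr0 mulr1 -[leRHS]mul1r ler_pM//.
    by case: ltP => _; case: ltP => _; rewrite ?subrr ?subr0 ?sub0r ?normrN ?normr0 ?normr1.
  have t0 : 0 < enorm (v - y) by apply: lt_le_trans tt1; apply: lt_le_trans t10; lra.
  apply: (le_trans (bf _)); first by rewrite t0 (lt_trans tt2).
  apply: (@le_trans _ _ (`|C| * enorm (v - y) `^ (1 - q))).
    by rewrite ler_wpM2r ?powR_ge0// ler_norm.
  rewrite ler_wpM2l// ler_powRN//; first lra.
    by rewrite (le_trans t10).
  lra.
rewrite IntZ; last by apply: itgB; exact: itg_ball.
rewrite IntB; [|exact: itg_ball..].
rewrite !Int_ball; [|lra|lra].
rewrite -mulrBl /t1 /t2 !exprMn -mulrBr.
have h1 : (1 + 2 * c) ^+ n - (1 - 2 * c) ^+ n <= n%:R * (4 * c) * 2 ^+ n.-1.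
  apply: (le_trans (sub_expr_le _ _)); first by apply/andP; split; lra.
  rewrite (_ : 1 + 2 * c - (1 - 2 * c) = 4 * c); last by ring.
  rewrite ler_wpM2l//; first by rewrite mulr_ge0//; lra.
  by rewrite lerXn2r ?nnegrE//; lra.
have -> : M = M0 * c `^ (1 - q).
  rewrite /M /M0 -mulrA powRM ?(ltW c0)//; last by rewrite divr_ge0// ltW.
  by ring.
apply: (@le_trans _ _ (M0 * c `^ (1 - q) * (c ^+ n * Y ^+ n * (n%:R * (4 * c) * 2 ^+ n.-1) *
   unit_ball_volume R n))).
  rewrite ler_wpM2l ?mulr_ge0 ?powR_ge0// ler_wpM2r ?(ltW w0)//.
  by rewrite ler_wpM2l// mulr_ge0// exprn_ge0// ltW.
rewrite le_eqVlt; apply/orP; left; apply/eqP; rewrite /K.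
have -> : c `^ (2 - 2 * s) = c `^ (1 - q) * c ^+ n * c.
  rewrite -powR_mulrn ?(ltW c0)// -[X in _ = _ * X]powRr1 ?(ltW c0)//.
  rewrite -!powRD ?(gt_eqF c0) ?implybT//; congr (_ `^ _); ring.
by ring.
Qed.

Lemma shell_cvg :
  (Int (fun v => chi (c * enorm v < enorm (v - y)) * f v) -
   Int (fun v => chi (c * Y < enorm (v - y)) * f v)) @[c --> 0^'+] --> 0.
Proof.
move: (s0) (s1) (n2) => S0 S1 N2.
have [K K0 [d d0 H]] := shell_estimate.
have : (K * c `^ (2 - 2 * s)) @[c --> 0^'+] --> K * 0.
  by apply: cvgMr; apply: powR_cvg0; lra.
rewrite mulr0 => h.
apply: norm_cvg0.
apply: (squeeze_cvgr _ (@cvg_cst _ _ _ _ _) h).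
near=> c; rewrite normr_ge0/= H//; apply/andP; split.
  by near: c; exact: nbhs_right_gt.
by near: c; exact: nbhs_right_lt.
Unshelve. all: by end_near. Qed.

End shell.

Definition kelvin l f v : R := (l / enorm v) `^ g * f (kinv l v).

Lemma measurable_kelvin l f : 0 < l -> measurable_fun setT f ->
  measurable_fun setT (kelvin l f).
Proof.
move=> l0 mf; apply: measurable_funM; last first.
  by apply: measurableT_comp => //; exact: measurable_kinv.
by measr.
Qed.

Section kelvin_transform.
Variables (l : R) (y : 'rV[R]_n).
Hypotheses (l0 : 0 < l) (y0 : y != 0).
Local Notation y' := (kinv l y).

Let y'0 : y' != 0. Proof. by rewrite kinv_eq0 ?gt_eqF. Qed.

(** The Jacobian contributes the power [2n] of [l / enorm v] and the kernel the power [- q]. What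
    remains is [2n - q = g], which is why the Kelvin weight has this exponent. *)
Lemma kelvin_skew_integrand G e v : v != 0 ->
  (l / enorm v) ^+ (2 * n) * (chi (e / enorm y * enorm (kinv l v) < enorm (kinv l v - y')) *
     (G (kinv l v) * Kq (kinv l v - y'))) =
  (enorm y / l) `^ q * (chi (e < enorm (v - y)) * (kelvin l G v * Kq (v - y))).
Proof.
move=> v0; have V0 : 0 < enorm v by rewrite enorm_gt0.
have Y0 : 0 < enorm y by rewrite enorm_gt0.
rewrite (enorm_kinvB l0 v0 y0) (enorm_kinv l v).
have -> : (e / enorm y * (l ^+ 2 / enorm v) < l ^+ 2 * enorm (v - y) / (enorm v * enorm y)) =
    (e < enorm (v - y)).
  rewrite (_ : e / enorm y * _ = l ^+ 2 / (enorm v * enorm y) * e); last first.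
    by field; rewrite !gt_eqF.
  rewrite (_ : l ^+ 2 * _ / _ = l ^+ 2 / (enorm v * enorm y) * enorm (v - y)); last first.
    by field; rewrite !gt_eqF.
  by rewrite ltr_pM2l// divr_gt0 ?mulr_gt0 ?exprn_gt0.
rewrite /kelvin /Kq (enorm_kinvB l0 v0 y0).
rewrite (_ : l ^+ 2 * _ / _ = (l / enorm v * (l / enorm y)) * enorm (v - y)); last first.
  by field; rewrite !gt_eqF.
rewrite powRM ?enorm_ge0 ?mulr_ge0 ?divr_ge0 ?invr_ge0 ?enorm_ge0 ?(ltW l0)//.
rewrite [(l / _ * (l / _)) `^ _]powRM ?divr_ge0 ?invr_ge0 ?enorm_ge0 ?(ltW l0)//.
rewrite -powR_mulrn ?divr_ge0 ?enorm_ge0 ?(ltW l0)//.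
have -> : (l / enorm v) `^ g = (l / enorm v) `^ (2 * n)%:R * (l / enorm v) `^ (- q).
  rewrite -powRD ?(gt_eqF (divr_gt0 l0 V0)) ?implybT//.
  by congr (_ `^ _); rewrite natrM; ring.
have -> : (enorm y / l) `^ q = (l / enorm y) `^ (- q).
  by rewrite -powRVN ?divr_ge0 ?enorm_ge0 ?(ltW l0)// invf_div.
by ring.
Qed.

Lemma itg_kelvin_skew G e : 0 < e < enorm y -> tail_integrable G y' ->
  itg (fun v => chi (e / enorm y * enorm v < enorm (v - y')) * (G v * Kq (v - y'))).
Proof.
move=> /andP[e0 ey] [mG tG].
have Y0 : 0 < enorm y by rewrite enorm_gt0.
apply: itg_skew => //; last by rewrite divr_gt0//= ltr_pdivrMr// mul1r.
apply: measurable_funM => //; apply: measurable_Kq; measr.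
Qed.

Lemma itg_kelvin G e : 0 < e -> tail_integrable G y' ->
  itg (fun v => chi (e < enorm (v - y)) * (kelvin l G v * Kq (v - y))).
Proof.
move=> e0 tG; have [mG _] := tG.
have Y0 : 0 < enorm y by rewrite enorm_gt0.
have mK := measurable_kelvin l0 mG.
(* The skew region needs the ratio [e / enorm y] below 1; for larger [e] the integrand is dominated
   by the one for a smaller radius. *)
wlog ey : e e0 / e < enorm y.
  move=> W; pose e' := Num.min e (enorm y / 2).
  have e'0 : 0 < e' by rewrite lt_min e0 divr_gt0.
  have e'y : e' < enorm y by rewrite gt_min ltr_pdivrMr//; apply/orP; right; lra.
  apply: (itg_le (itg_abs (W _ e'0 e'y))).
    by apply: measurable_funM; [measr|apply: measurable_funM => //; apply: measurable_Kq; measr].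
  move=> v; rewrite !normrM ler_wpM2r ?mulr_ge0// !ger0_norm// ler_nat.
  case: (ltP e) => // ev; rewrite (_ : e' < _)// (le_lt_trans _ ev)//.
  by rewrite ge_min lexx.
have hey : 0 < e < enorm y by rewrite e0.
have H := itg_kinv n0 l0 (itg_kelvin_skew hey tG).
apply: (itg_le_ae (a := 0) (b := 0) n0 (itg_abs (itgZ ((enorm y / l) `^ (- q)) H))).
  by apply: measurable_funM; [measr|apply: measurable_funM => //; apply: measurable_Kq; measr].
move=> v v0 _; rewrite kelvin_skew_integrand// [X in _ <= `|X|]mulrA -powRD ?addNr ?powRr0 ?mul1r//.
by rewrite (gt_eqF (divr_gt0 Y0 l0)) implybT.
Qed.

Lemma tail_integrable_kelvin G : tail_integrable G y' -> tail_integrable (kelvin l G) y.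
Proof.
move=> tG; split=> [|e e0]; last exact: itg_kelvin.
by apply: measurable_kelvin => //; case: tG.
Qed.

Lemma Int_kelvin G e : 0 < e < enorm y -> tail_integrable G y' ->
  Int (fun v => chi (e < enorm (v - y)) * (kelvin l G v * Kq (v - y))) =
  (l / enorm y) `^ q *
  Int (fun v => chi (e / enorm y * enorm v < enorm (v - y')) * (G v * Kq (v - y'))).
Proof.
move=> hey tG; have /andP[e0 ey] := hey.
have Y0 : 0 < enorm y by rewrite enorm_gt0.
have IK := itg_kelvin_skew hey tG.
rewrite [X in _ * X](Int_kinv n0 l0 IK) -IntZ; last exact: (itg_kinv n0 l0 IK).
apply: (Int_eq_ae (a := 0) (b := 0) n0).
- exact: itg_kelvin.
- by apply: itgZ; exact: (itg_kinv n0 l0 IK).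
move=> v v0 _; rewrite kelvin_skew_integrand// [RHS]mulrA -powRM ?divr_ge0 ?enorm_ge0 ?(ltW l0)//.
rewrite (_ : l / enorm y * (enorm y / l) = 1) ?powR1 ?mul1r//.
by field; rewrite !gt_eqF.
Qed.

End kelvin_transform.

Lemma itg_trunc_lap0 f y : tail_integrable f y -> forall e, 0 < e ->
  itg (fun v => chi (e < enorm (v - y)) * ((f y - f v) * Kq (v - y))).
Proof. by move=> tf e e0; exact: itg_trunc_lap. Qed.

(** One-point regularity is all that the shell estimate consumes. *)
Definition lipschitz_at f y : Prop :=
  exists C r : R, 0 < r /\ forall v, enorm (v - y) < r -> `|f y - f v| <= C * enorm (v - y).

Lemma skew_trunc_lap_cvg f y : y != 0 -> tail_integrable f y -> lipschitz_at f y ->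
  (Int (fun v => chi (c * enorm v < enorm (v - y)) * ((f y - f v) * Kq (v - y))) -
   trunc_lap (c * enorm y) f y) @[c --> 0^'+] --> 0.
Proof.
move=> y0 tf [C [r [r0 fC]]]; have [mf _] := tf.
apply: (@shell_cvg y (fun v => (f y - f v) * Kq (v - y)) C r y0 r0).
- by apply: measurable_funM; [measr|apply: measurable_Kq; measr].
- exact: itg_trunc_lap0.
move=> v /andP[v0 vr]; rewrite normrM (ger0_norm (Kq_ge0 _)).
rewrite powRD; last by rewrite (gt_eqF v0) implybT.
rewrite powRr1 ?enorm_ge0// mulrA ler_wpM2r ?Kq_ge0//.
exact: fC.
Qed.

Lemma at_right0_mull (a : R) (F : R -> R) (L : R) : 0 < a ->
  F c @[c --> 0^'+] --> L -> F (a * c) @[c --> 0^'+] --> L.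
Proof.
move=> a0 FL; apply: cvg_comp FL => A [d /= d0 dA].
exists (d / a) => /=; first exact: divr_gt0.
move=> x /= xd x0; apply: dA => /=; last exact: mulr_gt0.
move: xd; rewrite !sub0r !normrN !gtr0_norm ?mulr_gt0//.
by rewrite ltr_pdivlMr// mulrC.
Qed.

Lemma lipschitz_kelvin1 y : y != 0 -> lipschitz_at (kelvin (enorm y) (fun=> 1)) y.
Proof.
move=> y0; have Y0 : 0 < enorm y by rewrite enorm_gt0.
have [C [r [C0 r0 H]]] := powR_near1_lipschitz g.
exists (2 * C / enorm y), (Num.min (enorm y / 2) (r * enorm y / 2)); split.
  by rewrite lt_min !divr_gt0// mulr_gt0.
move=> v; rewrite lt_min => /andP[h1 h2].
have tv : enorm y - enorm (v - y) <= enorm v.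
  by have := enormB_ge y v; rewrite (enormBC y v); lra.
have tv2 : enorm v - enorm y <= enorm (v - y) by exact: enormB_ge.
have v2 : enorm y / 2 <= enorm v by lra.
have V0 : 0 < enorm v by lra.
have tb : `|enorm y / enorm v - 1| <= 2 / enorm y * enorm (v - y).
  rewrite (_ : enorm y / enorm v - 1 = (enorm y - enorm v) / enorm v); last first.
    by field; rewrite gt_eqF.
  rewrite normrM (gtr0_norm (x := (enorm v)^-1)) ?invr_gt0// mulrC ler_pM ?invr_ge0 ?(ltW V0)//.
    by rewrite -[leRHS]invf_div lef_pV2 ?posrE ?divr_gt0.
  by rewrite ler_norml; apply/andP; split; lra.
rewrite /kelvin divff ?gt_eqF// powR1 !mulr1.
apply: (le_trans (H _ _)).
  apply: (le_lt_trans tb); rewrite mulrAC ltr_pdivrMr//; lra.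
rewrite (_ : 2 * C / enorm y * enorm (v - y) = C * (2 / enorm y * enorm (v - y))); last by ring.
by rewrite ler_wpM2l.
Qed.

(* The inversion in the sphere through [y] maps the principal value to its negative. *)
Lemma power_harmonic y : y != 0 ->
  trunc_lap e (kelvin (enorm y) (fun=> 1)) y @[e --> 0^'+] --> 0.
Proof.
move=> y0; have Y0 : 0 < enorm y by rewrite enorm_gt0.
set l := enorm y; pose phi := kelvin l (fun=> 1).
have yy : kinv l y = y by exact: kinv_fix.
have tphi : tail_integrable phi y.
  by apply: tail_integrable_kelvin => //; exact: tail_integrable_cst.
have phiy : phi y = 1 by rewrite /phi /kelvin divff ?gt_eqF// powR1 mulr1.
have phiE v : v != 0 -> kelvin l phi v = 1.
  move=> v0; rewrite /phi /kelvin mulr1 enorm_kinv -powRM ?divr_ge0 ?enorm_ge0 ?sqr_ge0//.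
  rewrite (_ : _ * _ = 1) ?powR1//; field.
  by rewrite enorm_eq0 v0 gt_eqF.
have Lphi : lipschitz_at phi y.
  exact: lipschitz_kelvin1.
have E e : 0 < e < l -> trunc_lap e phi y =
   - Int (fun v => chi (e / l * enorm v < enorm (v - y)) * ((phi y - phi v) * Kq (v - y))).
  move=> el; have /andP[e0 _] := el.
  have tB : tail_integrable (fun v => phi y - phi v) (kinv l y).
    by rewrite yy; exact: (tail_integrableB (tail_integrable_cst _ _) tphi).
  have := Int_kelvin Y0 y0 el tB.
  rewrite divff ?gt_eqF// powR1 mul1r yy => <-.
  rewrite -mulN1r -IntZ; last exact: itg_kelvin.
  apply: (Int_eq_ae (a := 0) (b := 0) n0).
  - exact: itg_trunc_lap.
  - by apply: itgZ; exact: itg_kelvin.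
  move=> v v0 _.
  have -> : kelvin (enorm y) (fun v => phi y - phi v) v = phi v - phi y.
    have := phiE _ v0; rewrite /kelvin mulrBr phiy mulr1 => ->.
    by rewrite /phi /kelvin mulr1.
  by ring.
(* By [E] the skew truncation is minus the round one, while their difference tends to 0; this
   difference is [- 2] times [trunc_lap], whence the factor [- 2^-1]. *)
have H := skew_trunc_lap_cvg y0 tphi Lphi.
pose F c := Int (fun v => chi (c * enorm v < enorm (v - y)) * ((phi y - phi v) * Kq (v - y))) -
   trunc_lap (c * enorm y) phi y.
have H2 : - 2^-1 * F (l^-1 * e) @[e --> 0^'+] --> (- 2^-1 * 0 : R).
  by apply: cvgMr; apply: at_right0_mull => //; rewrite invr_gt0.
rewrite mulr0 in H2; apply: cvg_trans H2; apply: near_eq_cvg.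
near=> e; have e0 : 0 < e by near: e; exact: nbhs_right_gt.
have el : e < l by near: e; exact: nbhs_right_lt.
rewrite /F (_ : l^-1 * e * enorm y = e); last by rewrite -/l; field; rewrite gt_eqF.
have := E e; rewrite e0 el (mulrC e) => /(_ isT) h.
rewrite -[Int _]opprK -h; field.
Unshelve. all: by end_near. Qed.

End truncated_laplacian.

Lemma at_right0_eq (R : realType) (F G : R -> R) (L : R) :
  F e @[e --> 0^'+] --> L -> (forall e, 0 < e -> F e = G e) -> G e @[e --> 0^'+] --> L.
Proof.
move=> FL FG; apply: cvg_trans FL; apply: near_eq_cvg; near=> e.
by apply: FG; near: e; exact: nbhs_right_gt.
Unshelve. all: by end_near. Qed.

Lemma at_right0_near_eq (R : realType) (d : R) (F G : R -> R) (L : R) : 0 < d ->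
  F e @[e --> 0^'+] --> L -> (forall e, 0 < e < d -> F e = G e) -> G e @[e --> 0^'+] --> L.
Proof.
move=> d0 FL FG; apply: cvg_trans FL; apply: near_eq_cvg; near=> e.
apply: FG; apply/andP; split; first by near: e; exact: nbhs_right_gt.
by near: e; exact: nbhs_right_lt.
Unshelve. all: by end_near. Qed.

Lemma at_right0_add (R : realType) (F G : R -> R) (L M : R) :
  F e @[e --> 0^'+] --> L -> G e @[e --> 0^'+] --> M ->
  F e + G e @[e --> 0^'+] --> (L + M : R).
Proof. by move=> FL GM; apply: cvgD. Qed.

Lemma at_right0_mul (R : realType) (a : R) (F : R -> R) (L : R) :
  F e @[e --> 0^'+] --> L -> a * F e @[e --> 0^'+] --> (a * L : R).
Proof. by move=> FL; apply: cvgMr. Qed.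

(** * Principal values under inversion and translation *)

Section principal_values.
Context (R : realType) (n : nat) (s : R).
Hypotheses (n2 : 2 <= n%:R :> R) (s0 : 0 < s) (s1 : s < 1).
Local Notation q := (n%:R + 2 * s).
Local Notation g := (n%:R - 2 * s).
Local Notation Kq := (@Kq R n s).
Local Notation trunc_lap := (@trunc_lap R n s).
Local Notation tail_integrable := (@tail_integrable R n s).
Local Notation kelvin := (@kelvin R n s).
Implicit Types (f : 'rV[R]_n -> R) (v x y z : 'rV[R]_n) (c e r l : R).

Let n0 : (0 < n)%N. Proof. by rewrite -(ltr_nat R); apply: lt_le_trans n2. Qed.

(** With [y' = kinv l y], the increment of [kelvin l f] at [y] splits into [kelvin l (f y' - f)],
    which inversion carries to a skew truncation at [y'], and [f y'] times the increment of
    [kelvin l 1], whose principal value vanishes. *)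
Lemma kelvin_lap_cvg l y f (L : R) : 0 < l -> y != 0 ->
  tail_integrable f (kinv l y) -> lipschitz_at f (kinv l y) ->
  trunc_lap e f (kinv l y) @[e --> 0^'+] --> L ->
  trunc_lap e (kelvin l f) y @[e --> 0^'+] --> (l / enorm y) `^ q * L.
Proof.
move=> l0 y0 tf Lf fL; have Y0 : 0 < enorm y by rewrite enorm_gt0.
set y' := kinv l y in tf Lf fL *.
have y'0 : y' != 0 by rewrite kinv_eq0 ?gt_eqF.
have Y'0 : 0 < enorm y' by rewrite enorm_gt0.
pose S c := Int (fun v => chi (c * enorm v < enorm (v - y')) * ((f y' - f v) * Kq (v - y'))).
have SL : S c @[c --> 0^'+] --> L.
  have h := skew_trunc_lap_cvg n2 s0 s1 y'0 tf Lf.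
  have h2 : trunc_lap (enorm y' * c) f y' @[c --> 0^'+] --> L.
    exact: (at_right0_mull (F := fun c => trunc_lap c f y')).
  have h3 := at_right0_add h h2; rewrite add0r in h3; apply: (at_right0_eq h3) => c c0.
  by rewrite (mulrC (enorm y')) subrK.
have t1 : tail_integrable (fun=> 1) y' by exact: (tail_integrable_cst n2 s0 s1).
have tk1 : tail_integrable (kelvin l (fun=> 1)) y.
  exact: (tail_integrable_kelvin n2 l0 y0 t1).
have tD : tail_integrable (fun v => f y' - f v) y'.
  exact: (tail_integrableB (tail_integrable_cst n2 s0 s1 _ _) tf).
(* Kelvin transforms of 1 for different radii are proportional, so the radius [enorm y], for which
   inversion fixes [y], is enough. *)
have k1 : trunc_lap e (kelvin l (fun=> 1)) y @[e --> 0^'+] --> 0.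
  have E v : kelvin l (fun=> 1) v = (l / enorm y) `^ g * kelvin (enorm y) (fun=> 1) v.
    rewrite /kelvin !mulr1 -powRM ?divr_ge0 ?enorm_ge0 ?(ltW l0)//.
    by congr (_ `^ _); have [->|v0] := eqVneq v 0; [rewrite enorm0 invr0 !mulr0|
      field; rewrite (gt_eqF Y0) enorm_eq0 v0].
  have tky : tail_integrable (kelvin (enorm y) (fun=> 1)) y.
    exact: (tail_integrable_kelvin n2 Y0 y0 (tail_integrable_cst n2 s0 s1 _ _)).
  have h := power_harmonic n2 s0 s1 y0.
  have h2 : (l / enorm y) `^ g * trunc_lap e (kelvin (enorm y) (fun=> 1)) y @[e --> 0^'+] -->
      ((l / enorm y) `^ g * 0 : R) by apply: cvgMr.
  rewrite mulr0 in h2; apply: (at_right0_eq h2) => e e0; rewrite -(trunc_lapZ n2 s0 s1 _ e0 tky).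
  by rewrite /trunc_lap; apply: eq_Int => v; rewrite !E.
have h : (l / enorm y) `^ q * S ((enorm y)^-1 * e) +
   f y' * trunc_lap e (kelvin l (fun=> 1)) y @[e --> 0^'+] -->
   ((l / enorm y) `^ q * L + f y' * 0 : R).
  apply: cvgD; last exact: cvgMr.
  by apply: cvgMr; apply: at_right0_mull => //; rewrite invr_gt0.
rewrite mulr0 addr0 in h; apply: (at_right0_near_eq Y0 h) => e hey.
have /andP[e0 ey] := hey.
have -> : (l / enorm y) `^ q * S ((enorm y)^-1 * e) =
    Int (fun v => chi (e < enorm (v - y)) * (kelvin l (fun v => f y' - f v) v * Kq (v - y))).
  by rewrite (mulrC _ e); exact: (esym (Int_kelvin n2 l0 y0 hey tD)).
have tk := itg_trunc_lap n2 s0 s1 e0 tk1.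
rewrite -(IntZ _ tk) -IntD; last 2 first.
- exact: (itg_kelvin n2 l0 y0 e0 tD).
- exact: itgZ.
by apply: eq_Int => v; rewrite /kelvin -/y'; ring.
Qed.

Lemma tail_integrable_shift f z y :
  tail_integrable f (y + z) -> tail_integrable (fun v => f (v + z)) y.
Proof.
move=> [mf tf]; split=> [|e e0].
  apply: (measurableT_comp mf); apply: measurable_rVD => //; exact: measurable_cst.
apply: eq_itg (itg_shift z (tf e e0)) => v.
by rewrite opprD addrACA subrr addr0.
Qed.

Lemma trunc_lap_shift e f z y : 0 < e -> tail_integrable f (y + z) ->
  trunc_lap e (fun v => f (v + z)) y = trunc_lap e f (y + z).
Proof.
move=> e0 tf; rewrite [RHS](Int_shift z (itg_trunc_lap n2 s0 s1 e0 tf)).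
by apply: eq_Int => v; rewrite opprD addrACA subrr addr0.
Qed.

Definition fundamental z v : R := enorm (v - z) `^ (- g).

Lemma fundamentalE l v : 0 < l -> fundamental 0 v = l `^ (- g) * kelvin l (fun=> 1) v.
Proof.
move: (s0) (s1) (n2) => S0 S1 N2 l0.
rewrite /fundamental subr0 /kelvin mulr1 powRM ?invr_ge0 ?enorm_ge0 ?(ltW l0)//.
rewrite powRVN ?enorm_ge0// mulrA -powRD ?addNr ?powRr0 ?mul1r//.
by rewrite (gt_eqF l0) implybT.
Qed.

Lemma tail_integrable_fundamental z y : y != z -> tail_integrable (fundamental z) y.
Proof.
move=> yz; have yz0 : y - z != 0 by rewrite subr_eq0.
have l0 : 0 < enorm (y - z) by rewrite enorm_gt0.
have t : tail_integrable (kelvin (enorm (y - z)) (fun=> 1)) (y - z).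
  exact: (tail_integrable_kelvin n2 l0 yz0 (tail_integrable_cst n2 s0 s1 _ _)).
have := tail_integrable_shift (tail_integrableZ (enorm (y - z) `^ (- g)) t).
rewrite (_ : (fun v => _) = fundamental z)//; apply/funext => v.
by rewrite -(fundamentalE _ l0) /fundamental (subr0 (v - z)).
Qed.

Lemma fundamental_harmonic z y : y != z ->
  trunc_lap e (fundamental z) y @[e --> 0^'+] --> 0.
Proof.
move=> yz; have yz0 : y - z != 0 by rewrite subr_eq0.
have l0 : 0 < enorm (y - z) by rewrite enorm_gt0.
have t : tail_integrable (kelvin (enorm (y - z)) (fun=> 1)) (y - z).
  exact: (tail_integrable_kelvin n2 l0 yz0 (tail_integrable_cst n2 s0 s1 _ _)).
have h : enorm (y - z) `^ (- g) * trunc_lap e (kelvin (enorm (y - z)) (fun=> 1)) (y - z)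
   @[e --> 0^'+] --> (enorm (y - z) `^ (- g) * 0 : R).
  by apply: cvgMr; exact: power_harmonic.
rewrite mulr0 in h; apply: (at_right0_eq h) => e e0.
rewrite -(trunc_lapZ n2 s0 s1 _ e0 t) -(trunc_lap_shift e0 (tail_integrableZ _ t)).
congr (trunc_lap _ _ _); apply/funext => v.
by rewrite -(fundamentalE _ l0) /fundamental (subr0 (v - z)).
Qed.

Lemma in_Ls_tail_integrable u y : in_Ls s u -> tail_integrable u y.
Proof.
move: (s0) (s1) (n2) => S0 S1 N2.
move=> [mu uoo]; split=> // e e0.
have Iu : itg (fun v => `|u v| / (1 + enorm v `^ q)).
  apply: itg_lty.
    apply: measurable_funM; first exact: measurableT_comp.
    by apply: measurable_invr => [t|]; [rewrite addr_ge0 ?powR_ge0|measr].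
  under eq_integral => v _.
    rewrite ger0_norm; last by rewrite divr_ge0 ?addr_ge0 ?powR_ge0.
    over.
  exact: uoo.
(* Where [e < |v - y|], both [1 <= e^(-q) |v - y|^q] and [|v| <= (1 + |y| / e) |v - y|] hold; the
   two terms dominate the [1] and the power of [|v|] in the weight of [in_Ls]. *)
pose C := e `^ (- q) + (1 + enorm y / e) `^ q.
apply: (itg_le (itgZ C Iu)).
  by apply: measurable_funM; [measr|apply: measurable_funM => //; apply: measurable_Kq; measr].
move=> v; rewrite !normrM (ger0_norm (Kq_ge0 _ _)) ger0_norm//.
have D0 : 0 < 1 + enorm v `^ q by rewrite ltr_pwDl ?powR_ge0.
have C0 : 0 <= C by rewrite addr_ge0 ?powR_ge0.
case: (ltP e (enorm (v - y))) => ev /=; last first.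
  by rewrite mul0r mulr_ge0// divr_ge0// ltW.
have E0 : 0 < enorm (v - y) by exact: lt_trans ev.
rewrite mul1r mulrCA ler_wpM2l// ler_pdivlMr// /Kq powRN ler_pdivrMl ?powR_gt0//.
rewrite [leRHS]mulrC /C (mulrDl (e `^ (- q))); apply: lerD.
  rewrite powRN -ler_pdivrMl ?invr_gt0 ?powR_gt0// invrK mulr1.
  by rewrite ge0_ler_powR ?nnegrE ?enorm_ge0 ?(ltW e0) ?(ltW ev)//; lra.
rewrite -powRM ?enorm_ge0 ?addr_ge0 ?divr_ge0 ?enorm_ge0 ?(ltW e0)//.
rewrite ge0_ler_powR ?nnegrE ?mulr_ge0 ?addr_ge0 ?divr_ge0 ?enorm_ge0 ?(ltW e0)//; first lra.
have h1 : enorm v <= enorm (v - y) + enorm y by have := enormD (v - y) y; rewrite subrK.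
rewrite mulrDl mul1r (le_trans h1)// lerD2l.
by rewrite -mulrA ler_peMr ?enorm_ge0// ler_pdivlMl// mulr1 ltW.
Qed.

(** Tail integrability makes the extended-real truncations finite, so that the limit in [\bar R]
    becomes a limit of [trunc_lap]. *)
Lemma is_frac_laplacian_cvg u y L : tail_integrable u y -> is_frac_laplacian s u y L ->
  exists2 I, trunc_lap e u y @[e --> 0^'+] --> I & L = frac_laplacian_const n s * I.
Proof.
move=> tu [I uI ->]; exists I => //.
suff /fine_cvgP[_ h] : (trunc_lap e u y)%:E @[e --> 0^'+] --> I%:E by exact: h.
apply: cvg_trans uI; apply: near_eq_cvg; near=> e.
have e0 : 0 < e by near: e; exact: nbhs_right_gt.
have t0 : tail_integrable u (0 + y) by rewrite add0r.
have E : trunc_lap e u y = trunc_lap e (fun v => u (v + y)) 0.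
  by rewrite (trunc_lap_shift e0 t0) add0r.
rewrite E Int_EFin; last exact: (itg_trunc_lap n2 s0 s1 e0 (tail_integrable_shift t0)).
rewrite integral_mkcond/=; apply: eq_integral => h _.
rewrite patchE/=; case: ifPn => [/set_mem/= eh|].
  rewrite subr0 eh mul1r add0r (addrC h) /Kq powRN//.
rewrite notin_setE/= => /negP/negbTE; rewrite subr0 => ->.
by rewrite mul0r.
Unshelve. all: by end_near. Qed.

End principal_values.

(** * Maximum principle for antisymmetric functions *)

Opaque enorm Int mirror_dist kinv.

Lemma eq_ler (R : realType) (x y : R) : x = y -> x <= y.
Proof. by move->. Qed.

Lemma itg_chiM (R : realType) n (f : 'rV[R]_n -> R) (b : 'rV[R]_n -> bool) :
  measurable_fun setT b -> itg f -> itg (fun v => chi (b v) * f v).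
Proof.
move=> mb If; apply: (itg_le (itg_abs If)).
  by apply: measurable_funM; [exact: measurable_chi|exact: itg_measurable].
move=> v; rewrite normrM ger0_norm// -[leRHS]mul1r ler_wpM2r//.
by case: (b v).
Qed.

Section maximum_principle.
Context (R : realType) (n : nat) (s : R).
Hypotheses (n2 : 2 <= n%:R :> R) (s0 : 0 < s) (s1 : s < 1).
Variable l : R.
Hypothesis l0 : 0 < l.
Local Notation q := (n%:R + 2 * s).
Local Notation g := (n%:R - 2 * s).
Local Notation Kq := (@Kq R n s).
Local Notation trunc_lap := (@trunc_lap R n s).
Local Notation tail_integrable := (@tail_integrable R n s).
Local Notation kelvin := (@kelvin R n s).
Implicit Types (f G : 'rV[R]_n -> R) (v x y z : 'rV[R]_n) (c e r : R).

Let n0 : (0 < n)%N. Proof. by rewrite -(ltr_nat R); apply: lt_le_trans n2. Qed.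

(** The kernel seen from [y] at the mirror image of [v], with the Jacobian and the Kelvin weight
    already absorbed. *)
Definition Km y v : R := mirror_dist l y v `^ (- q).

Lemma Km_ge0 y v : 0 <= Km y v. Proof. exact: powR_ge0. Qed.

Lemma measurable_Km y : measurable_fun setT (Km y).
Proof. by apply: measurable_powRf; measr. Qed.

Lemma mirror_dist_gt y v : enorm y < l -> enorm v < l -> enorm (v - y) < mirror_dist l y v.
Proof.
move=> yl vl; rewrite -(@ltr_pXn2r _ 2)// ?nnegrE ?enorm_ge0 ?mirror_dist_ge0//.
rewrite -subr_gt0 enormBC mirror_distB// divr_gt0 ?exprn_gt0// mulr_gt0// subr_gt0.
  by rewrite ltr_pXn2r// ?nnegrE ?enorm_ge0// ltW.
by rewrite ltr_pXn2r// ?nnegrE ?enorm_ge0// ltW.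
Qed.

Lemma mirror_dist_ge_bdry y v : enorm v < l -> l - enorm y <= mirror_dist l y v.
Proof.
move=> vl; apply: le_trans (mirror_dist_ge y v l0).
by rewrite lerD2l lerN2 ler_pdivrMr// ler_wpM2l ?enorm_ge0// ltW.
Qed.

Lemma Km_le y v : enorm y < l -> enorm v < l -> Km y v <= (l - enorm y) `^ (- q).
Proof.
move: (s0) (s1) (n2) => S0 S1 N2 yl vl.
by rewrite ler_powRN ?subr_gt0// ?mirror_dist_ge_bdry//; lra.
Qed.

Lemma Km_le_Kq y v : enorm y < l -> enorm v < l -> v != y -> Km y v <= Kq (v - y).
Proof.
move: (s0) (s1) (n2) => S0 S1 N2 yl vl vy.
rewrite ler_powRN ?enorm_gt0 ?subr_eq0//; first exact/ltW/mirror_dist_gt.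
lra.
Qed.

Lemma itg_Km y : enorm y < l -> itg (fun v => chi (enorm v < l) * Km y v).
Proof.
move=> yl; have /(itgZ ((l - enorm y) `^ (- q))) Ib := @itg_ball _ n 0 l.
apply: (itg_le Ib).
  by apply: measurable_funM; [measr|exact: measurable_Km].
move=> v; rewrite subr0 ger0_norm ?mulr_ge0 ?Km_ge0// mulrC.
by case: (ltP (enorm v) l) => vl; rewrite ?mulr1 ?mulr0// Km_le.
Qed.

Section folding.
Variables (G : 'rV[R]_n -> R) (y : 'rV[R]_n).
Hypotheses (y0 : y != 0) (yl : enorm y < l) (tG : tail_integrable G y).
Hypothesis antiG : forall v, v != 0 -> kelvin l G v = - G v.

Let d := l - enorm y.
Let d0 : 0 < d. Proof. by rewrite subr_gt0. Qed.

Lemma outside_ball v : l <= enorm v -> d <= enorm (v - y).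
Proof. by move=> lv; rewrite /d; have := enormB_ge v y; lra. Qed.

Lemma itg_outside f : tail_integrable f y ->
  itg (fun v => chi (l <= enorm v) * (f v * Kq (v - y))).
Proof.
move=> [mf tf]; have d2 : 0 < d / 2 by rewrite divr_gt0.
have h : measurable_fun setT (fun v : 'rV[R]_n => l <= enorm v) by measr.
apply: eq_itg (itg_chiM h (tf _ d2)) => v.
case: (leP l (enorm v)) => [lv|_]; last by rewrite !mul0r.
have dv := outside_ball lv; have := d0 => d0'.
by rewrite (_ : d / 2 < _) ?mul1r//; lra.
Qed.

Definition exit_mass : R := Int (fun v => chi (l <= enorm v) * Kq (v - y)).

Lemma itg_exit : itg (fun v => chi (l <= enorm v) * Kq (v - y)).
Proof.
apply: eq_itg (itg_outside (tail_integrable_cst n2 s0 s1 1 y)) => v.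
by rewrite mul1r.
Qed.

Let fold_integrand v : v != 0 ->
  (l / enorm v) ^+ (2 * n) * (chi (l <= enorm (kinv l v)) * (G (kinv l v) * Kq (kinv l v - y))) =
  - (chi (enorm v <= l) * (G v * Km y v)).
Proof.
move=> v0; have V0 : 0 < enorm v by rewrite enorm_gt0.
rewrite enorm_kinv (_ : (l <= l ^+ 2 / enorm v) = (enorm v <= l)); last first.
  by rewrite ler_pdivlMr// expr2 ler_pM2l.
have := antiG v0; rewrite /kelvin => /(congr1 ( *%R (chi (enorm v <= l) * Km y v))) h.
transitivity (chi (enorm v <= l) * Km y v * - G v); last by ring.
rewrite -h /Km /Kq (enormBC _ y) mirror_distE//.
rewrite (_ : l * mirror_dist l y v / enorm v = l / enorm v * mirror_dist l y v); last by ring.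
rewrite powRM ?divr_ge0 ?enorm_ge0 ?mirror_dist_ge0 ?(ltW l0)//.
have -> : (l / enorm v) `^ g = (l / enorm v) `^ (2 * n)%:R * (l / enorm v) `^ (- q).
  rewrite -powRD ?(gt_eqF (divr_gt0 l0 V0)) ?implybT//.
  by congr (_ `^ _); rewrite natrM; ring.
rewrite powR_mulrn ?divr_ge0 ?enorm_ge0 ?(ltW l0)//.
by ring.
Qed.

Let itg_fold : itg (fun v => chi (enorm v < l) * (G v * Km y v)).
Proof.
have [mG _] := tG.
apply: (itg_le_ae (a := 0) (b := 0) n0 (itg_abs (itg_kinv n0 l0 (itg_outside tG)))).
  apply: measurable_funM; first by measr.
  by apply: measurable_funM => //; exact: measurable_Km.
move=> v v0 _; rewrite fold_integrand// normrN !normrM ler_wpM2r ?mulr_ge0//.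
rewrite !ger0_norm// ler_nat.
by case: (ltP (enorm v) l) => // /ltW ->.
Qed.

Let G_sphere v : enorm v = l -> G v = 0.
Proof.
move=> vl; have v0 : v != 0 by rewrite -enorm_gt0 vl.
have := antiG v0; rewrite /kelvin kinv_fix// vl divff ?gt_eqF// powR1 mul1r => h.
by lra.
Qed.

(** As [e] is below the distance to the sphere, the truncation acts only inside. Outside, the
    constant [G y] produces the exit mass, and inversion with antisymmetry sends the integral of
    [G v * Kq (v - y)] to minus the integral of [G v * Km y v] inside. *)
Lemma fold_trunc_lap e : 0 < e < d ->
  trunc_lap e G y =
  Int (fun v => chi (enorm v < l) *
    (chi (e < enorm (v - y)) * ((G y - G v) * Kq (v - y)) + G v * Km y v)) +
  G y * exit_mass.
Proof.
move=> /andP[e0 ed].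
have It := itg_trunc_lap n2 s0 s1 e0 tG.
have mb : measurable_fun setT (fun v : 'rV[R]_n => enorm v < l) by measr.
have I1 := itg_chiM mb It.
have Io := itg_outside tG.
have [w E F] : exists2 w, trunc_lap e G y =
    Int (fun v => chi (enorm v < l) * (chi (e < enorm (v - y)) * ((G y - G v) * Kq (v - y)))) +
    (G y * exit_mass - w) & w = - Int (fun v => chi (enorm v < l) * (G v * Km y v)).
  exists (Int (fun v => chi (l <= enorm v) * (G v * Kq (v - y)))).
    have IE := itgZ (G y) itg_exit.
    rewrite -(IntZ _ itg_exit) -(IntB IE Io) -(IntD I1 (itgB IE Io)).
    apply: eq_Int => v; case: (ltP (enorm v) l) => lv; first by rewrite /=; ring.
    have dv := outside_ball lv; rewrite (_ : e < _); last exact: lt_le_trans dv.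
    by rewrite /=; ring.
  rewrite -mulN1r -(IntZ _ itg_fold) [LHS](Int_kinv n0 l0 Io).
  apply: (Int_eq_ae (a := 0) (b := 0) n0); [exact: (itg_kinv n0 l0 Io)|exact: (itgZ _ itg_fold)|].
  move=> v v0 _; rewrite fold_integrand// mulN1r; congr (- _).
  (* Folding yields the closed ball instead of the open one; on the sphere [G] vanishes by
     antisymmetry. *)
  by case: (ltgtP (enorm v) l) => //= /G_sphere ->; rewrite !mul0r mulr0.
rewrite {}E {}F opprK; have J := IntD I1 itg_fold.
transitivity (Int (fun v => chi (enorm v < l) * (chi (e < enorm (v - y)) * ((G y - G v) * Kq (v - y))) +
    chi (enorm v < l) * (G v * Km y v)) + G y * exit_mass).
  by rewrite J addrAC addrA.
by congr (_ + _); apply: eq_Int => v; ring.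
Qed.

Section comparison.
Variables (eta : 'rV[R]_n -> R) (M e0 : R) (a b : 'rV[R]_n).
Hypotheses (meta : measurable_fun setT eta) (eta01 : forall v, 0 <= eta v <= M).
Hypothesis e0_gt0 : 0 < e0.
Hypothesis GM : forall v, enorm (v - y) < e0 -> `|G v| <= M.
Hypothesis touch : forall v, enorm v < l -> v != a -> v != b -> G y - G v <= eta y - eta v.

Lemma itg_eta e : 0 < e ->
  itg (fun v => chi (enorm v < l) *
   (chi (e < enorm (v - y)) * ((eta y - eta v) * (Kq (v - y) - Km y v)))).
Proof.
move=> e_gt0.
have M0 : 0 <= M by have /andP[h1 h2] := eta01 0; exact: le_trans h2.
have mb : measurable_fun setT (fun v : 'rV[R]_n => enorm v < l) by measr.
have mK : measurable_fun setT (fun v : 'rV[R]_n => Kq (v - y)).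
  by apply: measurable_Kq; measr.
have mKm := measurable_Km y.
have I1 := itgD (itg_chiM mb (itg_Kq_tail n2 s0 s1 y e_gt0)) (itg_Km yl).
apply: (itg_le (itgZ M I1)).
  apply: measurable_funM; first by measr.
  apply: measurable_funM; first by measr.
  apply: measurable_funM; first exact: measurable_funB.
  exact: measurable_funB.
move=> v; have K0 := Kq_ge0 s (v - y); have Km0 := Km_ge0 y v.
case: (ltP (enorm v) l) => _; last by rewrite !mul0r normr0 addr0 mulr0.
case: (ltP e) => _; last by rewrite !mul0r mulr0 normr0 add0r !mul1r mulr_ge0.
rewrite !mul1r normrM ler_pM//.
  have /andP[h1 h2] := eta01 v; have /andP[h3 h4] := eta01 y.
  by rewrite ler_norml; apply/andP; split; lra.
by rewrite ler_norml; apply/andP; split; lra.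
Qed.

(** Away from [y] the integrand is [(G y - G v) * (Kq - Km) + G y * Km]; since [Km <= Kq], [touch]
    replaces [G] by [eta] in the first term. In the hole of radius [e] only [G v * Km] survives: it
    costs a multiple of the volume of the hole, and the maximum with 0 keeps the other bounding term
    nonnegative there. *)
Lemma maximum_principle_trunc e : 0 < e -> e < d -> 2 * e < e0 ->
  trunc_lap e G y <=
  Int (fun v => chi (enorm v < l) *
   (chi (e < enorm (v - y)) * ((eta y - eta v) * (Kq (v - y) - Km y v)))) +
  Num.max (G y) 0 * Int (fun v => chi (enorm v < l) * Km y v) +
  G y * exit_mass + (M * d `^ (- q) * ((2 * e) ^+ n * unit_ball_volume R n)).
Proof.
move=> e_gt0 ed ee0.
have M0 : 0 <= M by have /andP[h1 h2] := eta01 0; exact: le_trans h2.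
have ed' : 0 < e < d by rewrite e_gt0.
have e2 : 0 < 2 * e by rewrite mulr_gt0.
rewrite (fold_trunc_lap ed') -(Int_ball y e2).
have Ieta := itg_eta e_gt0.
rewrite [leRHS]addrAC lerD2r.
have IKm := itgZ (Num.max (G y) 0) (itg_Km yl).
have Ib := itgZ (M * d `^ (- q)) (itg_ball y (2 * e)).
have E := etrans (IntD (itgD Ieta IKm) Ib) (congr2 +%R
  (etrans (IntD Ieta IKm) (congr1 (+%R _) (IntZ _ (itg_Km yl)))) (IntZ _ (itg_ball y (2 * e)))).
apply: (le_trans _ (eq_ler E)) => {E}.
have mb : measurable_fun setT (fun v : 'rV[R]_n => enorm v < l) by measr.
have It := itgD (itg_chiM mb (itg_trunc_lap n2 s0 s1 e_gt0 tG)) itg_fold.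
apply: (Int_le_ae (a := a) (b := b) n0); last 1 first.
- move=> v va vb; have K0 := Kq_ge0 s (v - y); have Km0 := Km_ge0 y v.
  case: (ltP (enorm v) l) => vl; last first.
    rewrite !mul0r mulr0 !add0r mulr_ge0// mulr_ge0// powR_ge0//.
  rewrite !mul1r.
  have t := touch vl va vb.
  have mx : G y <= Num.max (G y) 0 by rewrite le_max lexx.
  have [ev|ev] := ltP e (enorm (v - y)).
    have vy : v != y by rewrite -subr_eq0 -enorm_gt0; exact: lt_trans ev.
    have KK := Km_le_Kq yl vl vy.
    rewrite !mul1r.
    apply: (@le_trans _ _ ((eta y - eta v) * (Kq (v - y) - Km y v) + Num.max (G y) 0 * Km y v)).
      rewrite (_ : (G y - G v) * Kq (v - y) + G v * Km y v =
        (G y - G v) * (Kq (v - y) - Km y v) + G y * Km y v); last by ring.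
      by rewrite lerD// ler_wpM2r// subr_ge0.
    by rewrite lerDl mulr_ge0// mulr_ge0// powR_ge0.
  (* The open ball of radius [2 * e] covers the closed hole left by the truncation. *)
  have v2e : enorm (v - y) < 2 * e by lra.
  rewrite v2e !mul0r !add0r mulr1.
  apply: (@le_trans _ _ (M * d `^ (- q))).
    rewrite (le_trans (ler_norm _))// normrM ler_pM//; first exact/GM/(lt_trans v2e).
    by rewrite ger0_norm// Km_le.
  by rewrite lerDr mulr_ge0// le_max lexx orbT.
- by apply: eq_itg It => v; ring.
- exact: (itgD (itgD Ieta IKm) Ib).
Qed.

(** The volume term disappears in the limit. With [eta = 0] and [G y < 0] only the negative exit
    term remains, as the narrow region needs; with [eta] a multiple of [cap], the bound is a
    multiple of the size of the barrier. *)
Lemma maximum_principle (L X : R) : trunc_lap e G y @[e --> 0^'+] --> L ->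
  (forall e, 0 < e -> e < d -> Int (fun v => chi (enorm v < l) *
   (chi (e < enorm (v - y)) * ((eta y - eta v) * (Kq (v - y) - Km y v)))) <= X) ->
  L <= X + Num.max (G y) 0 * Int (fun v => chi (enorm v < l) * Km y v) + G y * exit_mass.
Proof.
move=> GL HX.
set A := (X in _ <= X).
pose D := M * d `^ (- q) * unit_ball_volume R n.
have M0 : 0 <= M by have /andP[h1 h2] := eta01 0; exact: le_trans h2.
have D0 : 0 <= D by rewrite !mulr_ge0 ?powR_ge0 ?(ltW (unit_ball_volume_gt0 R n0)).
have c0 : A + D * (2 * e) @[e --> (0 : R)^'+] --> (A + D * (2 * 0) : R).
  have h : {for (0 : R), continuous (fun e : R => A + D * (2 * e))}.
    apply: (@contD _ _ _ R^o); first exact: contc.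
    by apply: contM; [exact: contc|apply: contM; [exact: contc|exact: cont_id]].
  exact: cvg_at_right_filter h.
rewrite !mulr0 addr0 in c0.
apply: (ler_cvg_to GL c0); near=> e.
have e_gt0 : 0 < e by near: e; exact: nbhs_right_gt.
have ed : e < d by near: e; exact: nbhs_right_lt.
(* So that [(2 * e) ^+ n <= 2 * e]. *)
have e1 : e < 2^-1 by near: e; exact: nbhs_right_lt.
have ee : e < e0 / 2 by near: e; apply: nbhs_right_lt; rewrite divr_gt0.
have ee0 : 2 * e < e0 by rewrite mulrC -ltr_pdivlMr.
apply: (le_trans (maximum_principle_trunc e_gt0 ed ee0)).
rewrite /A; apply: lerD; first by rewrite lerD2r lerD2r; exact: HX.
have h : (2 * e) ^+ n <= 2 * e.
  rewrite -[X in _ ^+ X](prednK n0) exprS ger_pMr; last by rewrite mulr_gt0.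
  by rewrite exprn_ile1 ?mulr_ge0 ?(ltW e_gt0)//; lra.
by rewrite (mulrC ((2 * e) ^+ n)) [leLHS]mulrA -/D ler_wpM2l.
Unshelve. all: by end_near. Qed.

End comparison.

End folding.
End maximum_principle.

Lemma eq_opp_eq0 (R : realType) (x : R) : x = -1 * x -> x = 0.
Proof. by move=> ?; lra. Qed.

(** * Exit mass near the sphere and a quadratic barrier *)

Section barrier.
Context (R : realType) (n : nat) (s : R).
Hypotheses (n2 : 2 <= n%:R :> R) (s0 : 0 < s) (s1 : s < 1).
Variable l : R.
Hypothesis l0 : 0 < l.
Local Notation q := (n%:R + 2 * s).
Local Notation Kq := (@Kq R n s).
Local Notation Km := (@Km R n s l).
Local Notation exit_mass := (@exit_mass R n s l).
Implicit Types (f G : 'rV[R]_n -> R) (v x y z h : 'rV[R]_n) (c e r : R).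

Let n0 : (0 < n)%N. Proof. by rewrite -(ltr_nat R); apply: lt_le_trans n2. Qed.

(** At distance [d] from the sphere, a ball of radius [d] just outside has volume of order [d^n] and
    lies within [4 * d] of [y], where the kernel is at least [(4 * d)^(-q)]. *)
Lemma exit_mass_ge y : y != 0 -> enorm y < l ->
  4 `^ (- q) * unit_ball_volume R n * (l - enorm y) `^ (- (2 * s)) <= exit_mass y.
Proof.
move: (s0) (s1) (n2) (l0) => S0 S1 N2 L0 y0 yl.
have Y0 : 0 < enorm y by rewrite enorm_gt0.
set d := l - enorm y; have d0 : 0 < d by rewrite subr_gt0.
(* The point at distance [3 * d] from [y] on its ray, so that the ball of radius [d] about it starts
   at distance [l + d] from the origin. *)
pose z := (1 + 3 * d / enorm y) *: y.
have zy : enorm (z - y) = 3 * d.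
  rewrite /z scalerDl scale1r addrC addKr enormZ gtr0_norm ?divr_gt0 ?mulr_gt0//.
  by rewrite divfK// gt_eqF.
have zn : enorm z = enorm y + 3 * d.
  rewrite /z enormZ gtr0_norm; last by rewrite addr_gt0// divr_gt0 ?mulr_gt0.
  by field; rewrite gt_eqF.
have -> : 4 `^ (- q) * unit_ball_volume R n * d `^ (- (2 * s)) =
    (4 * d) `^ (- q) * (d ^+ n * unit_ball_volume R n).
  rewrite powRM ?(ltW d0)// -powR_mulrn ?(ltW d0)//.
  rewrite (_ : d `^ (- (2 * s)) = d `^ (- q) * d `^ n%:R); first by ring.
  by rewrite -powRD ?(gt_eqF d0) ?implybT//; congr (_ `^ _); ring.
rewrite -(Int_ball z d0) -(IntZ _ (itg_ball z d)).
apply: Int_le; first exact: (itgZ _ (itg_ball z d)).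
  exact: (itg_exit n2 s0 s1 yl).
move=> v; case: (ltP (enorm (v - z)) d) => vz; last first.
  by rewrite mulr0 mulr_ge0 ?Kq_ge0.
have vl : l <= enorm v.
  by have := enormB_ge z v; rewrite (enormBC z v) zn; move: vz; rewrite /d; lra.
have vy : enorm (v - y) <= 4 * d.
  by have := enorm_tri z v y; rewrite zy; lra.
rewrite vl mulr1 mul1r ler_powRN//; last lra.
rewrite enorm_gt0 subr_eq0; apply/eqP => vE; move: vl; rewrite vE; lra.
Qed.

(** A paraboloid, because its increments are a second-order term plus a linear term whose principal
    value is zero by oddness. Cutting it at 0 can only raise [cap rho v], which is the favourable
    direction in [cap rho y - cap rho v]. *)
Definition cap (rho : R) v : R := Num.max 0 (1 - enorm v ^+ 2 / rho ^+ 2).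

Lemma cap01 rho v : 0 <= cap rho v <= 1.
Proof.
rewrite /cap le_max lexx/= ge_max ler01/= gerBl.
by rewrite divr_ge0 ?sqr_ge0.
Qed.

Lemma measurable_cap rho : measurable_fun setT (cap rho).
Proof. by apply: measurable_maxr; measr. Qed.

Let second_moment r : 0 < r ->
  itg (fun h => chi (enorm h < r) * (enorm h ^+ 2 * Kq h)).
Proof.
move: (s0) (s1) (n2) => S0 S1 N2 r0.
have ha : 0 < 2 - 2 * s < n%:R by apply/andP; split; lra.
apply: eq_itg (itg_power_ball ha r0) => h; congr (_ * _); rewrite /Kq.
have [->|h0] := eqVneq h 0.
  by rewrite enorm0 expr0n mul0r powR0// lt_eqF//; lra.
rewrite -powR_mulrn ?enorm_ge0// -powRD ?enorm_eq0 ?h0 ?implybT//.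
by congr (_ `^ _); ring.
Qed.

Let odd_moment y e r : 0 < e -> 0 < r ->
  itg (fun v => chi (e < enorm (v - y)) * (chi (enorm (v - y) < r) * (dot y (v - y) * Kq (v - y)))) /\
  Int (fun v => chi (e < enorm (v - y)) * (chi (enorm (v - y) < r) * (dot y (v - y) * Kq (v - y)))) = 0.
Proof.
move=> e0 r0.
pose f h := chi (e < enorm h) * (chi (enorm h < r) * (dot y h * Kq h)).
have If : itg f.
  have := itg_Kq_tail n2 s0 s1 0 e0 => /(itgZ (enorm y * r)) Ik.
  apply: (itg_le Ik).
    apply: measurable_funM; first by measr.
    apply: measurable_funM; first by measr.
    by apply: measurable_funM; [measr|apply: measurable_Kq; exact: measurable_id].
  move=> h; rewrite subr0 /f; case: (ltP e (enorm h)) => _; last by rewrite !mul0r mulr0 normr0.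
  rewrite !mul1r; case: (ltP (enorm h) r) => hr; last first.
    by rewrite mul0r normr0 mulr_ge0 ?mulr_ge0 ?enorm_ge0 ?Kq_ge0// ltW.
  rewrite mul1r normrM (ger0_norm (Kq_ge0 _ _)) ler_wpM2r ?Kq_ge0//.
  have h1 := dot_le y h; have h2 := dot_le (- y) h; rewrite dotNl enormN in h2.
  have h3 : enorm y * enorm h <= enorm y * r by rewrite ler_wpM2l ?enorm_ge0// ltW.
  by rewrite ler_norml; apply/andP; split; lra.
have I0 : Int f = 0.
  have h1 := Int_opp If.
  have h2 : Int (fun v => f (- v)) = -1 * Int f.
    rewrite -(IntZ _ If); apply: eq_Int => v.
    by rewrite /f dotNr enormN KqN; ring.
  have h3 : Int f = -1 * Int f by exact: etrans h1 h2.
  exact: eq_opp_eq0.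
by split; [exact: (itg_shift (- y) If)|rewrite -[RHS]I0; exact: (esym (Int_shift (- y) If))].
Qed.

Let barrier_integrand rho y v : 0 < rho < l -> enorm y < rho -> enorm v < l -> v != y ->
  (cap rho y - cap rho v) * (Kq (v - y) - Km y v) <=
  rho ^- 2 * (chi (enorm (v - y) < l - rho) * (enorm (v - y) ^+ 2 * Kq (v - y))) +
  2 * rho ^- 2 * (chi (enorm (v - y) < l - rho) * (dot y (v - y) * Kq (v - y))) +
  chi (l - rho <= enorm (v - y)) * Kq (v - y) + Km y v.
Proof.
move=> /andP[rho0 rhol] yrho vl vy.
have /andP[by0 by1] := cap01 rho y; have /andP[bv0 bv1] := cap01 rho v.
have K0 := Kq_ge0 s (v - y); have Km0 := Km_ge0 s l y v.
have h1 : - ((cap rho y - cap rho v) * Km y v) <= Km y v.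
  by rewrite -mulNr -[leRHS]mul1r ler_wpM2r//; lra.
rewrite mulrBr; apply: lerD => //.
case: (ltP (enorm (v - y)) (l - rho)) => vyl; last first.
  by rewrite !mul0r !mulr0 !add0r ler_wpM2r//=; lra.
rewrite mul0r addr0 !mul1r !mulrA -mulrDl ler_wpM2r//.
have rho2 : 0 < rho ^+ 2 by rewrite exprn_gt0.
have E : enorm v ^+ 2 - enorm y ^+ 2 = enorm (v - y) ^+ 2 + 2 * dot y (v - y).
  by rewrite !enorm_sqr !dotE (dotC v y); ring.
have capy : cap rho y = 1 - enorm y ^+ 2 / rho ^+ 2.
  rewrite /cap max_r// subr_ge0 ler_pdivrMr// mul1r.
  by rewrite lerXn2r// ?nnegrE ?enorm_ge0// ltW.
have capv : 1 - enorm v ^+ 2 / rho ^+ 2 <= cap rho v by rewrite le_max lexx orbT.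
rewrite capy; apply: (@le_trans _ _ ((enorm v ^+ 2 - enorm y ^+ 2) * rho ^- 2)); first by lra.
by rewrite E; lra.
Qed.

Let ball_mass_le rho y : 0 < rho < l -> enorm y < rho ->
  Int (fun v => chi (enorm v < l) * Km y v) <=
  (l - rho) `^ (- q) * (l ^+ n * unit_ball_volume R n).
Proof.
move: (s0) (s1) (n2) => S0 S1 N2 /andP[rho0 rhol] yrho.
have yl : enorm y < l by exact: lt_trans rhol.
have r0 : 0 < l - rho by rewrite subr_gt0.
have q0 : - q <= 0 by lra.
rewrite -(Int_ball 0 l0) -(IntZ _ (itg_ball 0 l)).
apply: (Int_le (itg_Km n2 s0 s1 l0 yl) (itgZ _ (itg_ball 0 l))) => v.
rewrite (subr0 v); case: (ltP (enorm v) l) => vl; last by rewrite mul0r mulr0.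
rewrite mul1r mulr1; apply: (le_trans (Km_le n2 s0 s1 l0 yl vl)).
apply: (ler_powRN r0) => //.
by rewrite lerD2l lerN2 ltW.
Qed.

Let tail_mass r : R := Int (fun v => chi (r < enorm (v - 0)) * Kq (v - 0)).

Let tail_massE r y : 0 < r -> tail_mass r = Int (fun v => chi (r < enorm (v - y)) * Kq (v - y)).
Proof.
move=> r0; apply: (etrans (Int_shift (- y) (itg_Kq_tail n2 s0 s1 0 r0))).
by apply: eq_Int => v; rewrite (subr0 (v - y)).
Qed.

Let far v rho y : enorm y < rho -> l <= enorm v -> (l - rho) < enorm (v - y).
Proof. by move=> yrho /(outside_ball y); lra. Qed.

Let exit_mass_le rho y : 0 < rho < l -> enorm y < rho -> exit_mass y <= tail_mass ((l - rho) / 2).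
Proof.
move: (l0) => L0 /andP[rho0 rhol] yrho; have yl : enorm y < l by exact: lt_trans rhol.
have r0 : 0 < (l - rho) / 2 by rewrite divr_gt0// subr_gt0.
rewrite (tail_massE y r0).
apply: (Int_le (itg_exit n2 s0 s1 yl) (itg_Kq_tail n2 s0 s1 y r0)) => v.
rewrite ler_wpM2r ?Kq_ge0// ler_nat.
case: (leP l (enorm v)) => // vl; have vy := far yrho vl.
by rewrite (_ : _ < _)//; lra.
Qed.

Let second r : R := Int (fun h => chi (enorm h < r) * (enorm h ^+ 2 * Kq h)).

(** The ball of radius [l - rho] about [y] lies inside [|v| < l], so the linear term is integrated
    over a full annulus about [y] and drops out; this is the factor 0. *)
Let barrier_le rho y e : 0 < rho < l -> enorm y < rho -> 0 < e ->
  Int (fun v => chi (enorm v < l) *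
    (chi (e < enorm (v - y)) * ((cap rho y - cap rho v) * (Kq (v - y) - Km y v)))) <=
  rho ^- 2 * second (l - rho) + 2 * rho ^- 2 * 0 + tail_mass ((l - rho) / 2) +
  Int (fun v => chi (enorm v < l) * Km y v).
Proof.
move: (l0) => L0 hrho yrho e0; have /andP[rho0 rhol] := hrho.
have yl : enorm y < l by exact: lt_trans rhol.
have r0 : 0 < l - rho by rewrite subr_gt0.
have r20 : 0 < (l - rho) / 2 by rewrite divr_gt0.
have [Io I0] := odd_moment y e0 r0.
have IA := itg_shift (- y) (second_moment r0).
have AE : second (l - rho) =
    Int (fun v => chi (enorm (v - y) < l - rho) * (enorm (v - y) ^+ 2 * Kq (v - y))).
  exact: (Int_shift (- y) (second_moment r0)).
have IAr := itgZ (rho ^- 2) IA.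
have Ior := itgZ (2 * rho ^- 2) Io.
have IKm := itg_Km n2 s0 s1 l0 yl.
have IB := itg_Kq_tail n2 s0 s1 y r20.
(* The tail is a strict condition while [barrier_integrand] leaves [l - rho <= enorm (v - y)];
   halving the radius accommodates both. *)
pose S v := rho ^- 2 * (chi (enorm (v - y) < l - rho) * (enorm (v - y) ^+ 2 * Kq (v - y))) +
  2 * rho ^- 2 * (chi (e < enorm (v - y)) * (chi (enorm (v - y) < l - rho) * (dot y (v - y) * Kq (v - y)))) +
  chi ((l - rho) / 2 < enorm (v - y)) * Kq (v - y) + chi (enorm v < l) * Km y v.
have IS : itg S by exact: (itgD (itgD (itgD IAr Ior) IB) IKm).
have SE : Int S = rho ^- 2 * second (l - rho) + 2 * rho ^- 2 * 0 + tail_mass ((l - rho) / 2) +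
    Int (fun v => chi (enorm v < l) * Km y v).
  rewrite (tail_massE y r20) AE -I0.
  exact: (etrans (IntD (itgD (itgD IAr Ior) IB) IKm) (congr1 (fun t => t + _)
    (etrans (IntD (itgD IAr Ior) IB) (congr1 (fun t => t + _)
    (etrans (IntD IAr Ior) (congr2 +%R (IntZ _ IA) (IntZ _ Io))))))).
apply: (le_trans _ (eq_ler SE)) => {SE I0 AE}.
have Ieta := itg_eta n2 s0 s1 l0 yl (measurable_cap rho) (cap01 rho) e0.
apply: (Int_le Ieta IS) => v; rewrite /S => {S IS Ieta Ior IAr IA Io IKm IB}.
have K0 := Kq_ge0 s (v - y); have Km0 := Km_ge0 s l y v.
have q0 : 0 <= rho ^- 2 by rewrite invr_ge0 sqr_ge0.
have T0 : 0 <= rho ^- 2 * (chi (enorm (v - y) < l - rho) * (enorm (v - y) ^+ 2 * Kq (v - y))).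
  apply: mulr_ge0 => //; apply: mulr_ge0 => //.
  by apply: mulr_ge0 => //; exact: sqr_ge0.
have T1 : 0 <= chi ((l - rho) / 2 < enorm (v - y)) * Kq (v - y) by rewrite mulr_ge0.
case: (ltP (enorm v) l) => vl; last first.
  have vy := far yrho vl.
  rewrite !mul0r addr0.
  have -> : (enorm (v - y) < l - rho) = false by apply/negbTE; rewrite -leNgt ltW.
  by rewrite !(mul0r, mulr0) !add0r.
have [ev|ev] := ltP e (enorm (v - y)); last first.
  by rewrite !(mul0r, mulr0) addr0 mul1r !addr_ge0.
have vy : v != y by rewrite -subr_eq0 -enorm_gt0; exact: lt_trans ev.
rewrite !mul1r; apply: (le_trans (barrier_integrand hrho yrho vl vy)).
rewrite lerD2r lerD2l ler_wpM2r// ler_nat.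
case: (leP (l - rho)) => // h.
by rewrite (_ : _ < _)//; lra.
Qed.

(** One constant for the three quantities in the upper bound at a contact point, uniform because
    that point is not known in advance. *)
Lemma barrier_bound rho : 0 < rho < l -> exists2 X, 0 <= X & forall y, enorm y < rho ->
  [/\ forall e, 0 < e -> Int (fun v => chi (enorm v < l) *
       (chi (e < enorm (v - y)) * ((cap rho y - cap rho v) * (Kq (v - y) - Km y v)))) <= X,
     Int (fun v => chi (enorm v < l) * Km y v) <= X & exit_mass y <= X].
Proof.
move=> hrho; have /andP[rho0 rhol] := hrho.
have r0 : 0 < l - rho by rewrite subr_gt0.
have A0 : 0 <= rho ^- 2 * second (l - rho).
  apply: mulr_ge0; first by rewrite invr_ge0 sqr_ge0.
  apply: Int_ge0 => h; apply: mulr_ge0 => //.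
  by apply: mulr_ge0; [exact: sqr_ge0|exact: Kq_ge0].
have B0 : 0 <= tail_mass ((l - rho) / 2).
  by apply: Int_ge0 => h; apply: mulr_ge0 => //; exact: Kq_ge0.
have C0 : 0 <= (l - rho) `^ (- q) * (l ^+ n * unit_ball_volume R n).
  apply: mulr_ge0; first exact: powR_ge0.
  by apply: mulr_ge0; [rewrite exprn_ge0// ltW|exact/ltW/unit_ball_volume_gt0].
exists (rho ^- 2 * second (l - rho) + tail_mass ((l - rho) / 2) +
  (l - rho) `^ (- q) * (l ^+ n * unit_ball_volume R n)).
  by apply: addr_ge0 => //; exact: addr_ge0.
move=> y yrho; have W := ball_mass_le hrho yrho; split.
- move=> e e0; apply: (le_trans (barrier_le hrho yrho e0)).
  by rewrite mulr0 addr0 lerD2l.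
- by apply: (le_trans W); rewrite lerDr; exact: addr_ge0.
- by apply: (le_trans (exit_mass_le hrho yrho)); rewrite -addrA addrCA lerDl addr_ge0.
Qed.

End barrier.

(** * Riesz potentials *)

Section riesz_potential.
Context (R : realType) (n : nat) (a : R).
Hypotheses (n0 : (0 < n)%N) (ha : 0 < a < n%:R).
Implicit Types (f D : 'rV[R]_n -> R) (v x y z : 'rV[R]_n) (c d e r l : R).

Definition Ka v : R := enorm v `^ (a - n%:R).

Lemma Ka_ge0 v : 0 <= Ka v. Proof. exact: powR_ge0. Qed.

Lemma measurable_Ka y : measurable_fun setT (fun v => Ka (v - y)).
Proof. by rewrite /Ka; measr. Qed.

Definition riesz_itg f y : Prop := itg (fun v => Ka (v - y) * f v).

Definition riesz f y : R := Int (fun v => Ka (v - y) * f v).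

(* Chosen so that it corresponds to [kelvin] under [f |-> f `^ p_star]. *)
Definition conformal l f v : R := (l / enorm v) `^ (n%:R + a) * f (kinv l v).

Let exponent_neq0 : n%:R + a != 0.
Proof. by have /andP[a0 an] := ha; rewrite gt_eqF//; lra. Qed.

Let conformal_integrand l y f v : 0 < l -> y != 0 ->
  (l / enorm v) ^+ (2 * n) * (Ka (kinv l v - kinv l y) * f (kinv l v)) =
  (l / enorm y) `^ (a - n%:R) * (Ka (v - y) * conformal l f v).
Proof.
move=> l0 y0; have Y0 : 0 < enorm y by rewrite enorm_gt0.
have [->|v0] := eqVneq v 0.
  rewrite /conformal enorm0 invr0 mulr0 powR0// expr0n muln_eq0/= (gtn_eqF n0).
  by rewrite !(mul0r, mulr0).
have V0 : 0 < enorm v by rewrite enorm_gt0.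
rewrite /Ka (enorm_kinvB l0 v0 y0) -powR_mulrn ?divr_ge0 ?enorm_ge0 ?(ltW l0)//.
rewrite /conformal (_ : l ^+ 2 * enorm (v - y) / (enorm v * enorm y) =
  (l / enorm y) * ((l / enorm v) * enorm (v - y))); last by field; rewrite !gt_eqF.
have LV0 : 0 <= l / enorm v by rewrite divr_ge0// ltW.
have LY0 : 0 <= l / enorm y by rewrite divr_ge0// ltW.
rewrite (powRM _ LY0 (mulr_ge0 LV0 (enorm_ge0 _))) (powRM _ LV0 (enorm_ge0 _)).
have -> : (l / enorm v) `^ (n%:R + a) = (l / enorm v) `^ (2 * n)%:R * (l / enorm v) `^ (a - n%:R).
  rewrite -powRD ?(gt_eqF (divr_gt0 l0 V0)) ?implybT//.
  by congr (_ `^ _); rewrite natrM; ring.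
by ring.
Qed.

Lemma riesz_itg_conformal l y f : 0 < l -> y != 0 ->
  riesz_itg f (kinv l y) -> riesz_itg (conformal l f) y.
Proof.
move=> l0 y0 If; have Y0 : 0 < enorm y by rewrite enorm_gt0.
apply: eq_itg (itgZ ((l / enorm y) `^ (a - n%:R))^-1 (itg_kinv n0 l0 If)) => v.
by rewrite conformal_integrand// mulKf// gt_eqF// powR_gt0// divr_gt0.
Qed.

Lemma riesz_conformal l y f : 0 < l -> y != 0 -> riesz_itg f (kinv l y) ->
  riesz (conformal l f) y = (l / enorm y) `^ (n%:R - a) * riesz f (kinv l y).
Proof.
move=> l0 y0 If; have Y0 : 0 < enorm y by rewrite enorm_gt0.
have Ic := riesz_itg_conformal l0 y0 If.
have E : riesz f (kinv l y) = (l / enorm y) `^ (a - n%:R) * riesz (conformal l f) y.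
  rewrite -(IntZ _ Ic); apply: (etrans (Int_kinv n0 l0 If)).
  by apply: eq_Int => v; exact: conformal_integrand.
rewrite E mulrA -powRD ?(gt_eqF (divr_gt0 l0 Y0)) ?implybT//.
by rewrite addrC subrKA subrr powRr0 mul1r.
Qed.

Section folding.
Variables (l : R) (l0 : 0 < l).

(** The folded Riesz kernel. The factor [chi] removes the diagonal, where [Ka] has the default value
    0 and the difference would be negative. *)
Definition riesz_green y v : R :=
  chi (0 < enorm (v - y)) * (Ka (v - y) - mirror_dist l y v `^ (a - n%:R)).

Lemma riesz_green_ge0 y v : enorm y < l -> enorm v < l -> 0 <= riesz_green y v.
Proof.
have /andP[a0 an] := ha; move=> yl vl; rewrite /riesz_green.
case: (ltP 0 (enorm (v - y))) => vy; last by rewrite mul0r.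
rewrite mul1r subr_ge0 ler_powRN//; first exact/ltW/mirror_dist_gt.
lra.
Qed.

Lemma riesz_green_le y v : enorm y < l -> enorm v < l ->
  riesz_green y v <= chi (enorm (v - y) < 2 * l) * Ka (v - y).
Proof.
move=> yl vl; have h : enorm (v - y) < 2 * l by have := enormB v y; lra.
rewrite h mul1r /riesz_green; have K0 := Ka_ge0 (v - y).
have M0 := powR_ge0 (mirror_dist l y v) (a - n%:R).
by case: (ltP 0 (enorm (v - y))) => _; rewrite ?mul0r// mul1r; lra.
Qed.

(** By [mirror_distB] the two squared distances differ by at least [d]. As [|v - y| <= 2 * l], this
    additive gap becomes a ratio: the mirror distance is at least [sg * |v - y|] with [sg > 1]. *)
Lemma riesz_green_gt rho : 0 < rho < l -> exists2 k, 0 < k &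
  forall y v, enorm y < rho -> enorm v < rho -> v != y -> k <= riesz_green y v.
Proof.
have /andP[a0 an] := ha; move: (l0) => L0; move=> /andP[rho0 rhol].
have b0 : 0 < n%:R - a by lra.
pose d := (l ^+ 2 - rho ^+ 2) ^+ 2 / l ^+ 2.
have rl2 : rho ^+ 2 < l ^+ 2 by rewrite ltrXn2r// ltW.
have d0 : 0 < d by rewrite divr_gt0 ?exprn_gt0// subr_gt0.
pose sg := Num.sqrt (1 + d / (4 * l ^+ 2)).
have sg2 : sg ^+ 2 = 1 + d / (4 * l ^+ 2).
  by rewrite sqr_sqrtr// addr_ge0// divr_ge0 ?(ltW d0)// mulr_ge0// sqr_ge0.
have sg0 : 0 <= sg by exact: sqrtr_ge0.
have sg1 : 1 < sg.
  rewrite -(@ltr_pXn2r _ 2)// ?nnegrE// expr1n sg2 ltrDl divr_gt0// mulr_gt0//.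
  by rewrite exprn_gt0.
have sgb : sg `^ (a - n%:R) < 1.
  rewrite -(opprB n%:R) powRN invf_lt1 ?powR_gt0//; last lra.
  by have := @gt0_ltr_powR _ _ b0 1 sg; rewrite powR1; apply; rewrite ?nnegrE.
exists ((1 - sg `^ (a - n%:R)) * (2 * l) `^ (a - n%:R)).
  by rewrite mulr_gt0 ?subr_gt0// powR_gt0// mulr_gt0.
move=> y v yr vr vy; have A0 : 0 < enorm (v - y) by rewrite enorm_gt0 subr_eq0.
have A2 : enorm (v - y) <= 2 * l by have := enormB v y; lra.
have h : sg * enorm (v - y) <= mirror_dist l y v.
  rewrite -(@ler_pXn2r _ 2)// ?nnegrE ?mulr_ge0 ?mirror_dist_ge0 ?enorm_ge0//.
  have := mirror_distB y v l0; rewrite (enormBC y v) => E.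
  have -> : mirror_dist l y v ^+ 2 = enorm (v - y) ^+ 2 +
    (l ^+ 2 - enorm y ^+ 2) * (l ^+ 2 - enorm v ^+ 2) / l ^+ 2 by rewrite -E; ring.
  rewrite exprMn sg2 mulrDl mul1r lerD2l.
  have hh (w : 'rV[R]_n) : enorm w < rho -> l ^+ 2 - rho ^+ 2 <= l ^+ 2 - enorm w ^+ 2.
    by move=> wr; rewrite lerD2l lerN2 lerXn2r// ?nnegrE ?enorm_ge0// ltW.
  apply: (@le_trans _ _ d).
    rewrite -mulrA -[leRHS]mulr1 ler_wpM2l ?(ltW d0)//.
    rewrite mulrC ler_pdivrMr ?mulr_gt0 ?exprn_gt0// mul1r.
    by rewrite (_ : 4 * l ^+ 2 = (2 * l) ^+ 2); [rewrite lerXn2r// ?nnegrE ?enorm_ge0//; lra|ring].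
  rewrite /d ler_wpM2r ?invr_ge0 ?sqr_ge0// expr2 ler_pM ?subr_ge0 ?(ltW rl2)// hh//.
rewrite /riesz_green A0 mul1r.
have h1 : mirror_dist l y v `^ (a - n%:R) <= sg `^ (a - n%:R) * Ka (v - y).
  rewrite -powRM ?enorm_ge0// ler_powRN// ?mulr_gt0//; lra.
have h2 : (2 * l) `^ (a - n%:R) <= Ka (v - y) by rewrite ler_powRN//; lra.
apply: (@le_trans _ _ ((1 - sg `^ (a - n%:R)) * Ka (v - y))).
  by rewrite ler_wpM2l// subr_ge0 ltW.
by lra.
Qed.

Section antisymmetric.
Variables (D : 'rV[R]_n -> R) (y : 'rV[R]_n).
Hypotheses (mD : measurable_fun setT D) (ID : riesz_itg D y).
Hypothesis antiD : forall v, v != 0 -> conformal l D v = - D v.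

Let K v := mirror_dist l y v `^ (a - n%:R).

Let mb : measurable_fun setT (fun v : 'rV[R]_n => enorm v < l). Proof. by measr. Qed.
Let mc : measurable_fun setT (fun v : 'rV[R]_n => l <= enorm v). Proof. by measr. Qed.
Let md : measurable_fun setT (fun v : 'rV[R]_n => 0 < enorm (v - y)). Proof. by measr. Qed.

Let mK : measurable_fun setT K. Proof. by apply: measurable_powRf; measr. Qed.

Let D_sphere v : enorm v = l -> D v = 0.
Proof.
move=> vl; have v0 : v != 0 by rewrite -enorm_gt0 vl.
have := antiD v0; rewrite /conformal kinv_fix// vl divff ?gt_eqF// powR1 mul1r => h.
by lra.
Qed.

Let fold_integrand v : v != 0 ->
  (l / enorm v) ^+ (2 * n) * (chi (l <= enorm (kinv l v)) * (Ka (kinv l v - y) * D (kinv l v))) =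
  - (chi (enorm v < l) * (K v * D v)).
Proof.
move=> v0; have V0 : 0 < enorm v by rewrite enorm_gt0.
rewrite enorm_kinv (_ : (l <= l ^+ 2 / enorm v) = (enorm v <= l)); last first.
  by rewrite ler_pdivlMr// expr2 ler_pM2l.
transitivity (- (chi (enorm v <= l) * (K v * D v))); last first.
  by congr (- _); case: (ltgtP (enorm v) l) => //= /D_sphere ->; rewrite !mulr0.
have := antiD v0; rewrite /conformal => /(congr1 ( *%R (chi (enorm v <= l) * K v))) h.
transitivity (chi (enorm v <= l) * K v * - D v); last by ring.
rewrite -h /K /Ka (enormBC _ y) mirror_distE//.
rewrite (_ : l * mirror_dist l y v / enorm v = l / enorm v * mirror_dist l y v); last by ring.
rewrite powRM ?divr_ge0 ?enorm_ge0 ?mirror_dist_ge0 ?(ltW l0)//.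
have -> : (l / enorm v) `^ (n%:R + a) = (l / enorm v) `^ (2 * n)%:R * (l / enorm v) `^ (a - n%:R).
  rewrite -powRD ?(gt_eqF (divr_gt0 l0 V0)) ?implybT//.
  by congr (_ `^ _); rewrite natrM; ring.
rewrite powR_mulrn ?divr_ge0 ?enorm_ge0 ?(ltW l0)//.
by ring.
Qed.

Let itg_fold : itg (fun v => chi (enorm v < l) * (K v * D v)).
Proof.
apply: (itg_le_ae (a := 0) (b := 0) n0 (itg_abs (itg_kinv n0 l0 (itg_chiM mc ID)))).
  apply: measurable_funM; first by measr.
  exact: measurable_funM.
by move=> v v0 _; rewrite fold_integrand// normrN.
Qed.

Let fold_green v : v != y ->
  chi (enorm v < l) * (Ka (v - y) * D v) - chi (enorm v < l) * (K v * D v) =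
  chi (enorm v < l) * (riesz_green y v * D v).
Proof.
move=> vy; rewrite /riesz_green enorm_gt0 subr_eq0 vy mul1r -/(K v).
by ring.
Qed.

Lemma itg_riesz_fold : itg (fun v => chi (enorm v < l) * (riesz_green y v * D v)).
Proof.
apply: (itg_le_ae (a := y) (b := y) n0 (itg_abs (itgB (itg_chiM mb ID) itg_fold))).
  apply: measurable_funM; first by measr.
  apply: measurable_funM => //; apply: measurable_funM; first by measr.
  by apply: measurable_funB => //; exact: measurable_Ka.
by move=> v vy _; rewrite fold_green.
Qed.

Lemma riesz_fold : riesz D y = Int (fun v => chi (enorm v < l) * (riesz_green y v * D v)).
Proof.
have I1 := itg_chiM mb ID.
have I2 := itg_chiM mc ID.
have E : riesz D y = Int (fun v => chi (enorm v < l) * (Ka (v - y) * D v)) +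
    Int (fun v => chi (l <= enorm v) * (Ka (v - y) * D v)).
  apply: (etrans _ (IntD I1 I2)); apply: eq_Int => v.
  by case: (ltP (enorm v) l) => _ /=; ring.
have F : Int (fun v => chi (l <= enorm v) * (Ka (v - y) * D v)) =
    -1 * Int (fun v => chi (enorm v < l) * (K v * D v)).
  rewrite -(IntZ _ itg_fold); apply: (etrans (Int_kinv n0 l0 I2)).
  apply: (Int_eq_ae (a := 0) (b := 0) n0); [exact: (itg_kinv n0 l0 I2)|exact: (itgZ _ itg_fold)|].
  by move=> v v0 _; rewrite fold_integrand// mulN1r.
rewrite E F mulN1r -(IntB I1 itg_fold).
apply: (Int_eq_ae (a := y) (b := y) n0); [exact: (itgB I1 itg_fold)|exact: itg_riesz_fold|].
by move=> v vy _; exact: fold_green.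
Qed.

End antisymmetric.

Definition riesz_mass r : R := Int (fun v => chi (enorm v < r) * Ka v).

Lemma riesz_mass_ge0 r : 0 <= riesz_mass r.
Proof. by apply: Int_ge0 => v; rewrite mulr_ge0 ?Ka_ge0. Qed.

Lemma riesz_fold_ge D y m b1 b2 : enorm y < l -> measurable_fun setT D -> riesz_itg D y ->
  (forall v, v != 0 -> conformal l D v = - D v) -> 0 <= m ->
  (forall v, enorm v < l -> v != b1 -> v != b2 -> - m <= D v) ->
  - m * riesz_mass (2 * l) <= riesz D y.
Proof.
move=> yl mD ID antiD m0 Dm; have l20 : 0 < 2 * l by rewrite mulr_gt0.
have I0 := itg_power_ball ha l20; have Is := itg_shift (- y) I0.
rewrite (riesz_fold mD ID antiD).
have -> : riesz_mass (2 * l) = Int (fun v => chi (enorm (v - y) < 2 * l) * Ka (v - y)).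
  exact: (Int_shift (- y) I0).
rewrite -(IntZ _ Is); apply: (Int_le_ae (a := b1) (b := b2) n0).
- exact: (itgZ _ Is).
- exact: itg_riesz_fold.
move=> v v1 v2; case: (ltP (enorm v) l) => vl; last first.
  rewrite mul0r mulNr oppr_le0 mulr_ge0// mulr_ge0//; exact: powR_ge0.
rewrite mul1r.
have G0 := riesz_green_ge0 yl vl; have G1 := riesz_green_le yl vl.
apply: (@le_trans _ _ (riesz_green y v * - m)); last by rewrite ler_wpM2l// Dm.
by rewrite mulrN mulNr lerN2 mulrC ler_wpM2l.
Qed.

(** Positivity of [D] on one small ball lifts its potential everywhere in [|y| < rho]; [k] precedes
    [D] and [y] because it must serve an unknown contact point. *)
Lemma riesz_fold_gt rho y1 r : 0 < rho < l -> 0 < r -> enorm y1 + r <= rho ->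
  exists2 k, 0 < k & forall D y d b1 b2, enorm y < rho -> measurable_fun setT D ->
  riesz_itg D y -> (forall v, v != 0 -> conformal l D v = - D v) -> 0 <= d ->
  (forall v, enorm v < l -> v != b1 -> v != b2 -> 0 <= D v) ->
  (forall v, enorm (v - y1) < r -> v != b1 -> v != b2 -> d <= D v) ->
  k * d <= riesz D y.
Proof.
move=> hrho r0 y1r; have /andP[rho0 rhol] := hrho.
have [k k0 Hk] := riesz_green_gt hrho.
exists (k * (r ^+ n * unit_ball_volume R n)).
  by rewrite mulr_gt0// mulr_gt0 ?exprn_gt0 ?unit_ball_volume_gt0.
move=> D y d b1 b2 yrho mD ID antiD d0 D0 Dd.
have yl : enorm y < l by exact: lt_trans rhol.
have If := itg_riesz_fold mD ID antiD.
have my : measurable_fun setT (fun v : 'rV[R]_n => 0 < enorm (v - y)) by measr.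
have Ifc := itg_chiM my If.
have E : riesz D y = Int (fun v => chi (0 < enorm (v - y)) *
    (chi (enorm v < l) * (riesz_green y v * D v))).
  rewrite (riesz_fold mD ID antiD); apply: (Int_eq_ae (a := y) (b := y) n0 If Ifc) => v vy _.
  by rewrite enorm_gt0 subr_eq0 vy mul1r.
have Ib := itg_ball y1 r; have Ibc := itg_chiM my Ib.
have F : k * (r ^+ n * unit_ball_volume R n) * d =
    Int (fun v => k * d * (chi (0 < enorm (v - y)) * chi (enorm (v - y1) < r))).
  rewrite (IntZ _ Ibc) mulrAC -(Int_ball y1 r0); congr (_ * _).
  apply: (Int_eq_ae (a := y) (b := y) n0 Ib Ibc) => v vy _.
  by rewrite enorm_gt0 subr_eq0 vy mul1r.
rewrite E F; apply: (Int_le_ae (a := b1) (b := b2) n0 (itgZ _ Ibc) Ifc) => v v1 v2.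
case: (ltP 0 (enorm (v - y))) => vy; last by rewrite !mul0r mulr0.
rewrite !mul1r; case: (ltP (enorm v) l) => vl; last first.
  have -> : (enorm (v - y1) < r) = false.
    apply/negbTE; rewrite -leNgt; have := enormB_ge v y1; lra.
  by rewrite mulr0 mul0r.
have G0 := riesz_green_ge0 yl vl.
case: (ltP (enorm (v - y1)) r) => vr; last by rewrite mulr0 mul1r mulr_ge0// D0.
rewrite mul1r mulr1 ler_pM ?(ltW k0)//; last exact: Dd.
apply: Hk => //; last by rewrite -subr_eq0 -enorm_gt0.
have := enormB_ge v y1; lra.
Qed.

End folding.

(** Near [y] the density is at most [C]. Where [|v - y| >= r], [|v| <= (1 + l / r) |v - y|], so the
    kernel at [y] is at most [c] times the kernel at [0], whose potential is finite. *)
Lemma riesz_bounded f l r C : 0 < l -> 0 < r -> (forall v, 0 <= f v) -> riesz_itg f 0 ->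
  (forall v, enorm v <= l + r -> f v <= C) ->
  exists2 X, 0 <= X & forall y, enorm y <= l -> riesz_itg f y -> riesz f y <= X.
Proof.
have /andP[a0 an] := ha; move=> l0 r0 f0 I0 fC.
have C0 : 0 <= C by apply: le_trans (f0 0) _; apply: fC; rewrite enorm0 addr_ge0// ltW.
have c0 : 0 < (1 + l / r)^-1 by rewrite invr_gt0 addr_gt0// divr_gt0.
pose c := (1 + l / r)^-1 `^ (a - n%:R).
have r00 : 0 <= riesz f 0 by apply: Int_ge0 => v; rewrite mulr_ge0 ?Ka_ge0.
exists (C * riesz_mass r + c * riesz f 0).
  by rewrite addr_ge0// mulr_ge0 ?riesz_mass_ge0 ?powR_ge0.
move=> y yl Iy.
have Ib := itg_power_ball ha r0; have Is := itg_shift (- y) Ib.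
have -> : riesz_mass r = Int (fun v => chi (enorm (v - y) < r) * Ka (v - y)).
  exact: (Int_shift (- y) Ib).
rewrite -(IntZ _ Is) -(IntZ _ I0).
apply: (le_trans _ (eq_ler (IntD (itgZ C Is) (itgZ c I0)))).
apply: (Int_le_ae (a := 0) (b := 0) n0 Iy (itgD (itgZ C Is) (itgZ c I0))) => v v0 _.
clear Is Ib I0 Iy r00.
have K0 := Ka_ge0 (v - y).
have T0 : 0 <= c * (Ka (v - 0) * f v).
  by apply: mulr_ge0; [exact: powR_ge0|apply: mulr_ge0; [exact: Ka_ge0|exact: f0]].
case: (ltP (enorm (v - y)) r) => vy.
  rewrite mul1r mulrC ler_wpDr// ler_wpM2r//.
  by apply: fC; have := enormB_ge v y; lra.
rewrite mul0r mulr0 add0r /c mulrA ler_wpM2r// subr0 -powRM ?(ltW c0) ?enorm_ge0//.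
have V0 : 0 < enorm v by rewrite enorm_gt0.
apply: ler_powRN; [by rewrite mulr_gt0| |lra].
rewrite ler_pdivrMl ?addr_gt0 ?divr_gt0// mulrDl mul1r.
have h : l <= l / r * enorm (v - y) by rewrite mulrAC ler_pdivlMr// ler_wpM2l// ltW.
by have := enormB_ge v y; lra.
Qed.

End riesz_potential.

(** * Moving spheres *)

Opaque powR expR.

Section power_inequalities.
Context (R : realType).
Implicit Types t p x y : R.

(** Bernoulli's inequality, obtained from Young's inequality with second factor 1. *)
Let one_minus_powR_ge1 t p : 1 <= p -> 0 <= t -> 1 - t `^ p <= p * (1 - t).
Proof.
move=> p1 t0; have [->|pn1] := eqVneq p 1; first by rewrite powRr1// mul1r.
have p1' : 1 < p by rewrite lt_def pn1.
have p0 : 0 < p by lra.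
have q0 : 0 < p / (p - 1) by rewrite divr_gt0//; lra.
have e : p^-1 + (p / (p - 1))^-1 = 1 by field; rewrite !gt_eqF//; lra.
have := conjugate_powR t0 ler01 p0 q0 e; rewrite mulr1 powR1 => h.
have h2 : t * p <= t `^ p + (p - 1).
  have -> : t `^ p + (p - 1) = (t `^ p / p + 1 / (p / (p - 1))) * p.
    by field; rewrite !gt_eqF//; lra.
  by rewrite ler_wpM2r// ltW.
lra.
Qed.

(** An exponent below 1 must be allowed, as [p_star - 1] may be one. For [t <= 1], [t ^ (1 + p)] is
    at most [t ^ p], so Bernoulli applies to [1 + p]: hence the constant. *)
Lemma one_minus_powR t p : 0 < p -> 0 <= t <= 1 -> 1 - t `^ p <= (1 + p) * (1 - t).
Proof.
move=> p0 /andP[t0 t1].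
have h : 1 - t `^ (1 + p) <= (1 + p) * (1 - t) by apply: one_minus_powR_ge1 => //; lra.
have [->|tn0] := eqVneq t 0; first by rewrite powR0 ?gt_eqF//; lra.
have t0' : 0 < t by rewrite lt_def tn0.
rewrite powRD ?tn0 ?implybT// powRr1// in h.
have : t * t `^ p <= t `^ p by rewrite ler_piMl ?powR_ge0.
lra.
Qed.

Lemma powRB_le x y p : 0 < p -> 0 <= x <= y -> 0 < y ->
  y `^ p - x `^ p <= (1 + p) * y `^ (p - 1) * (y - x).
Proof.
move=> p0 /andP[x0 xy] y0.
have t01 : 0 <= x / y <= 1 by rewrite divr_ge0 ?(ltW y0)//= ler_pdivrMr// mul1r.
have := one_minus_powR p0 t01; rewrite -(ler_pM2l (powR_gt0 p y0)) => h.
have -> : y `^ p - x `^ p = y `^ p * (1 - (x / y) `^ p).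
  by rewrite mulrBr mulr1 -powRM ?divr_ge0 ?(ltW y0)// mulrCA divff ?gt_eqF// mulr1.
apply: (le_trans h); rewrite powRB ?(gt_eqF y0) ?implybT// powRr1 ?(ltW y0)//.
rewrite le_eqVlt; apply/orP; left; apply/eqP; field.
by rewrite gt_eqF.
Qed.

End power_inequalities.

Section fundamental_pole.
Context (R : realType) (n : nat) (s : R).
Hypotheses (n2 : 2 <= n%:R :> R) (s0 : 0 < s) (s1 : s < 1).
Local Notation g := (n%:R - 2 * s).
Local Notation fundamental := (@fundamental R n s).
Implicit Types (v x y z : 'rV[R]_n) (c e r l : R).

Let g0 : 0 < g.
Proof. by move: (s0) (s1) (n2) => S0 S1 N2; lra. Qed.

Lemma fundamental_ge0 z v : 0 <= fundamental z v.
Proof. exact: powR_ge0. Qed.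

Lemma fundamental_pole K : exists2 r, 0 < r & forall z v, v != z -> enorm (v - z) < r ->
  K <= fundamental z v.
Proof.
move: (g0) => G0; pose k := Num.max K 1.
have k0 : 0 < k by rewrite lt_max ltr01 orbT.
exists (k `^ (- g^-1)); first exact: powR_gt0.
move=> z v vz vr; apply: (@le_trans _ _ k); first by rewrite le_max lexx.
have -> : k = (k `^ (- g^-1)) `^ (- g).
  by rewrite -powRrM mulrN mulNr opprK mulVf ?gt_eqF// powRr1// ltW.
apply: ler_powRN; [by rewrite enorm_gt0 subr_eq0|exact: ltW|lra].
Qed.

Lemma continuous_fundamental z y : y != z -> {for y, continuous (fundamental z)}.
Proof.
move=> yz; apply: cont_powR; first by rewrite enorm_gt0 subr_eq0.
exact: continuous_enormB.
Qed.

Lemma kelvinK l f v : 0 < l -> v != 0 -> kelvin s l (kelvin s l f) v = f v.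
Proof.
move=> l0 v0; have V0 : 0 < enorm v by rewrite enorm_gt0.
rewrite /kelvin kinvK ?gt_eqF// mulrA -powRM ?divr_ge0 ?enorm_ge0 ?(ltW l0)//.
rewrite enorm_kinv (_ : _ / _ * _ = 1); last by field; rewrite !gt_eqF.
by rewrite powR1 mul1r.
Qed.

Lemma kelvin_sphere l f v : 0 < l -> enorm v = l -> kelvin s l f v = f v.
Proof.
by move=> l0 vl; rewrite /kelvin kinv_fix// vl divff ?gt_eqF// powR1 mul1r.
Qed.

Lemma continuous_kelvin l f v : 0 < l -> v != 0 -> {for kinv l v, continuous f} ->
  {for v, continuous (kelvin s l f)}.
Proof.
move=> l0 v0 cf; have V0 : 0 < enorm v by rewrite enorm_gt0.
have c2 : {for v, continuous (fun x => f (kinv l x))}.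
  exact: (cont_comp (g := f) (continuous_kinv (l := l) v0) cf).
apply: (contM _ c2).
apply: cont_powR; first exact: divr_gt0.
apply: contM; first exact: contc.
apply: contV; first by rewrite gt_eqF.
by apply: continuous_enorm; exact: cont_id.
Qed.

Lemma lipschitz_fundamental z y : y != z -> lipschitz_at (fundamental z) y.
Proof.
move=> yz; have yz0 : y - z != 0 by rewrite subr_eq0.
have l0 : 0 < enorm (y - z) by rewrite enorm_gt0.
have [C [r [r0 H]]] := lipschitz_kelvin1 s yz0.
exists (enorm (y - z) `^ (- g) * C), r; split=> // v vr.
have E x : fundamental z x = enorm (y - z) `^ (- g) * kelvin s (enorm (y - z)) (fun=> 1) (x - z).
  by rewrite -(fundamentalE n2 s0 s1 _ l0) /fundamental subr0.
have vE : v - z - (y - z) = v - y by rewrite opprB addrA subrK.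
rewrite !E -mulrBr normrM ger0_norm ?powR_ge0// -mulrA ler_wpM2l ?powR_ge0//.
by have := H (v - z); rewrite vE; apply.
Qed.

End fundamental_pole.

(** * Harmonic poles at the two uncontrolled points *)

Section sphere_data.
Context (R : realType) (n : nat) (s : R).
Hypotheses (n2 : 2 <= n%:R :> R) (s0 : 0 < s) (s1 : s < 1).
Variables (z : 'rV[R]_n) (l : R).
Hypotheses (l0 : 0 < l) (lz : l < enorm z).
Local Notation g := (n%:R - 2 * s).
Local Notation fundamental := (@fundamental R n s).
Local Notation kelvin := (@kelvin R n s l).
Local Notation ze := (kinv l z).
Implicit Types (v x y : 'rV[R]_n) (c e r : R).

Let g0 : 0 < g.
Proof. by move: (s0) (s1) (n2) => S0 S1 N2; lra. Qed.

Lemma image_pole_lt : enorm ze < l.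
Proof.
rewrite enorm_kinv ltr_pdivrMr; last exact: lt_trans lz.
by rewrite expr2 ltr_pM2l.
Qed.

Lemma inside_neq v : enorm v <= l -> v != z.
Proof. by move=> vl; apply/eqP => vz; move: vl; rewrite vz leNgt lz. Qed.

Lemma kinv_inside v : v != 0 -> enorm v <= l -> l <= enorm (kinv l v).
Proof.
move=> v0 vl; rewrite enorm_kinv ler_pdivlMr ?enorm_gt0//.
by rewrite expr2 ler_pM2l.
Qed.

Lemma kinv_neq_pole v : v != ze -> kinv l v != z.
Proof. by apply: contra_neq => <-; rewrite kinvK// gt_eqF. Qed.

Definition poles v : R := fundamental 0 v + fundamental ze v.

Definition pole_gap v : R := poles v - kelvin poles v.

(** The transform of the pole at [0] is constant, and that of the image pole has its singularity at
    [z], outside the ball. So [pole_gap] is nonnegative inside and still blows up at both poles. *)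
Lemma kelvin_poles v : v != 0 ->
  kelvin poles v = l `^ (- g) + mirror_dist l v ze `^ (- g).
Proof.
move=> v0; have V0 : 0 < enorm v by rewrite enorm_gt0.
have A0 : 0 < l / enorm v by rewrite divr_gt0.
have E m : 0 <= m -> (l / enorm v) `^ g * (l / enorm v * m) `^ (- g) = m `^ (- g).
  move=> m0; rewrite (powRM _ (ltW A0) m0) mulrA -powRD ?addrN ?powRr0 ?mul1r//.
  by rewrite (gt_eqF A0) implybT.
rewrite /kelvin /poles mulrDr; congr (_ + _).
  rewrite /fundamental subr0 enorm_kinv (_ : l ^+ 2 / enorm v = (l / enorm v) * l); last first.
    by rewrite expr2 mulrAC.
  exact/E/ltW.
rewrite /fundamental enormBC mirror_distE// (mirror_distC l ze).
by rewrite (mulrAC l) E// mirror_dist_ge0.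
Qed.

Lemma pole_gap_ge0 v : enorm v < l -> v != 0 -> v != ze -> 0 <= pole_gap v.
Proof.
move: (g0) => G0 vl v0 vz; rewrite /pole_gap kelvin_poles// subr_ge0.
rewrite lerD// /fundamental ?subr0; apply: ler_powRN; rewrite ?enorm_gt0 ?subr_eq0 ?(ltW vl)//; try lra.
rewrite mirror_distC; apply/ltW/mirror_dist_gt => //; exact: image_pole_lt.
Qed.

Lemma pole_gap_sphere v : enorm v = l -> pole_gap v = 0.
Proof. by move=> vl; rewrite /pole_gap kelvin_sphere// subrr. Qed.

Lemma pole_gap_pole K : exists2 r, 0 < r & forall v, enorm v < l -> v != 0 -> v != ze ->
  (enorm v < r \/ enorm (v - ze) < r) -> K <= pole_gap v.
Proof.
move: (g0) => G0; have zl := image_pole_lt.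
have [r r0 H] := fundamental_pole n2 s0 s1 (K + l `^ (- g) + (l - enorm ze) `^ (- g)).
exists r => // v vl v0 vz hr; rewrite /pole_gap kelvin_poles//.
have h1 : mirror_dist l v ze `^ (- g) <= (l - enorm ze) `^ (- g).
  apply: ler_powRN; [by rewrite subr_gt0| |lra].
  by rewrite mirror_distC mirror_dist_ge_bdry.
have F0 := fundamental_ge0 s 0 v; have F1 := fundamental_ge0 s ze v.
have h2 : K + l `^ (- g) + (l - enorm ze) `^ (- g) <= poles v.
  case: hr => hr; rewrite /poles.
    rewrite -(subr0 v) in hr; apply: (le_trans (H 0 v v0 hr)).
    by rewrite lerDl; exact: F1.
  by apply: (le_trans (H ze v vz hr)); rewrite lerDr; exact: F0.
clear hr H F0 F1; lra.
Qed.

Lemma continuous_poles v : v != 0 -> v != ze -> {for v, continuous poles}.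
Proof.
move=> v0 vz; exact: (@contD _ _ _ R^o _ _ (continuous_fundamental v0) (continuous_fundamental vz)).
Qed.

Lemma lipschitz_poles v : v != 0 -> v != ze -> lipschitz_at poles v.
Proof.
move=> v0 vz.
have [C1 [r1 [r10 H1]]] := lipschitz_fundamental n2 s0 s1 v0.
have [C2 [r2 [r20 H2]]] := lipschitz_fundamental n2 s0 s1 vz.
exists (C1 + C2), (Num.min r1 r2); split=> [|x]; first by rewrite lt_min r10.
rewrite lt_min => /andP[/H1 h1 /H2 h2]; rewrite mulrDl.
rewrite /poles opprD (addrACA (fundamental 0 v)).
exact: (le_trans (ler_normD _ _) (lerD h1 h2)).
Qed.

Lemma tail_integrable_poles v : v != 0 -> v != ze -> tail_integrable s poles v.
Proof.
move=> v0 vz; exact: (tail_integrableD (tail_integrable_fundamental n2 s0 s1 v0)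
  (tail_integrable_fundamental n2 s0 s1 vz)).
Qed.

Lemma poles_harmonic v : v != 0 -> v != ze -> trunc_lap s e poles v @[e --> 0^'+] --> 0.
Proof.
move=> v0 vz.
have := at_right0_add (fundamental_harmonic n2 s0 s1 v0) (fundamental_harmonic n2 s0 s1 vz).
rewrite addr0 => h; apply: (at_right0_eq h) => e e0.
apply: esym; apply: (trunc_lapD n2 s0 s1 e0).
  exact: (tail_integrable_fundamental n2 s0 s1 v0).
exact: (tail_integrable_fundamental n2 s0 s1 vz).
Qed.

End sphere_data.

Lemma continuous_ball (R : realType) n (f : 'rV[R]_n -> R) x e :
  {for x, continuous f} -> 0 < e ->
  exists2 r, 0 < r & forall v, enorm (v - x) < r -> `|f v - f x| < e.
Proof.
move=> cf e0; have /cvgrPdist_lt/(_ e e0) h := cf.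
have [r r0 H] := (nbhs_enormP _ _).2 h; exists r => // v /H.
by rewrite distrC.
Qed.

Lemma compact_enorm_min (R : realType) n (f : 'rV[R]_n -> R) (A : set 'rV[R]_n) r x :
  closed A -> A x -> (forall v, A v -> enorm v <= r) -> (forall v, A v -> {for v, continuous f}) ->
  exists2 y, A y & forall v, A v -> f y <= f v.
Proof.
move=> cA Ax Ar cf.
have cf' : {within A, continuous f}.
  by apply: continuous_in_subspaceT => v /set_mem; exact: cf.
have [y /set_mem Ay H] := EVT_min_rV (ex_intro _ x Ax) (compact_enorm_le Ar cA) cf'.
by exists y => // v /mem_set; exact: H.
Qed.

Lemma positive_on_ball (R : realType) n (f : 'rV[R]_n -> R) r : 0 <= r ->
  (forall v, enorm v <= r -> {for v, continuous f}) -> (forall v, enorm v <= r -> 0 < f v) ->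
  exists c C : R, [/\ 0 < c, c <= C & forall v, enorm v <= r -> c <= f v <= C].
Proof.
move=> r0 cf f0.
have cA : closed [set v : 'rV[R]_n | enorm v <= r].
  have := @closed_enorm_le R n 0 r; congr closed.
  by apply/seteqP; split=> v /=; rewrite subr0.
have A0 : [set v : 'rV[R]_n | enorm v <= r] 0 by rewrite /= enorm0.
have [y Ay Hy] := compact_enorm_min cA A0 (fun v => id) cf.
have cg v : enorm v <= r -> {for v, continuous (fun v => -1 * f v)}.
  by move=> vr; apply: contM; [exact: contc|exact: (cf v vr)].
have [x Ax Hx] := compact_enorm_min cA A0 (fun v => id) cg.
exists (f y), (f x); split; [exact: f0|exact: Hy|].
move=> v vr; have h1 := Hy v vr; have h2 := Hx v vr; rewrite !mulN1r lerN2 in h2.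
by rewrite h1.
Qed.

Lemma near_norm_le (R : realType) (x y M : R) : 0 <= M -> `|x - y| < 1 -> `|x| <= M + `|y| + 1.
Proof. by have := ler_normD (x - y) y; rewrite subrK; lra. Qed.

Lemma ler_subl_swap (R : realType) (a b c d : R) : a - b <= c - d -> a - c <= b - d.
Proof. by lra. Qed.

(** Stated for both signs of [r]: it is applied to [p_star - 2]. *)
Lemma powR_between (R : realType) (c C y r : R) : 0 < c -> c <= y <= C ->
  y `^ r <= c `^ r + C `^ r.
Proof.
move=> c0 /andP[cy yC]; have y0 : 0 < y by exact: lt_le_trans cy.
have [r0|r0] := leP 0 r.
  apply: (@le_trans _ _ (C `^ r)); last by rewrite lerDr powR_ge0.
  by rewrite ge0_ler_powR// ?nnegrE ltW// (lt_le_trans y0 yC).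
apply: (@le_trans _ _ (c `^ r)); last by rewrite lerDl powR_ge0.
by apply: ler_powRN => //; exact: ltW.
Qed.

(** [P] and [Q] stand for the potentials of [F] and of the difference [D], [x] and [y] for the
    values of [U_l] and [U]. The right-hand side is [Q * x^(p-1) - P * (y^(p-1) - x^(p-1))], and
    both terms are linear in the size of the negative gap. *)
Lemma perturbation_ge (R : realType) (p x y C X m P Q E M : R) : 1 < p ->
  0 <= x <= y -> 0 < y <= C -> y `^ (p - 1 - 1) <= E -> 0 <= P <= X -> 0 <= m -> - m <= Q ->
  y - x <= M ->
  - (m * C `^ (p - 1) + X * (p * E * M)) <= (P + Q) * x `^ (p - 1) - P * y `^ (p - 1).
Proof.
move=> p1 xy /andP[y0 yC] yE /andP[P0 PX] m0 mQ yxM; have /andP[x0 xley] := xy.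
have q0 : 0 < p - 1 by rewrite subr_gt0.
have C0 : 0 < C by exact: lt_le_trans yC.
have h := powRB_le q0 xy y0; rewrite subrKC in h.
have yx0 : 0 <= y - x by rewrite subr_ge0.
have h1 : y `^ (p - 1) - x `^ (p - 1) <= p * E * M.
  apply: (le_trans h); apply: ler_pM => //.
    by rewrite mulr_ge0 ?powR_ge0// ltW// (lt_trans ltr01).
  by rewrite ler_wpM2l// ltW// (lt_trans ltr01).
have h2 : 0 <= y `^ (p - 1) - x `^ (p - 1).
  by rewrite subr_ge0 ge0_ler_powR ?nnegrE ?(ltW q0)// ltW.
have h3 : P * (y `^ (p - 1) - x `^ (p - 1)) <= X * (p * E * M) by exact: ler_pM.
have h4 : x `^ (p - 1) <= C `^ (p - 1).
  by rewrite ge0_ler_powR ?nnegrE ?(ltW q0) ?(ltW C0)// (le_trans xley).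
have h5 : - (m * C `^ (p - 1)) <= Q * x `^ (p - 1).
  apply: (@le_trans _ _ (- m * x `^ (p - 1))); last by rewrite ler_wpM2r ?powR_ge0.
  by rewrite mulNr lerN2 ler_wpM2l.
have -> : (P + Q) * x `^ (p - 1) - P * y `^ (p - 1) =
  Q * x `^ (p - 1) - P * (y `^ (p - 1) - x `^ (p - 1)) by ring.
by lra.
Qed.

Lemma half_le_near (R : realType) (a b : R) : `|a - b| < b / 2 -> b / 2 <= a.
Proof. by rewrite ltr_norml => /andP[]; lra. Qed.

Lemma near_gt (R : realType) (a b c l : R) : a < b - l -> b - c <= a -> l < c.
Proof. by lra. Qed.

Lemma shift_le (R : realType) (l l0 d : R) : l - l0 < d / 2 -> l - d <= l0 - d / 2.
Proof. by lra. Qed.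

Lemma sub_ge_opp (R : realType) (a b C : R) : b <= C -> 0 < a -> - C <= a - b.
Proof. by lra. Qed.

Lemma continuous_cap (R : realType) n rho (v : 'rV[R]_n) : {for v, continuous (@cap R n rho)}.
Proof.
apply: (continuous_max (f := fun=> 0)); first exact: contc.
apply: (@contB _ _ _ R^o); first exact: contc.
apply: contM; last exact: contc.
by apply: contX; apply: continuous_enorm; exact: cont_id.
Qed.

(** Iteration gives the lower bounds [- C / 2^k]. It replaces an argument at the infimum of the gap,
    which need not be attained. *)
Lemma halving_ge0 (R : realType) (T : Type) (P : T -> Prop) (f : T -> R) C : 0 < C ->
  (forall t, P t -> - C <= f t) ->
  (forall M, 0 < M -> (forall t, P t -> - M <= f t) -> forall t, P t -> - (M / 2) <= f t) ->
  forall t, P t -> 0 <= f t.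
Proof.
move=> C0 fC H.
have IH k t : P t -> - (C / 2 ^+ k) <= f t.
  elim: k t => [|k IH] t Pt; first by rewrite expr0 divr1 fC.
  have := H _ _ IH t Pt; rewrite exprSr invfM mulrA; apply.
  by rewrite divr_gt0// exprn_gt0.
move=> t Pt; rewrite leNgt; apply/negP => ft.
have ft0 : 0 < - f t by rewrite oppr_gt0.
have := IH (Num.truncn (C / - f t)).+1 t Pt; apply/negP; rewrite -ltNge ltrNr.
rewrite ltr_pdivrMr ?exprn_gt0// mulrC -ltr_pdivrMr//.
apply: (lt_trans (truncnS_gt _)); rewrite -natrX ltr_nat.
exact: ltn_expl.
Qed.

(** * Comparison of [U] with its Kelvin transforms *)

Section moving_spheres.
Context (R : realType) (n : nat) (s alpha : R).
Hypotheses (n2 : 2 <= n%:R :> R) (s0 : 0 < s) (s1 : s < 1) (al : 0 < alpha < n%:R).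
Variables (U : 'rV[R]_n -> R) (z : 'rV[R]_n) (kappa : R).
Local Notation q := (n%:R + 2 * s).
Local Notation g := (n%:R - 2 * s).
Local Notation p := (p_star n s alpha).
Local Notation kelvin := (@kelvin R n s).
Local Notation trunc_lap := (@trunc_lap R n s).
Local Notation tail_integrable := (@tail_integrable R n s).
Local Notation riesz := (@riesz R n alpha).
Local Notation riesz_itg := (@riesz_itg R n alpha).
Local Notation conformal := (@conformal R n alpha).
Local Notation poles := (@poles R n s z).
Local Notation pole_gap := (@pole_gap R n s z).
Implicit Types (v x y : 'rV[R]_n) (c d e r l : R).
Let F v := U v `^ p.
Hypotheses (kappa0 : 0 < kappa) (z0 : z != 0) (mU : measurable_fun setT U).
Hypothesis tU : forall v, v != z -> tail_integrable U v.
Hypothesis contU : forall v, v != z -> {for v, continuous U}.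
Hypothesis lipU : forall v, v != z -> lipschitz_at U v.
Hypothesis posU : forall v, v != z -> 0 < U v.
Hypothesis IU : forall v, v != z -> riesz_itg F v.
Hypothesis eqU : forall v, v != z -> exists2 I : R, trunc_lap e U v @[e --> 0^'+] --> I &
  kappa * I = riesz F v * U v `^ (p - 1).
Hypothesis singU : forall f : 'rV[R]_n -> R, {for z, continuous f} ->
  (\forall v \near z, v != z -> f v = U v) -> False.

Let n0 : (0 < n)%N. Proof. by rewrite -(ltr_nat R); apply: lt_le_trans n2. Qed.

Let g0 : 0 < g.
Proof. by move: (s0) (s1) (n2) => S0 S1 N2; lra. Qed.

Let p1 : 1 < p.
Proof.
have /andP[a0 _] := al; move: (s0) (s1) (n2) (g0) => S0 S1 N2 G0.
by rewrite /p_star ltr_pdivlMr//; lra.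
Qed.

Let gp : g * p = n%:R + alpha.
Proof. by rewrite /p_star mulrC divfK// gt_eqF. Qed.

Let F0 v : 0 <= F v. Proof. exact: powR_ge0. Qed.

Let mF : measurable_fun setT F.
Proof. by apply: measurable_powRf. Qed.

Let p0 : 0 < p. Proof. exact: lt_trans p1. Qed.

Definition gap l v : R := kelvin l U v - U v.

Let D l v : R := conformal l F v - F v.

(* Adding [e * pole_gap] to the gap makes it blow up at [0] and at [kinv l z]
   without changing the equation. *)
Let W l e v : R := U v - e * poles l v.

Let G l e v : R := kelvin l (W l e) v - W l e v.

Let GE l e v : G l e v = gap l v + e * pole_gap l v.
Proof. rewrite /G /W /gap /pole_gap /kelvin.
by move: (poles l _) (poles l _) (_ `^ _) => A B C; ring. Qed.

Let mD l : 0 < l -> measurable_fun setT (D l).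
Proof.
move=> l0; apply: measurable_funB => //; apply: measurable_funM.
  by measr.
by apply: (measurableT_comp mF); exact: measurable_kinv.
Qed.

(** The weights agree since [g * p = n + alpha]. The image pole is excluded because the sign of
    [U z], needed to split the power of a product, is unknown. *)
Let conformalE l v : 0 < l -> v != kinv l z -> conformal l F v = kelvin l U v `^ p.
Proof.
move=> l0 vz; rewrite /conformal /kelvin -gp.
have [->|v0] := eqVneq v 0.
  by rewrite enorm0 invr0 mulr0 !powR0 ?mul0r ?powR0// ?gt_eqF// mulr_gt0.
by rewrite (powRM _ (powR_ge0 _ _) (ltW (posU (kinv_neq_pole l0 vz)))) -powRrM.
Qed.

Let antiD l v : 0 < l -> v != 0 -> conformal l (D l) v = - D l v.
Proof.
move=> l0 v0; have V0 : 0 < enorm v by rewrite enorm_gt0.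
rewrite /D {1}/conformal mulrBr {1}/conformal mulrA -powRM ?divr_ge0 ?enorm_ge0 ?(ltW l0)//.
rewrite enorm_kinv (_ : _ / _ * _ = 1); last by field; rewrite !gt_eqF.
by rewrite powR1 mul1r kinvK ?gt_eqF// opprB.
Qed.

Let antiG l e v : 0 < l -> v != 0 -> kelvin l (G l e) v = - G l e v.
Proof.
move=> l0 v0; have E : kelvin l (G l e) v = kelvin l (kelvin l (W l e)) v - kelvin l (W l e) v.
  by rewrite /G {1}/kelvin mulrBr.
by rewrite E kelvinK// /G opprB.
Qed.

Section sphere.
Variable l : R.
Hypotheses (l0 : 0 < l) (lz : l < enorm z).
Local Notation ze := (kinv l z).

Definition inside v := [/\ enorm v < l, v != 0 & v != ze].

Let kinside v : inside v -> [/\ kinv l v != z, kinv l v != 0 & kinv l v != ze].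
Proof.
move=> [vl v0 vz]; split; first exact: kinv_neq_pole.
  by rewrite kinv_eq0// gt_eqF.
apply/eqP => E; have := kinv_inside l0 v0 (ltW vl).
by rewrite E leNgt (image_pole_lt l0 lz).
Qed.

Let insidez v : inside v -> v != z.
Proof. by move=> [vl _ _]; exact: (inside_neq lz (ltW vl)). Qed.

Let tW e v : v != z -> v != 0 -> v != ze -> tail_integrable (W l e) v.
Proof.
move=> vz v0 vze.
exact: (tail_integrableB (tU vz) (tail_integrableZ e (tail_integrable_poles n2 s0 s1 v0 vze))).
Qed.

Let lipW e v : v != z -> v != 0 -> v != ze -> lipschitz_at (W l e) v.
Proof.
move=> vz v0 vze; have [C1 [r1 [r10 H1]]] := lipU vz.
have [C2 [r2 [r20 H2]]] := lipschitz_poles n2 s0 s1 v0 vze.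
exists (C1 + `|e| * C2), (Num.min r1 r2); split=> [|x]; first by rewrite lt_min r10.
rewrite lt_min => /andP[/H1 h1 /H2 h2].
have -> : W l e v - W l e x = (U v - U x) - e * (poles l v - poles l x).
  by rewrite /W; move: (poles l v) (poles l x) => A B; ring.
apply: (le_trans (ler_normB _ _)); rewrite normrM mulrDl; apply: lerD => //.
by rewrite -mulrA ler_wpM2l.
Qed.

Let cvgW e v : v != z -> v != 0 -> v != ze -> exists2 I : R,
  trunc_lap t (W l e) v @[t --> 0^'+] --> I & kappa * I = riesz F v * U v `^ (p - 1).
Proof.
move=> vz v0 vze; have [I UI EI] := eqU vz; exists I => //.
have h := at_right0_add UI (at_right0_mul (a := - e) (poles_harmonic n2 s0 s1 v0 vze)).
rewrite mulr0 addr0 in h; apply: (at_right0_eq h) => t t0.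
have tp := tail_integrable_poles n2 s0 s1 v0 vze.
rewrite mulNr -(trunc_lapZ n2 s0 s1 e t0 tp).
exact: (esym (trunc_lapB n2 s0 s1 t0 (tU vz) (tail_integrableZ e tp))).
Qed.

Lemma riesz_itg_gap v : inside v -> riesz_itg (D l) v.
Proof.
move=> vi; have [h1 _ _] := kinside vi; have [_ v0 _] := vi.
have I1 := riesz_itg_conformal n0 al l0 v0 (IU h1).
by apply: eq_itg (itgB I1 (IU (insidez vi))) => x; rewrite /D mulrBr.
Qed.

(** Conformal invariance of the equation: by [gp], [q = (n - alpha) + g * (p - 1)], the two
    exponents coming from the potential and from the power of [U]. The poles are harmonic, so [e]
    does not enter the value. *)
Lemma kelvin_difference e v : inside v -> exists2 L : R,
  trunc_lap t (G l e) v @[t --> 0^'+] --> L &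
  kappa * L = (riesz F v + riesz (D l) v) * kelvin l U v `^ (p - 1) - riesz F v * U v `^ (p - 1).
Proof.
move=> vi; have [h1 h2 h3] := kinside vi; have [vl v0 vze] := vi; have vz := insidez vi.
have V0 : 0 < enorm v by rewrite enorm_gt0.
have [I WI EI] := cvgW e vz v0 vze.
have [J WJ EJ] := cvgW e h1 h2 h3.
have KJ := kelvin_lap_cvg n2 s0 s1 l0 v0 (tW e h1 h2 h3) (lipW e h1 h2 h3) WJ.
exists ((l / enorm v) `^ q * J - I).
  have h := at_right0_add KJ (at_right0_mul (a := -1) WI).
  rewrite mulN1r in h; apply: (at_right0_eq h) => t t0; rewrite mulN1r.
  exact: (esym (trunc_lapB n2 s0 s1 t0 (tail_integrable_kelvin n2 l0 v0 (tW e h1 h2 h3))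
    (tW e vz v0 vze))).
have -> : riesz F v + riesz (D l) v = (l / enorm v) `^ (n%:R - alpha) * riesz F (kinv l v).
  rewrite -(riesz_conformal n0 al l0 v0 (IU h1)).
  have I1 := riesz_itg_conformal n0 al l0 v0 (IU h1).
  have -> : riesz (D l) v = riesz (conformal l F) v - riesz F v.
    by apply: (etrans _ (IntB I1 (IU vz))); apply: eq_Int => x; rewrite /D mulrBr.
  by rewrite addrC subrK.
rewrite mulrBr EI mulrCA EJ; congr (_ - _).
rewrite /kelvin (powRM _ (powR_ge0 _ _) (ltW (posU h1))) -powRrM.
have -> : (l / enorm v) `^ q = (l / enorm v) `^ (n%:R - alpha) * (l / enorm v) `^ (g * (p - 1)).
  rewrite -powRD ?(gt_eqF (divr_gt0 l0 V0)) ?implybT//.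
  by congr (_ `^ _); rewrite mulrBr gp; ring.
by ring.
Qed.

Let contG e v : enorm v <= l -> v != 0 -> v != ze -> {for v, continuous (G l e)}.
Proof.
move=> vl v0 vze; have vz := inside_neq lz vl.
have vK := kinv_neq_pole l0 vze.
have v'0 : kinv l v != 0 by rewrite kinv_eq0// gt_eqF.
have v'z : kinv l v != ze.
  apply/eqP => E; have := kinv_inside l0 v0 vl.
  by rewrite E leNgt (image_pole_lt l0 lz).
have cW x : x != z -> x != 0 -> x != ze -> {for x, continuous (W l e)}.
  move=> xz x0 xze; apply: (@contB _ _ _ R^o); first exact: contU.
  apply: contM; first exact: contc.
  exact: (continuous_poles x0 xze).
apply: (@contB _ _ _ R^o); [exact: (continuous_kelvin l0 v0 (cW _ vK v'0 v'z))|exact: (cW _ vz v0 vze)].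
Qed.

Let gap_sphere v : enorm v = l -> gap l v = 0.
Proof. by move=> vl; rewrite /gap kelvin_sphere// subrr. Qed.

(** Near the poles the added term exceeds the worst value of [eta - gap], and on the sphere
    everything vanishes; a negative minimum is therefore attained on a compact set away from the
    poles and lies strictly inside. *)
Lemma gap_min e (eta : 'rV[R]_n -> R) M x : 0 < e ->
  (forall v, {for v, continuous eta}) -> (forall v, 0 <= eta v <= M) ->
  (forall v, enorm v = l -> eta v = 0) -> (forall v, inside v -> - M <= gap l v) ->
  inside x -> G l e x - eta x < 0 ->
  exists y, [/\ inside y, G l e y - eta y <= G l e x - eta x &
    forall v, inside v -> G l e y - eta y <= G l e v - eta v].
Proof.
move=> e0 ceta eta01 etal gM xi xneg.
(* One [M] compensates [gap >= - M], the other [eta <= M]. *)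
have [r r0 H] := pole_gap_pole n2 s0 s1 l0 lz (2 * M / e).
have near0 v : inside v -> enorm v < r \/ enorm (v - ze) < r -> 0 <= G l e v - eta v.
  move=> vi hr; have [vl v0 vz] := vi; have := H v vl v0 vz hr; rewrite ler_pdivrMr// => h.
  have := gM v vi; have /andP[_] := eta01 v; rewrite GE mulrC; lra.
pose A := [set v : 'rV[R]_n | enorm v <= l] `&` ([set v | r <= enorm v] `&` [set v | r <= enorm (v - ze)]).
have cA : closed A.
  have c1 := @closed_enorm_le R n 0 l; have c2 := @closed_enorm_ge R n 0 r.
  rewrite (_ : [set x | enorm (x - 0) <= l] = [set v | enorm v <= l]) in c1; last first.
    by apply/seteqP; split=> v /=; rewrite subr0.
  rewrite (_ : [set x | r <= enorm (x - 0)] = [set v | r <= enorm v]) in c2; last first.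
    by apply/seteqP; split=> v /=; rewrite subr0.
  exact: (closedI c1 (closedI c2 (@closed_enorm_ge R n ze r))).
have inA v : inside v -> G l e v - eta v < 0 -> A v.
  move=> vi vneg; have [vl _ _] := vi; split; first exact: ltW.
  have h := near0 v vi; split=> /=; rewrite leNgt; apply/negP => hr.
    by have := h (or_introl hr); rewrite leNgt vneg.
  by have := h (or_intror hr); rewrite leNgt vneg.
have Aneq v : A v -> [/\ enorm v <= l, v != 0 & v != ze].
  move=> [vl [/= vr vzr]]; split=> //.
    by rewrite -enorm_gt0; exact: lt_le_trans vr.
  by rewrite -subr_eq0 -enorm_gt0; exact: lt_le_trans vzr.
have cG v : A v -> {for v, continuous (fun v => G l e v - eta v)}.
  move=> /Aneq[vl v0 vz]; apply: (@contB _ _ _ R^o); [exact: (contG vl v0 vz)|exact: (ceta v)].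
have [y Ay Hy] := compact_enorm_min cA (inA x xi xneg) (fun v Av => Av.1) cG.
have yneg := le_lt_trans (Hy x (inA x xi xneg)) xneg.
have [yl y0 yz] := Aneq y Ay.
have yi : inside y.
  split=> //; rewrite lt_neqAle yl andbT; apply/eqP => yl'.
  by move: yneg; rewrite GE gap_sphere// pole_gap_sphere// etal// mulr0 addr0 subr0 ltxx.
exists y; split=> //; first exact: (Hy x (inA x xi xneg)).
move=> v vi; have [vneg|vpos] := ltP (G l e v - eta v) 0; first exact: (Hy v (inA v vi vneg)).
exact: (le_trans (ltW yneg) vpos).
Qed.

Let tG e v : inside v -> tail_integrable (G l e) v.
Proof.
move=> vi; have [h1 h2 h3] := kinside vi; have [vl v0 vze] := vi; have vz := insidez vi.
exact: (tail_integrableB (tail_integrable_kelvin n2 l0 v0 (tW e h1 h2 h3)) (tW e vz v0 vze)).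
Qed.

Lemma kelvin_gt0 v : inside v -> 0 < kelvin l U v.
Proof.
move=> vi; have [h1 _ _] := kinside vi; have [_ v0 _] := vi.
by rewrite /kelvin mulr_gt0 ?posU// powR_gt0// divr_gt0// enorm_gt0.
Qed.

(** The equation evaluates the operator at the touching point, so the maximum principle becomes an
    upper bound on the difference of the right-hand sides, to be contradicted by a lower bound. *)
Lemma touching_bound e (eta : 'rV[R]_n -> R) M X y : inside y ->
  measurable_fun setT eta -> (forall v, 0 <= eta v <= M) ->
  (forall v, inside v -> G l e y - eta y <= G l e v - eta v) ->
  (forall t, 0 < t -> t < l - enorm y -> Int (fun v => chi (enorm v < l) *
   (chi (t < enorm (v - y)) * ((eta y - eta v) * (Kq s (v - y) - Km s l y v)))) <= X) ->
  (riesz F y + riesz (D l) y) * kelvin l U y `^ (p - 1) - riesz F y * U y `^ (p - 1) <=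
  kappa * (X + Num.max (G l e y) 0 * Int (fun v => chi (enorm v < l) * Km s l y v) +
    G l e y * exit_mass s l y).
Proof.
move=> yi meta eta01 touch HX; have [yl y0 yze] := yi.
have [L GL <-] := kelvin_difference e yi.
rewrite (ler_pM2l kappa0).
have cG : {for y, continuous (G l e)} by exact: (contG (ltW yl) y0 yze).
have [r r0 Hr] := continuous_ball cG ltr01.
(* [maximum_principle] takes a single bound for [eta] and for [G] near [y], hence the enlarged
   constant. *)
have eta01' v : 0 <= eta v <= M + `|G l e y| + 1.
  have /andP[h1 h2] := eta01 v; rewrite h1/= -addrA; apply: (le_trans h2).
  by rewrite lerDl addr_ge0.
have GM v : enorm (v - y) < r -> `|G l e v| <= M + `|G l e y| + 1.
  move=> /Hr h; have M0 : 0 <= M by have /andP[h1 h2] := eta01 0; exact: le_trans h2.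
  exact: near_norm_le.
have touch' v : enorm v < l -> v != 0 -> v != ze -> G l e y - G l e v <= eta y - eta v.
  move=> vl v0 vz; have h := touch v (And3 vl v0 vz).
  exact: ler_subl_swap.
have aG v : v != 0 -> kelvin l (G l e) v = - G l e v by exact: antiG.
exact: (maximum_principle n2 s0 s1 l0 yl (tG e yi) aG meta eta01' r0 GM touch' GL HX).
Qed.

End sphere.

(** [z] lies beyond the sphere; half the remaining distance leaves a compact ball avoiding [z], with
    room for the local part of the potential. *)
Let bounds l : 0 < l -> l < enorm z -> exists c C X : R, [/\ 0 < c, c <= C, 0 <= X,
  forall v, enorm v <= l -> c <= U v <= C &
  forall v, enorm v <= l -> 0 <= riesz F v <= X].
Proof.
move=> l0 lz; pose r := (enorm z - l) / 2.
have r0 : 0 < r by rewrite divr_gt0// subr_gt0.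
have lr0 : 0 <= l + r by rewrite addr_ge0 ?(ltW l0) ?(ltW r0).
have lrz v : enorm v <= l + r -> v != z.
  by move=> vl; apply: (@inside_neq _ _ _ (l + r)) => //; rewrite /r; lra.
have [c [C [c0 cC cU]]] := positive_on_ball lr0 (fun v h => contU (lrz v h)) (fun v h => posU (lrz v h)).
have I0 : riesz_itg F 0 by apply: IU; rewrite eq_sym.
have FC v : enorm v <= l + r -> F v <= C `^ p.
  move=> vl; have /andP[h1 h2] := cU v vl.
  by rewrite ge0_ler_powR ?nnegrE ?(ltW p0)//; [exact/ltW/(lt_le_trans c0 h1)|lra].
have [X X0 HX] := riesz_bounded n0 al l0 r0 F0 I0 FC.
exists c, C, X; split=> // v vl.
  by apply: cU; apply: (le_trans vl); rewrite lerDl ltW.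
have vz : v != z by apply: lrz; apply: (le_trans vl); rewrite lerDl ltW.
have vl' : enorm v <= l by exact: vl.
have h1 : riesz F v <= X by exact: (HX v vl' (IU vz)).
rewrite h1 andbT; apply: Int_ge0 => x; apply: mulr_ge0; [exact: Ka_ge0|exact: F0].
Qed.

Let D_ge l C M v : 0 < l -> l < enorm z -> inside l v -> 0 <= M -> U v <= C ->
  - M <= gap l v -> - ((1 + p) * C `^ (p - 1) * M) <= D l v.
Proof.
move=> l0 lz vi M0 UC gM; have [vl v0 vze] := vi.
have K0 := ltW (kelvin_gt0 l0 lz vi); have U0 : 0 < U v by exact/posU/(inside_neq lz (ltW vl)).
have C0 : 0 <= C by exact/ltW/(lt_le_trans U0).
have q0 : 0 <= p - 1 by rewrite subr_ge0 ltW.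
have p10 : 0 <= 1 + p by rewrite addr_ge0// ltW.
rewrite /D (conformalE l0 vze) /F.
have [KU|UK] := ltP (kelvin l U v) (U v).
  rewrite lerNl opprB; apply: (le_trans (powRB_le p0 _ U0)); first by rewrite K0 ltW.
  apply: ler_pM; first by rewrite mulr_ge0 ?powR_ge0.
  - by rewrite subr_ge0 ltW.
  - by rewrite ler_wpM2l// ge0_ler_powR// ?nnegrE ?(ltW U0).
  - by rewrite lerNl opprB in gM.
apply: (@le_trans _ _ 0).
  by rewrite oppr_le0 mulr_ge0// mulr_ge0 ?powR_ge0.
by rewrite subr_ge0 ge0_ler_powR ?nnegrE ?(ltW p0)// ltW.
Qed.

(** Linear in [M], with [K] uniform in [l <= l1]: this lets the width of the narrow region stay
    fixed while [l] grows. *)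
Let rhs_ge l1 : 0 < l1 -> l1 < enorm z -> exists2 K, 0 <= K & forall l M y, 0 < l -> l <= l1 ->
  0 <= M -> (forall v, inside l v -> - M <= gap l v) -> inside l y -> gap l y <= 0 ->
  - (K * M) <= (riesz F y + riesz (D l) y) * kelvin l U y `^ (p - 1) - riesz F y * U y `^ (p - 1).
Proof.
move=> l10 l1z; have [c [C [X [c0 cC X0 cU FX]]]] := bounds l10 l1z.
have C0 : 0 <= C by exact/ltW/(lt_le_trans c0).
have p10 : 0 <= 1 + p by rewrite addr_ge0// ltW.
pose E := c `^ (p - 1 - 1) + C `^ (p - 1 - 1).
have E0 : 0 <= E by rewrite addr_ge0 ?powR_ge0.
pose A := (1 + p) * C `^ (p - 1).
have A0 : 0 <= A by rewrite mulr_ge0 ?powR_ge0.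
pose m1 := riesz_mass n alpha (2 * l1).
have m10 : 0 <= m1 by exact: riesz_mass_ge0.
exists (A * m1 * C `^ (p - 1) + X * (p * E)).
  by apply: addr_ge0; apply: mulr_ge0; rewrite ?powR_ge0//; apply: mulr_ge0 => //; exact: ltW.
move=> l M y l0 ll1 M0 gM yi gy; have lz : l < enorm z by exact: le_lt_trans l1z.
have [yl y0 yze] := yi.
have inl1 v : inside l v -> enorm v <= l1 by move=> [vl _ _]; exact: (le_trans (ltW vl)).
have /andP[cUy UyC] := cU y (inl1 y yi).
have U0 : 0 < U y by exact: lt_le_trans cUy.
have AM0 : 0 <= A * M by exact: mulr_ge0.
have DM v : enorm v < l -> v != 0 -> v != kinv l z -> - (A * M) <= D l v.
  move=> vl v0 vz; have vi : inside l v by [].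
  have /andP[_ UvC] := cU v (inl1 v vi).
  exact: (D_ge l0 lz vi M0 UvC (gM v vi)).
have aD v : v != 0 -> conformal l (D l) v = - D l v by exact: antiD.
have RD := riesz_fold_ge n0 al l0 yl (mD l0) (riesz_itg_gap l0 lz yi) aD AM0 DM.
have mm : riesz_mass n alpha (2 * l) <= m1.
  have l20 : 0 < 2 * l by rewrite mulr_gt0.
  have l120 : 0 < 2 * l1 by rewrite mulr_gt0.
  apply: (Int_le (itg_power_ball al l20) (itg_power_ball al l120)) => v.
  rewrite ler_wpM2r ?powR_ge0// ler_nat; case: (ltP (enorm v) (2 * l)) => // h.
  by rewrite (lt_le_trans h)// ler_pM2l.
have RD' : - (A * M * m1) <= riesz (D l) y.
  by apply: le_trans RD; rewrite mulNr lerN2 ler_wpM2l.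
have Amm : 0 <= A * M * m1 by exact: mulr_ge0.
have K0 : 0 <= kelvin l U y <= U y.
  by rewrite (ltW (kelvin_gt0 l0 lz yi))/=; rewrite /gap subr_le0 in gy.
have UC : 0 < U y <= C by rewrite U0.
have UE : U y `^ (p - 1 - 1) <= E by apply: powR_between => //; rewrite cUy.
have UM : U y - kelvin l U y <= M by have := gM y yi; rewrite /gap lerNl opprB.
have h := perturbation_ge p1 K0 UC UE (FX y (inl1 y yi)) Amm RD' UM.
apply: le_trans h; rewrite lerN2 le_eqVlt; apply/orP; left; apply/eqP.
by ring.
Qed.

(* At a negative minimum of the gap at distance [d] from the sphere, the kernel
   has mass of order [d `^ (- (2 * s))] outside the ball; for small [d] this
   dominates the potential terms, which are bounded by a multiple of the minimum. *)
Lemma narrow_region l1 : 0 < l1 -> l1 < enorm z -> exists2 d, 0 < d & forall l, 0 < l -> l <= l1 ->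
  (forall v, inside l v -> enorm v <= l - d -> 0 <= gap l v) ->
  forall v, inside l v -> 0 <= gap l v.
Proof.
move=> l10 l1z; have [K K0 HK] := rhs_ge l10 l1z.
have [c [C [X [c0 cC _ cU _]]]] := bounds l10 l1z.
pose k4 := 4 `^ (- q) * unit_ball_volume R n.
have k40 : 0 < k4 by rewrite mulr_gt0 ?powR_gt0 ?unit_ball_volume_gt0.
(* Makes the exit term at gap [- M / 2] at least [M * (K + 1)], just beyond the [K * M] allowed by
   [rhs_ge]. *)
pose B := 2 * (K + 1) / (kappa * k4).
have B0 : 0 < B.
  by apply: divr_gt0; [apply: mulr_gt0 => //; rewrite ltr_wpDl|exact: mulr_gt0].
have s20 : 0 < 2 * s by rewrite mulr_gt0.
exists (B `^ (- (2 * s)^-1)); first exact: powR_gt0.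
set d := _ `^ _; have d0 : 0 < d by exact: powR_gt0.
have dB : d `^ (- (2 * s)) = B.
  by rewrite /d -powRrM mulrN mulNr opprK mulVf ?gt_eqF// powRr1// ltW.
move=> l l0 ll1 Hd; have lz : l < enorm z by exact: le_lt_trans l1z.
have inl1 v : inside l v -> enorm v <= l1 by move=> [vl _ _]; exact: (le_trans (ltW vl)).
apply: (halving_ge0 (C := C)); first exact: (lt_le_trans c0).
  move=> v vi; have /andP[_ UC] := cU v (inl1 v vi).
  by have := kelvin_gt0 l0 lz vi; rewrite /gap; move: UC; exact: sub_ge_opp.
move=> M M0 gM x xi; rewrite leNgt; apply/negP => gx.
have [xl x0 xz] := xi.
have Px := pole_gap_ge0 n2 s0 s1 l0 lz xl x0 xz.
(* Small enough that the perturbed gap at [x] stays below [- M / 2]; the [+ 1] is there because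
   [pole_gap l x] may vanish. *)
pose e := (- (M / 2) - gap l x) / (pole_gap l x + 1) / 2.
have P1 : 0 < pole_gap l x + 1 by rewrite ltr_wpDl.
have e0 : 0 < e by rewrite divr_gt0 ?divr_gt0// subr_gt0.
have GxM : G l e x < - (M / 2).
  rewrite GE -ltrBrDl; apply: (@le_lt_trans _ _ (e * (pole_gap l x + 1))).
    by rewrite ler_wpM2l ?(ltW e0)// lerDl.
  rewrite /e mulrAC divfK ?gt_eqF//; rewrite ltr_pdivrMr// ltr_pMr ?subr_gt0//.
  by rewrite ltr1n.
have M20 : 0 < M / 2 by rewrite divr_gt0.
have Gx0 : G l e x - 0 < 0 by rewrite subr0 (lt_trans GxM)// oppr_lt0.
have z01 (v : 'rV[R]_n) : 0 <= (0 : R) <= M by rewrite lexx ltW.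
have cz (v : 'rV[R]_n) : {for v, continuous (fun=> 0 : R)} by exact: contc.
have [y [yi yx ymin]] := gap_min l0 lz e0 cz z01 (fun v _ => erefl) gM xi Gx0.
have [yl y0 yz] := yi.
have Py := pole_gap_ge0 n2 s0 s1 l0 lz yl y0 yz.
have {}yx : G l e y <= G l e x.
  by apply: (le_trans _ (le_trans yx _)); apply: eq_ler; [exact: (esym (subr0 _))|exact: (subr0 _)].
have GyM : G l e y < - (M / 2) by exact: le_lt_trans GxM.
have Gy0 : G l e y < 0 by rewrite (lt_trans GyM)// oppr_lt0.
have gy0 : gap l y <= 0.
  apply: (le_trans _ (ltW Gy0)); rewrite GE lerDl mulr_ge0//; exact: ltW.
have yd : l - enorm y < d.
  rewrite ltrBlDr -ltrBlDl; rewrite ltNge; apply/negP => yd.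
  have gy := Hd y yi yd; have : 0 <= G l e y by rewrite GE addr_ge0// mulr_ge0// ltW.
  by rewrite leNgt Gy0.
have := touching_bound (X := 0) l0 lz yi (@measurable_cst _ _ _ _ _ (0 : R)) z01 ymin.
have I0 t : 0 < t -> t < l - enorm y -> Int (fun v => chi (enorm v < l) *
   (chi (t < enorm (v - y)) * ((0 - 0) * (Kq s (v - y) - Km s l y v)))) <= 0.
  move=> _ _; apply: eq_ler; rewrite -[RHS](Int0 R n); apply: eq_Int => v.
  by rewrite subrr mul0r !mulr0.
move=> /(_ I0); rewrite (max_r (ltW Gy0)) mul0r add0r add0r => up.
have low := HK l M y l0 ll1 (ltW M0) gM yi gy0.
have := le_trans low up; apply/negP; rewrite -ltNge.
have ex := exit_mass_ge n2 s0 s1 l0 y0 yl.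
have dd : d `^ (- (2 * s)) <= (l - enorm y) `^ (- (2 * s)).
  by apply: ler_powRN; [rewrite subr_gt0|exact: ltW|rewrite oppr_le0 ltW].
have exB : k4 * B <= exit_mass s l y.
  by apply: le_trans ex; rewrite -dB ler_wpM2l// ltW.
have E : kappa * (M / 2 * (k4 * B)) = M * (K + 1).
  by rewrite /B; field; rewrite !gt_eqF.
apply: (@le_lt_trans _ _ (- (M * (K + 1)))); last first.
  by rewrite ltrN2 mulrC ltr_pM2l// ltrDl.
rewrite -E -mulrN ler_pM2l// lerNr -mulNr; apply: ler_pM => //.
- exact: ltW.
- by rewrite mulr_ge0// ltW.
- by rewrite lerNr ltW.
Qed.

Let cont_excess l v : 0 < l -> l < enorm z -> inside l v -> {for v, continuous (D l)}.
Proof.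
move=> l0 lz [vl v0 vze]; have vz := inside_neq lz (ltW vl).
have kz := kinv_neq_pole l0 vze.
have V0 : 0 < enorm v by rewrite enorm_gt0.
have cF x : x != z -> {for x, continuous F}.
  by move=> xz; apply: cont_powR; [exact: posU|exact: contU].
apply: (@contB _ _ _ R^o); last exact: (cF v vz).
have c2 : {for v, continuous (fun x => F (kinv l x))}.
  exact: (cont_comp (g := F) (continuous_kinv (l := l) v0) (cF _ kz)).
apply: (contM _ c2); apply: cont_powR; first exact: divr_gt0.
apply: contM; first exact: contc.
apply: contV; first by rewrite gt_eqF.
by apply: continuous_enorm; exact: cont_id.
Qed.

(* A small multiple of the paraboloid [cap] stays below the gap: at a point of first
   contact the right-hand side of the equation would be bounded away from [0]. *)
Lemma barrier_gap l rho y1 : 0 < l -> l < enorm z -> (forall v, inside l v -> 0 <= gap l v) ->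
  inside l y1 -> 0 < gap l y1 -> 0 < rho < l ->
  exists2 c, 0 < c & forall v, inside l v -> enorm v <= rho -> c <= gap l v.
Proof.
move=> l0 lz g_ge0 y1i gy1 /andP[rho0 rhol]; have [y1l y10 y1z] := y1i.
(* Beyond [rho], so that the cap of radius [r1] is bounded below on [enorm v <= rho], and beyond
   [y1], so that a ball about [y1] fits inside. *)
pose r1 := (Num.max rho (enorm y1) + l) / 2.
have ml : Num.max rho (enorm y1) < l by rewrite gt_max rhol.
have mr : Num.max rho (enorm y1) < r1 by exact: (midf_lt ml).1.
have r1l : r1 < l by exact: (midf_lt ml).2.
have rhor1 : rho < r1 by apply: le_lt_trans mr; rewrite le_max lexx.
have y1r1 : enorm y1 < r1 by apply: le_lt_trans mr; rewrite le_max lexx orbT.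
have r10 : 0 < r1 by exact: lt_trans rhor1.
have hr1 : 0 < r1 < l by rewrite r10.
have K1 := kelvin_gt0 l0 lz y1i.
have U1 : 0 < U y1 by exact/posU/(inside_neq lz (ltW y1l)).
have D1 : 0 < D l y1.
  rewrite /D (conformalE l0 y1z) subr_gt0 gt0_ltr_powR ?nnegrE ?(ltW K1) ?(ltW U1)//.
  by rewrite -subr_gt0.
have D12 : 0 < D l y1 / 2 by rewrite divr_gt0.
have [r' r'0 Hr'] := continuous_ball (cont_excess l0 lz y1i) D12.
pose r := Num.min r' (r1 - enorm y1).
have r0 : 0 < r by rewrite lt_min r'0 subr_gt0.
have rr1 : enorm y1 + r <= r1 by rewrite -lerBrDl ge_min lexx orbT.
have [k k0 Hk] := riesz_fold_gt n0 al l0 hr1 r0 rr1.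
have [c [C [X [c0 cC _ cU FX]]]] := bounds l0 lz.
have [Y Y0 HY] := barrier_bound n2 s0 s1 l0 hr1.
have p10 : 0 <= p - 1 by rewrite subr_ge0 ltW.
pose f0 := k * (D l y1 / 2) * c `^ (p - 1).
have f00 : 0 < f0 by rewrite mulr_gt0 ?powR_gt0// mulr_gt0.
(* The barrier integral, the ball mass and the exit mass each contribute at most [c1 * Y]; the [+ 1]
   makes the final comparison with [f0] strict. *)
pose c1 := f0 / (kappa * (3 * Y + 1)).
have Y1 : 0 < 3 * Y + 1 by rewrite ltr_wpDl// mulr_ge0.
have c10 : 0 < c1 by rewrite divr_gt0// mulr_gt0.
pose eta v := c1 * cap r1 v.
have eta01 v : 0 <= eta v <= c1.
  by have /andP[h1 h2] := cap01 r1 v; rewrite mulr_ge0 ?(ltW c10)//= ger_pMr.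
have ceta v : {for v, continuous eta} by apply: contM; [exact: contc|exact: continuous_cap].
have meta : measurable_fun setT eta by apply: measurable_funM => //; exact: measurable_cap.
have etal v : r1 <= enorm v -> eta v = 0.
  move=> h; rewrite /eta /cap max_l ?mulr0// subr_le0 ler_pdivlMr ?exprn_gt0// mul1r.
  by rewrite lerXn2r// nnegrE ?enorm_ge0// ltW.
have D_ge0 v : enorm v < l -> v != 0 -> v != kinv l z -> 0 <= D l v.
  move=> vl v0 vz; have vi : inside l v by [].
  have /andP[_ UC] := cU v (ltW vl); have h := g_ge0 v vi; rewrite -oppr0 in h.
  by have := D_ge l0 lz vi (lexx 0) UC h; rewrite mulr0 oppr0.
have D_ball v : enorm (v - y1) < r -> v != 0 -> v != kinv l z -> D l y1 / 2 <= D l v.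
  rewrite lt_min => /andP[/Hr' + _] _ _; exact: half_le_near.
have aD v : v != 0 -> conformal l (D l) v = - D l v by exact: antiD.
have main v : inside l v -> eta v <= gap l v.
  move=> xi; rename v into x; rewrite leNgt; apply/negP => gx.
  have [xl x0 xz] := xi.
  have Px := pole_gap_ge0 n2 s0 s1 l0 lz xl x0 xz.
  have P1 : 0 < pole_gap l x + 1 by rewrite ltr_wpDl.
  pose e := (eta x - gap l x) / (pole_gap l x + 1) / 2.
  have e0 : 0 < e by rewrite divr_gt0 ?divr_gt0// subr_gt0.
  have Gx0 : G l e x - eta x < 0.
    rewrite GE subr_lt0 -ltrBrDl; apply: (@le_lt_trans _ _ (e * (pole_gap l x + 1))).
      by rewrite ler_wpM2l ?(ltW e0)// lerDl.
    rewrite /e mulrAC divfK ?gt_eqF//; rewrite ltr_pdivrMr// ltr_pMr ?subr_gt0//.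
    by rewrite ltr1n.
  have gM v : inside l v -> - c1 <= gap l v.
    by move=> vi; apply: le_trans (g_ge0 v vi); rewrite oppr_le0 ltW.
  have etasph v : enorm v = l -> eta v = 0 by move=> vl; apply: etal; rewrite vl ltW.
  have [y [yi yx ymin]] := gap_min l0 lz e0 ceta eta01 etasph gM xi Gx0.
  have [yl y0 yz] := yi.
  have Py := pole_gap_ge0 n2 s0 s1 l0 lz yl y0 yz.
  have Gy : G l e y < eta y by rewrite -subr_lt0 (le_lt_trans yx).
  have gy := g_ge0 y yi.
  have Gy0 : 0 <= G l e y by rewrite GE addr_ge0// mulr_ge0// ltW.
  have yr1 : enorm y < r1.
    by rewrite ltNge; apply/negP => /etal h; move: Gy; rewrite h ltNge Gy0.
  have Gc1 : G l e y <= c1.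
    by have /andP[_ h] := eta01 y; exact: (le_trans (ltW Gy)).
  have [HY1 HY2 HY3] := HY y yr1.
  have XI t : 0 < t -> t < l - enorm y -> Int (fun v => chi (enorm v < l) *
     (chi (t < enorm (v - y)) * ((eta y - eta v) * (Kq s (v - y) - Km s l y v)))) <= c1 * Y.
    move=> t0 _; have Ie := itg_eta n2 s0 s1 l0 yl (measurable_cap (n := n) r1) (cap01 (n := n) r1) t0.
    apply: (@le_trans _ _ (c1 * Int (fun v => chi (enorm v < l) *
      (chi (t < enorm (v - y)) * ((cap r1 y - cap r1 v) * (Kq s (v - y) - Km s l y v)))))).
      rewrite -(IntZ _ Ie); apply: eq_ler; apply: eq_Int => v.
      by rewrite /eta; move: (Kq _ _) (Km _ _ _ _) => A B; ring.
    by rewrite ler_pM2l// HY1.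
  have up := touching_bound l0 lz yi meta eta01 ymin XI.
  rewrite (max_l Gy0) in up.
  have low : f0 <= (riesz F y + riesz (D l) y) * kelvin l U y `^ (p - 1) - riesz F y * U y `^ (p - 1).
    have RD := Hk (D l) y (D l y1 / 2) 0 (kinv l z) yr1 (mD l0) (riesz_itg_gap l0 lz yi) aD
      (ltW D12) D_ge0 D_ball.
    have /andP[cUy _] := cU y (ltW yl); have /andP[F0y _] := FX y (ltW yl).
    have U0 : 0 < U y by exact: lt_le_trans cUy.
    have UK : U y <= kelvin l U y by rewrite -subr_ge0.
    have h1 : U y `^ (p - 1) <= kelvin l U y `^ (p - 1).
      by rewrite ge0_ler_powR// nnegrE ltW// (lt_le_trans U0).
    have h2 : c `^ (p - 1) <= kelvin l U y `^ (p - 1).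
      by apply: le_trans h1; rewrite ge0_ler_powR// nnegrE ltW.
    rewrite mulrDl addrAC -mulrBr; apply: ler_wpDl.
      by rewrite mulr_ge0// subr_ge0.
    by apply: ler_pM => //; [rewrite mulr_ge0 ?(ltW k0)// ltW|exact: powR_ge0].
  have := le_trans low up; apply/negP; rewrite -ltNge.
  have Ib0 : 0 <= Int (fun v => chi (enorm v < l) * Km s l y v).
    by apply: Int_ge0 => v; rewrite mulr_ge0 ?Km_ge0.
  have Ie0 : 0 <= exit_mass s l y.
    by apply: Int_ge0 => v; rewrite mulr_ge0 ?Kq_ge0.
  apply: (@le_lt_trans _ _ (kappa * (c1 * (3 * Y)))).
    rewrite ler_pM2l//.
    have -> : c1 * (3 * Y) = c1 * Y + c1 * Y + c1 * Y by ring.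
    exact: (lerD (lerD (lexx _) (ler_pM Gy0 Ib0 Gc1 HY2)) (ler_pM Gy0 Ie0 Gc1 HY3)).
  have -> : f0 = kappa * (c1 * (3 * Y + 1)).
    by rewrite /c1; field; rewrite !gt_eqF.
  by rewrite ltr_pM2l// ltr_pM2l// ltrDl.
exists (c1 * (1 - rho ^+ 2 / r1 ^+ 2)).
  rewrite mulr_gt0// subr_gt0 ltr_pdivrMr ?exprn_gt0// mul1r.
  by rewrite ltrXn2r// ltW.
move=> v vi vrho; apply: le_trans (main v vi); rewrite ler_pM2l//.
apply: (@le_trans _ _ (1 - enorm v ^+ 2 / r1 ^+ 2)); last by rewrite le_max lexx orbT.
rewrite lerD2l lerN2 ler_wpM2r ?invr_ge0 ?sqr_ge0//.
by rewrite lerXn2r// ?nnegrE ?enorm_ge0// ltW.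
Qed.

Definition sphere_below l := forall v, inside l v -> 0 <= gap l v.

(** This is where the singularity is used: if the gap vanished inside, inversion would give
    [U = kelvin l U] on a punctured neighbourhood of [z], and the right-hand side is continuous at
    [z]. *)
Let gap_gt0_ex l : 0 < l -> l < enorm z -> sphere_below l -> exists2 y, inside l y & 0 < gap l y.
Proof.
move=> l0 lz gl; apply: contrapT => H.
have gap0 v : inside l v -> U v = kelvin l U v.
  move=> vi; apply/eqP; rewrite eq_le -subr_ge0 gl//= -subr_le0 leNgt; apply/negP => gv.
  by apply: H; exists v.
have ze := kinv_inside l0 z0.
have zi : kinv l z != z by apply: (inside_neq lz); exact/ltW/image_pole_lt.
apply: (singU (f := kelvin l U)).
  exact: (continuous_kelvin l0 z0 (contU zi)).
have e0 : 0 < enorm z - l by rewrite subr_gt0.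
apply: filterS (near_enorm z e0) => x xz xnz.
have lx : l < enorm x by have := enormB_ge z x; rewrite enormBC; move: xz; exact: near_gt.
have x0 : x != 0 by rewrite -enorm_gt0; exact: lt_trans lx.
have xi : inside l (kinv l x).
  split; first exact: image_pole_lt.
    by rewrite kinv_eq0// gt_eqF.
  by apply: contra_neq xnz => /kinv_inj ->//; rewrite gt_eqF.
rewrite -[RHS](kelvinK s U l0 x0) /kelvin; congr (_ * _).
exact: gap0.
Qed.

(** The points [v] for radius [l] and [(l0 / l)^2 v] for radius [l0] have the same inverse image.
    The uncontrolled value of [U] there is thus common to both transforms, and changing the radius
    only moves points inside the ball. *)
Let kelvin_rescale l0 l v : 0 < l0 -> 0 < l -> v != 0 ->
  kelvin l U v = (l0 / l) `^ g * kelvin l0 U ((l0 / l) ^+ 2 *: v) /\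
  kinv l0 ((l0 / l) ^+ 2 *: v) = kinv l v.
Proof.
move=> l00 l_0 v0; have V0 : 0 < enorm v by rewrite enorm_gt0.
have t0 : 0 < l0 / l by exact: divr_gt0.
have E : kinv l0 ((l0 / l) ^+ 2 *: v) = kinv l v.
  rewrite !kinvE scalerA enormZ ger0_norm ?sqr_ge0//; congr (_ *: _).
  by field; rewrite !gt_eqF.
split=> //; rewrite /kelvin E mulrA -powRM ?divr_ge0 ?enorm_ge0 ?(ltW l00) ?(ltW l_0)//.
rewrite enormZ ger0_norm ?sqr_ge0//; congr (_ `^ _ * _).
by field; rewrite !gt_eqF.
Qed.

(** In [|v| <= rho] the positive lower bound [c] of the gap survives a small change of radius, and
    the remaining shell is thin enough for [narrow_region]. *)
Let continuation l0 l1 : 0 < l0 -> l0 <= l1 -> l1 < enorm z -> sphere_below l0 ->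
  exists2 e, 0 < e & forall l, l0 <= l -> l < l0 + e -> l <= l1 -> sphere_below l.
Proof.
move=> l00 l01 l1z gl0; have l0z := le_lt_trans l01 l1z; have l10 := lt_le_trans l00 l01.
have [d d0 Hd] := narrow_region l10 l1z.
have [y1 y1i gy1] := gap_gt0_ex l00 l0z gl0.
(* Half of the width [d] is kept as room for the growth of [l]; [l0 / 2] only ensures [rho > 0]. *)
pose rho := Num.max (l0 - d / 2) (l0 / 2).
have d20 : 0 < d / 2 by rewrite divr_gt0.
have rho0 : 0 < rho by rewrite lt_max divr_gt0 ?orbT.
have rhol0 : rho < l0.
  by rewrite gt_max gtrBl d20/= ltr_pdivrMr// ltr_pMr// ltr1n.
have hrho : 0 < rho < l0 by rewrite rho0.
have [c c0 Hc] := barrier_gap l00 l0z gl0 y1i gy1 hrho.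
pose A := [set v : 'rV[R]_n | enorm v <= rho].
have cA : compact A.
  apply: (compact_enorm_le (r := rho)) => //.
  have := @closed_enorm_le R n 0 rho; congr closed.
  by apply/seteqP; split=> v /=; rewrite subr0.
(* At [t = 1] this reads [0 < c]. Compactness makes it hold for [t] near 1 uniformly in [v]; it is
   used with [t = l0 / l]. *)
pose P (t : R) v := 0 < t `^ g * (U (t ^+ 2 *: v) + c) - U v.
have AP : forall v, A v -> \forall v' \near v & t \near (1 : R), P t v'.
  move=> v Av; have vz : v != z by apply: (inside_neq l0z); exact: (le_trans Av (ltW rhol0)).
  pose Q (x : 'rV[R]_n * R) := x.2 `^ g * (U (x.2 ^+ 2 *: x.1) + c) - U x.1.
  have c1 : {for (v, 1 : R), continuous (fun x : 'rV[R]_n * R => x.1)} by exact: cvg_fst.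
  have c2 : {for (v, 1 : R), continuous (fun x : 'rV[R]_n * R => x.2)} by exact: cvg_snd.
  have cQ : {for (v, 1 : R), continuous Q}.
    apply: (@contB _ _ _ R^o); last exact: (cont_comp (g := U) c1 (contU vz)).
    apply: contM; first by apply: cont_powR.
    apply: (@contD _ _ _ R^o); last exact: contc.
    apply: (cont_comp (f := fun x : 'rV[R]_n * R => x.2 ^+ 2 *: x.1)).
      by apply: contZ; [exact: contX|].
    by rewrite /= expr1n scale1r; exact: contU.
  have Q0 : 0 < Q (v, 1) by rewrite /Q /= powR1 expr1n scale1r mul1r addrAC subrr add0r.
  exact: (cvgr_gt _ cQ _ Q0).
have nc := (compact_near_coveringP A).1 cA _ _ P (nbhs_filter _) AP.
have [e' /= e'0 He'] := (nbhs_ballP (1 : R) _).1 nc.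
exists (Num.min (d / 2) (e' * l0)); first by rewrite lt_min d20 mulr_gt0.
move=> l l0l ll ll1; have l_0 := lt_le_trans l00 l0l; have lz := le_lt_trans ll1 l1z.
rewrite -ltrBlDl lt_min in ll; have /andP[lld lle] := ll.
apply: (Hd l l_0 ll1) => v vi vld; have [vl v0 vze] := vi.
have [E1 E2] := kelvin_rescale l00 l_0 v0.
set t := l0 / l in E1 E2.
have t0 : 0 < t by exact: divr_gt0.
have t1 : t <= 1 by rewrite ler_pdivrMr// mul1r.
have vrho : enorm v <= rho.
  by rewrite le_max; apply/orP; left; apply: (le_trans vld); exact: shift_le.
have te : `|1 - t| < e'.
  rewrite ger0_norm ?subr_ge0//.
  have -> : 1 - t = (l - l0) / l by rewrite /t; field; rewrite gt_eqF.
  rewrite ltr_pdivrMr//; apply: (lt_le_trans lle); rewrite ler_pM2l//.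
have Pv : P t v by exact: (He' t te v vrho).
have tv : enorm (t ^+ 2 *: v) <= enorm v.
  by rewrite enormZ ger0_norm ?sqr_ge0// ger_pMl ?enorm_gt0// expr_le1// ltW.
have vi' : inside l0 (t ^+ 2 *: v).
  split; first exact: (le_lt_trans tv (le_lt_trans vrho rhol0)).
    by rewrite scaler_eq0 negb_or v0 expf_neq0// gt_eqF.
  apply: contra_neq (kinv_neq_pole l_0 vze) => E.
  by rewrite -E2 E kinvK// gt_eqF.
have := Hc _ vi' (le_trans tv vrho); rewrite /gap E1 lerBrDr => h.
rewrite subr_ge0; apply: (@le_trans _ _ (t `^ g * (U (t ^+ 2 *: v) + c))).
  by rewrite -subr_ge0 ltW.
by rewrite ler_pM2l ?powR_gt0// addrC.
Qed.

(** For fixed [v] the gap is continuous in [l], and [v] stays inside the spheres of radius slightly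
    below [l0] and off their image poles. *)
Let closedness l0 : 0 < l0 -> l0 < enorm z -> (forall l, 0 < l -> l < l0 -> sphere_below l) ->
  sphere_below l0.
Proof.
move=> l00 l0z H v [vl v0 vze]; rewrite leNgt; apply/negP => gv.
have V0 : 0 < enorm v by rewrite enorm_gt0.
have kz := kinv_neq_pole l00 vze.
have ck : {for l0, continuous (fun l => kinv l v)}.
  rewrite (_ : (fun l => kinv l v) = (fun l => (l ^+ 2 / enorm v ^+ 2) *: v)); last first.
    by apply/funext => l; exact: kinvE.
  apply: contZ; last exact: contc.
  by apply: contM; [apply: contX; exact: cont_id|exact: contc].
have cg : {for l0, continuous (fun l => gap l v)}.
  apply: (@contB _ _ _ R^o); last exact: contc.
  have c2 : {for l0, continuous (fun l => U (kinv l v))}.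
    exact: (cont_comp (g := U) ck (contU kz)).
  apply: (contM _ c2); apply: cont_powR; first exact: divr_gt0.
  by apply: contM; [exact: cont_id|exact: contc].
have cz : {for l0, continuous (fun l => enorm (kinv l v - z))}.
  by apply: continuous_enorm; apply: contB => //; exact: contc.
have kz0 : 0 < enorm (kinv l0 v - z) by rewrite enorm_gt0 subr_eq0.
have [l] : exists l, [/\ l < l0, enorm v < l, gap l v < 0 & 0 < enorm (kinv l v - z)].
  near (l0^'-) => l; exists l; split.
  - by near: l; exact: nbhs_left_lt.
  - by near: l; exact: nbhs_left_gt.
  - by near: l; exact: (cvgr_lt _ (cvg_at_left_filter cg) _ gv).
  - by near: l; exact: (cvgr_gt _ (cvg_at_left_filter cz) _ kz0).
move=> [ll0 vll gl kl]; have l_0 := lt_trans V0 vll.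
have vi : inside l v.
  split=> //; apply/eqP => E; move: kl; rewrite E kinvK ?gt_eqF// subrr enorm0 ltxx.
  by [].
by have := H l l_0 ll0 v vi; rewrite leNgt gl.
Unshelve. all: by end_near. Qed.

Theorem moving_spheres l : 0 < l -> l < enorm z -> sphere_below l.
Proof.
move=> l10 l1z; set l1 := l in l10 l1z *; apply: contrapT => bad.
have [d d0 Hd] := narrow_region l10 l1z.
pose S := [set l | [/\ 0 < l, l <= l1 & forall l', 0 < l' -> l' <= l -> sphere_below l']].
(* For [l <= d / 2] the region [enorm v <= l - d] is empty, so [narrow_region] starts the process
   with nothing to check. *)
have S1 : S (Num.min (d / 2) l1).
  have d20 : 0 < d / 2 by rewrite divr_gt0.
  split; [by rewrite lt_min d20|by rewrite ge_min lexx orbT|].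
  move=> l' l'0; rewrite le_min => /andP[l'd l'1]; apply: (Hd l' l'0 l'1) => v _ vl.
  have := le_trans (enorm_ge0 v) vl; rewrite subr_ge0 leNgt (le_lt_trans l'd)//.
  by rewrite ltr_pdivrMr// ltr_pMr// ltr1n.
have Sn0 : S !=set0 by exists (Num.min (d / 2) l1).
have Sub : has_ubound S by exists l1 => x [].
pose l0 := sup S.
have l0_ge (x : R) : S x -> x <= l0 by exact: ub_le_sup.
have l00 : 0 < l0 by apply: lt_le_trans (l0_ge _ S1); case: S1.
have l01 : l0 <= l1 by apply: ge_sup => // x [].
have l0z := le_lt_trans l01 l1z.
have below (x : R) : 0 < x -> x < l0 -> sphere_below x.
  move=> x0 /(sup_gt Sn0)[y [_ _ H] xy]; exact: (H x x0 (ltW xy)).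
have at0 := closedness l00 l0z below.
have [l0E|l0n] := eqVneq l0 l1; first by apply: bad; rewrite -l0E.
have l0lt : l0 < l1 by rewrite lt_neqAle l0n.
have [e e0 He] := continuation l00 l01 l1z at0.
have e20 : 0 < e / 2 by rewrite divr_gt0.
have : S (Num.min (l0 + e / 2) l1).
  split; [by rewrite lt_min (addr_gt0 l00 e20)|by rewrite ge_min lexx orbT|].
  move=> x x0; rewrite le_min => /andP[xe x1].
  have [xl0|l0x] := ltP x l0; first exact: below.
  apply: He => //; apply: (le_lt_trans xe).
  by rewrite ltrD2l ltr_pdivrMr// ltr_pMr// ltr1n.
move=> /l0_ge; rewrite leNgt lt_min l0lt andbT ltrDl e20.
by [].
Qed.

End moving_spheres.

(** * Radial symmetry *)

Lemma lipschitz_shift (R : realType) n (f : 'rV[R]_n -> R) c y :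
  lipschitz_at f (y + c) -> lipschitz_at (fun v => f (v + c)) y.
Proof.
move=> [C [r [r0 H]]]; exists C, r; split=> // v vr.
have E : v + c - (y + c) = v - y by rewrite opprD addrACA subrr addr0.
by have := H (v + c); rewrite E; apply.
Qed.

Lemma continuous_shift (R : realType) n (f : 'rV[R]_n -> R) (c y : 'rV[R]_n) :
  {for y + c, continuous f} -> {for y, continuous (fun v : 'rV[R]_n => f (v + c))}.
Proof.
move=> cf; apply: (cont_comp (f := fun v : 'rV[R]_n => v + c)) => //.
by apply: contD; [exact: cont_id|exact: contc].
Qed.

Lemma continuous_near_eq (R : realType) (T : topologicalType) (f h : T -> R) x :
  {for x, continuous f} -> (\forall v \near x, f v = h v) -> {for x, continuous h}.
Proof.
move=> cf fh; have E : f x = h x by exact: nbhs_singleton fh.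
have cf' : f v @[v --> x] --> h x by rewrite -E; exact: cf.
by apply: cvg_trans cf'; exact: near_eq_cvg.
Qed.

Section hartree_solutions.
Context (R : realType) (n : nat) (s alpha : R).
Hypotheses (n2 : 2 <= n%:R :> R) (s0 : 0 < s) (s1 : s < 1) (al : 0 < alpha < n%:R).
Variable u : 'rV[R]_n -> R.
Local Notation p := (p_star n s alpha).
Local Notation g := (n%:R - 2 * s).
Local Notation kappa := (frac_laplacian_const n s).
Let F v := u v `^ p.
Hypotheses (hC11 : in_C11loc [set x | x != 0] u) (hLs : in_Ls s u).
Hypothesis hpos : forall x, x != 0 -> 0 < u x.
Hypothesis hsol : forall x, x != 0 -> solves_hartree s alpha u x.
Hypothesis hsing : ~ removable_at0 u.

Let n0 : (0 < n)%N. Proof. by rewrite -(ltr_nat R); apply: lt_le_trans n2. Qed.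

Let cont_u x : x != 0 -> {for x, continuous u}.
Proof. by move=> x0; apply: differentiable_continuous; exact: (hC11.1 x x0). Qed.

Let lip_u x : x != 0 -> lipschitz_at u x.
Proof.
move=> x0; have [C C0 H] := differentiable_near_lipschitz (hC11.1 x x0).
have [r r0 Hr] := (nbhs_enormP _ _).2 H.
exists C, r; split=> // v /Hr h; apply: (le_trans h).
by rewrite ler_wpM2l ?(ltW C0)// norm_le_enorm.
Qed.

Let mu : measurable_fun setT u. Proof. by case: hLs. Qed.

Let mF : measurable_fun setT F. Proof. exact: measurable_powRf. Qed.

Let tail_u x : tail_integrable s u x. Proof. exact: in_Ls_tail_integrable. Qed.

Let hartree x : x != 0 -> riesz_itg alpha F x /\ exists2 I : R,
  trunc_lap s e u x @[e --> 0^'+] --> I & kappa * I = riesz alpha F x * u x `^ (p - 1).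
Proof.
move=> x0; have [L uL E] := hsol x0.
have [I uI LE] := is_frac_laplacian_cvg n2 s0 s1 (tail_u x) uL.
have U0 : 0 < u x `^ (p - 1) by rewrite powR_gt0// hpos.
have convE : convolution (riesz_kernel alpha) F x =
    (\int[lebesgue_rV R n]_v (Ka alpha (v - x) * F v)%:E)%E.
  by apply: eq_integral => v _; rewrite /Ka /riesz_kernel (enormBC x).
have c0 : (0 <= \int[lebesgue_rV R n]_v (Ka alpha (v - x) * F v)%:E)%E.
  by apply: integral_ge0 => v _; rewrite lee_fin mulr_ge0 ?Ka_ge0 ?powR_ge0.
rewrite -/F convE in E.
(* An infinite potential times a positive number would be infinite, whereas the left-hand side of
   the equation is real. *)
have coo : (\int[lebesgue_rV R n]_v (Ka alpha (v - x) * F v)%:E < +oo)%E.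
  rewrite ltey; apply/eqP => coo; move: E; rewrite coo.
  by rewrite gt0_mulye// lte_fin.
have Ix : riesz_itg alpha F x.
  apply: itg_lty; first by apply: measurable_funM; [exact: measurable_Ka|exact: mF].
  have absE v : `|Ka alpha (v - x) * F v| = Ka alpha (v - x) * F v.
    by apply: ger0_norm; apply: mulr_ge0; [exact: Ka_ge0|exact: powR_ge0].
  under eq_integral => v _ do rewrite absE.
  exact: coo.
split; first exact: Ix.
exists I; first exact: uI.
apply: EFin_inj; rewrite -LE E EFinM; congr (_ * _)%E.
by rewrite -(Int_EFin Ix).
Qed.

Let riesz_gt0 x : x != 0 -> 0 < riesz alpha F x.
Proof.
move=> x0; have [Ix _] := hartree x0.
(* Any point other than [0] and [x] would do: there the integrand is continuous and positive. *)
pose w := 2 *: x; pose f v := Ka alpha (v - x) * F v.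
have w0 : w != 0 by rewrite scaler_eq0 negb_or x0 andbT pnatr_eq0.
have wx : w - x = x by rewrite /w scaler_nat mulr2n addrK.
have f0 v : 0 <= f v by rewrite mulr_ge0 ?Ka_ge0 ?powR_ge0.
have fw : 0 < f w by rewrite mulr_gt0// /Ka /F ?wx powR_gt0 ?hpos ?enorm_gt0.
have cf : {for w, continuous f}.
  apply: contM; apply: cont_powR; rewrite ?wx ?enorm_gt0 ?hpos//.
    exact: continuous_enormB.
  exact: cont_u.
have fw2 : 0 < f w / 2 by rewrite divr_gt0.
have [r r0 Hr] := continuous_ball cf fw2.
have h : 0 < f w / 2 * (r ^+ n * unit_ball_volume R n).
  by rewrite mulr_gt0// mulr_gt0 ?exprn_gt0 ?unit_ball_volume_gt0.
apply: (lt_le_trans h); rewrite -(Int_ball w r0) -(IntZ _ (itg_ball w r)).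
apply: (Int_le (itgZ _ (itg_ball w r)) Ix) => v.
case: (ltP (enorm (v - w)) r) => vr; last by rewrite mulr0 f0.
by rewrite mulr1; exact: (half_le_near (Hr v vr)).
Qed.

Let Gamma_ge0 (a : R) : 0 <= Gamma a.
Proof.
apply: fine_ge0; apply: integral_ge0 => t _.
by rewrite lee_fin mulr_ge0 ?powR_ge0 ?expR_ge0.
Qed.

(** No positivity of [Gamma] is computed: the constant is nonnegative, and it is not zero because
    the right-hand side of the equation is positive. *)
Let kappa_gt0 (x : 'rV[R]_n) : x != 0 -> 0 < kappa.
Proof.
move=> x0; have [_ [I _ E]] := hartree x0.
have k0 : 0 <= kappa.
  by rewrite /frac_laplacian_const !mulr_ge0 ?invr_ge0 ?powR_ge0 ?Gamma_ge0// ltW.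
rewrite lt_def k0 andbT; apply/eqP => kE; move: E; rewrite kE mul0r => /esym/eqP.
by rewrite gt_eqF// mulr_gt0 ?riesz_gt0// powR_gt0 ?hpos.
Qed.

Let not_removable c : c != 0 -> forall f : 'rV[R]_n -> R, {for - c, continuous f} ->
  (\forall v \near (- c), v != - c -> f v = u (v + c)) -> False.
Proof.
move=> c0 f cf fu; apply: hsing.
exists (fun x => if x == 0 then f (- c) else u x); last by move=> x /negbTE ->.
have [r r0 Hr] := (nbhs_enormP _ _).2 fu.
move=> x; have [->|x0] := eqVneq x 0.
  have cs : {for 0, continuous (fun v : 'rV[R]_n => f (v - c))}.
    by apply: continuous_shift; rewrite add0r.
  apply: (continuous_near_eq cs).
  apply: filterS (near_enorm 0 r0) => v vr.
  have [->|v0] := eqVneq v 0; first by rewrite sub0r.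
  have E : v - c - - c = v by rewrite opprK subrK.
  have vr' : enorm (v - c - - c) < r by rewrite E; rewrite subr0 in vr.
  have vc : v - c != - c by rewrite -subr_eq0 E.
  by rewrite (Hr _ vr' vc) subrK.
apply: (continuous_near_eq (cont_u x0)); have x00 : 0 < enorm x by rewrite enorm_gt0.
apply: filterS (near_enorm x x00) => v vr; case: eqP => // v0.
by move: vr; rewrite v0 sub0r enormN ltxx.
Qed.

Lemma kelvin_comparison (c v : 'rV[R]_n) l : c != 0 -> 0 < l -> l < enorm c -> enorm v < l ->
  v != 0 -> v != kinv l (- c) -> u (v + c) <= (l / enorm v) `^ g * u (kinv l v + c).
Proof.
move=> c0 l0 lc vl v0 vc.
have lz : l < enorm (- c) by rewrite enormN.
have z0 : - c != 0 by rewrite oppr_eq0.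
have shift0 x : x != - c -> x + c != 0 by rewrite -(subr_eq0 x) opprK.
have mU : measurable_fun setT (fun x : 'rV[R]_n => u (x + c)).
  by case: (tail_integrable_shift (tail_u (0 + c))).
have tU x : x != - c -> tail_integrable s (fun x : 'rV[R]_n => u (x + c)) x.
  by move=> _; exact: (tail_integrable_shift (tail_u (x + c))).
have cU x : x != - c -> {for x, continuous (fun x : 'rV[R]_n => u (x + c))}.
  by move=> /shift0 h; exact: (continuous_shift (cont_u h)).
have lU x : x != - c -> lipschitz_at (fun x : 'rV[R]_n => u (x + c)) x.
  by move=> /shift0 h; exact: (lipschitz_shift (lip_u h)).
have pU x : x != - c -> 0 < u (x + c) by move=> /shift0; exact: hpos.
have KE x v' : Ka alpha (v' + c - (x + c)) = Ka alpha (v' - x).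
  by rewrite opprD addrACA subrr addr0.
have IU x : x != - c -> riesz_itg alpha (fun x : 'rV[R]_n => u (x + c) `^ p) x.
  move=> /shift0/hartree[h _]; apply: eq_itg (itg_shift c h) => v'.
  by rewrite KE.
have eU x : x != - c -> exists2 I : R,
    trunc_lap s e (fun x : 'rV[R]_n => u (x + c)) x @[e --> 0^'+] --> I &
    kappa * I = riesz alpha (fun x : 'rV[R]_n => u (x + c) `^ p) x * u (x + c) `^ (p - 1).
  move=> /shift0 x0; have [Ix [I uI IE]] := hartree x0; exists I.
    apply: (at_right0_eq uI) => e e0; apply: esym.
    exact: (trunc_lap_shift n2 s0 s1 e0 (tail_u (x + c))).
  rewrite IE; apply: (congr1 (fun r => r * u (x + c) `^ (p - 1))); apply: (etrans (Int_shift c Ix)).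
  by apply: eq_Int => v'; rewrite KE.
have h := moving_spheres n2 s0 s1 al (kappa_gt0 c0) z0 mU tU cU lU pU IU eU (not_removable c0) l0 lz.
by have := h v (And3 vl v0 vc); rewrite /gap subr_ge0.
Qed.
End hartree_solutions.

(** The centre is sent to infinity through [1 / t], so the limit becomes the continuity at [t = 0]
    of an explicit [f] with [f 0 = u a]. For small [t > 0] the comparison says exactly [f t <= u b],
    the Kelvin weight having been moved to the left. *)
Lemma compare_reflected (R : realType) (n : nat) (g : R) (u : 'rV[R]_n -> R) (a b : 'rV[R]_n) :
  a != 0 -> b != 0 -> enorm a = enorm b -> {for a, continuous u} ->
  (forall (c v : 'rV[R]_n) l, c != 0 -> 0 < l -> l < enorm c -> enorm v < l ->
    v != 0 -> v != kinv l (- c) -> u (v + c) <= (l / enorm v) `^ g * u (kinv l v + c)) ->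
  u a <= u b.
Proof.
move=> a0 b0 ab cu H; have [->//|anb] := eqVneq a b.
pose e := a - b; have e0 : e != 0 by rewrite subr_eq0.
have E0 : 0 < enorm e by rewrite enorm_gt0.
(* The only use of [ab]: [a] and [b] are mirror images in the hyperplane through [0] orthogonal to
   [e]. *)
have be : dot b e = - (enorm e ^+ 2) / 2.
  have : enorm a ^+ 2 = enorm b ^+ 2 by rewrite ab.
  by rewrite !enorm_sqr /e !dotE (dotC b a); lra.
have aE : b + e = a by rewrite subrKC.
clearbody e; pose N (t : R) := enorm (t *: b - e).
have N2 t : N t ^+ 2 = t ^+ 2 * enorm b ^+ 2 + t * enorm e ^+ 2 + enorm e ^+ 2.
  by rewrite /N enorm_sqr !dotE (dotC e b) be -!enorm_sqr; field.
pose rho t := (enorm e - t ^+ 2) ^+ 2 / N t ^+ 2.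
(* This is [(1 - rho t) / t] with the factor [t] cancelled, which makes it continuous at 0. *)
pose sg t := (t * enorm b ^+ 2 + enorm e ^+ 2 + 2 * t * enorm e - t ^+ 3) / N t ^+ 2.
pose f t := ((enorm e - t ^+ 2) / N t) `^ g * u (rho t *: b + sg t *: e).
have N0 : N 0 = enorm e by rewrite /N scale0r sub0r enormN.
have E20 : enorm e ^+ 2 != 0 by rewrite expf_neq0// gt_eqF.
have rho0 : rho 0 = 1 by rewrite /rho N0 expr0n subr0 divff.
have sg0 : sg 0 = 1 by rewrite /sg N0 !expr0n mulr0 !mul0r add0r addr0 subr0 divff.
have f0 : f 0 = u a.
  by rewrite /f rho0 sg0 N0 expr0n subr0 divff ?gt_eqF// powR1 mul1r !scale1r aE.
have cN : {for (0 : R), continuous N}.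
  apply: continuous_enorm; apply: contB; last exact: contc.
  by apply: contZ; [exact: cont_id|exact: contc].
have cN2 : {for (0 : R), continuous (fun t => (N t ^+ 2)^-1)}.
  by apply: contV; [rewrite N0|exact: contX].
have cE : {for (0 : R), continuous (fun t : R => enorm e - t ^+ 2)}.
  by apply: (@contB _ _ _ R^o); [exact: contc|apply: contX; exact: cont_id].
have cf : {for (0 : R), continuous f}.
  apply: contM.
    apply: cont_powR; first by rewrite expr0n subr0 N0 divff ?gt_eqF.
    by apply: contM => //; apply: contV => //; rewrite N0 gt_eqF.
  apply: (cont_comp (f := fun t : R => rho t *: b + sg t *: e)); last first.
    by rewrite rho0 sg0 !scale1r aE.
  apply: contD; (apply: contZ; last exact: contc); apply: contM => //; first exact: contX.
  apply: (@contB _ _ _ R^o); last by apply: contX; exact: cont_id.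
  apply: (@contD _ _ _ R^o).
    apply: (@contD _ _ _ R^o); last exact: contc.
    by apply: contM; [exact: cont_id|exact: contc].
  by apply: contM; [apply: contM; [exact: contc|exact: cont_id]|exact: contc].
(* For [c = e / t] and [l = |c| - t], the inversion in the sphere of radius [l]
   about [c] maps [b] to [rho t *: b + sg t *: e], which tends to [a]. *)
rewrite -f0; apply: (cvgr_to_le (cvg_at_right_filter cf)); near=> t.
have t0 : 0 < t by near: t; exact: nbhs_right_gt.
have t1 : t < 1 by near: t; exact: nbhs_right_lt.
have te : t < enorm e by near: t; exact: nbhs_right_lt.
have t2 : t ^+ 2 < enorm e by apply: lt_trans te; rewrite expr2 gtr_pMr.
have B0 : 0 < enorm b by rewrite enorm_gt0.
have NE : enorm e < N t.
  rewrite -(@ltr_pXn2r _ 2)// ?nnegrE ?enorm_ge0// N2 ltrDr.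
  by rewrite addr_gt0// mulr_gt0// exprn_gt0.
have Nt0 : 0 < N t by exact: lt_trans NE.
pose c := t^-1 *: e; pose l := (enorm e - t ^+ 2) / t.
pose w := b - c; pose v := kinv l w.
have wE : w = t^-1 *: (t *: b - e) by rewrite scalerBr scalerA mulVf ?gt_eqF// scale1r.
have wn : enorm w = N t / t by rewrite wE enormZ gtr0_norm ?invr_gt0// mulrC.
have l0 : 0 < l by rewrite divr_gt0// subr_gt0.
have cn : enorm c = enorm e / t by rewrite enormZ gtr0_norm ?invr_gt0// mulrC.
have lc : l < enorm c by rewrite cn ltr_pM2r ?invr_gt0// gtrBl exprn_gt0.
have lw : l < enorm w.
  by apply: (lt_trans lc); rewrite cn wn ltr_pM2r ?invr_gt0.
have w0 : 0 < enorm w by exact: lt_trans lw.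
have vw : kinv l v = w by rewrite kinvK// gt_eqF.
have vn : enorm v = l ^+ 2 / enorm w by exact: enorm_kinv.
have vl : enorm v < l by rewrite vn ltr_pdivrMr// expr2 ltr_pM2l.
have v0 : v != 0 by rewrite kinv_eq0 ?gt_eqF// -enorm_gt0.
have c0 : c != 0 by rewrite -enorm_gt0 cn divr_gt0.
have vc : v != kinv l (- c).
  apply/eqP => /(kinv_inj (lt0r_neq0 l0))/eqP; rewrite -subr_eq0 opprK subrK.
  by rewrite (negbTE b0).
have h := H c v l c0 l0 lc vl v0 vc; rewrite vw subrK in h.
have lvE : l / enorm v = (l / enorm w)^-1 by rewrite vn; field; rewrite !gt_eqF.
have lwE : l / enorm w = (enorm e - t ^+ 2) / N t by rewrite wn /l; field; rewrite !gt_eqF.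
have pE : v + c = rho t *: b + sg t *: e.
  have -> : v = rho t *: w.
    by rewrite /v kinvE -exprVn -exprMn lwE exprMn exprVn.
  rewrite /w scalerBr -addrA; congr (_ + _).
  rewrite /c scalerA addrC -scalerBl; congr (_ *: _).
  rewrite /sg /rho N2; field; rewrite gt_eqF//=.
  by rewrite exprMn -N2 exprn_gt0.
have q0 : 0 < l / enorm w by rewrite divr_gt0.
rewrite /f -lwE -pE.
have : (l / enorm w) `^ g * u (v + c) <= (l / enorm w) `^ g * ((l / enorm v) `^ g * u b).
  by rewrite ler_wpM2l ?powR_ge0.
rewrite lvE mulrA -powRM ?(ltW q0) ?invr_ge0 ?(ltW q0)// divff ?gt_eqF// powR1 mul1r.
by [].
Unshelve. all: by end_near. Qed.

Theorem theorem1p1 (R : realType) (n : nat) (hn : (2 <= n)%N)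
  (s : R) (hs : 0 < s < 1) (alpha : R) (halpha : 0 < alpha < n%:R)
  (u : 'rV[R]_n -> R)
  (hC11 : in_C11loc [set x | x != 0] u)
  (hLs : in_Ls s u)
  (hL1 : in_L1loc u)
  (hpos : forall x, x != 0 -> 0 < u x)
  (hsol : forall x, x != 0 -> solves_hartree s alpha u x)
  (hsing : ~ removable_at0 u) :
  radially_symmetric u.
Proof.
have /andP[s0 s1] := hs.
have n2 : (2 : R) <= n%:R by rewrite ler_nat.
have H := kelvin_comparison n2 s0 s1 halpha hC11 hLs hpos hsol hsing.
have cu x : x != 0 -> {for x, continuous u}.
  by move=> x0; apply: differentiable_continuous; exact: (hC11.1 x x0).
move=> a b ab; have [a0|a0] := eqVneq a 0.
  suff -> : b = 0 by rewrite a0.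
  by apply/eqP; rewrite -enorm_eq0 -ab a0 enorm0.
have b0 : b != 0 by rewrite -enorm_gt0 -ab enorm_gt0.
apply/eqP; rewrite eq_le; apply/andP; split.
  exact: (compare_reflected a0 b0 ab (cu a a0) H).
exact: (compare_reflected b0 a0 (esym ab) (cu b b0) H).
Qed.
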